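(* Let $d=1$, and let $X_t$ denote the position of the walker at time $t$ (with $X_0=0$). (i) For any deterministic initial configuration of arrows, the dynamics of the M1 model are ballistic. In particular, $$\liminf_{t\to\infty}\frac{|X_t|}{t}\ \ge\ \frac13\qquad\text{with probability }1 .$$ (ii) With the initial configuration of arrows distributed according to $\pi_1$, the M2 model is the true self-avoiding walk. In particular, with $E(t)=\mathbb{E}[|X_t|^2]$, there are constants $C,D>0$ such that $$C\,t^{4/3}\le E(t)\le D\,t^{4/3}.$$
   Context: Here $\mathbb{Z}_\star=\mathbb{Z}\cup\{\star\}$, where $\star$ is an extra symbol indexing the arrow held in the walker's hand. A state is $\omega\in\Omega=\{-1,+1\}^{\mathbb{Z}_\star}$: $\omega(x)$, $x\in\mathbb{Z}$, is the arrow at the site at displacement $x$ from the walker, and $\omega(\star)$ is the arrow in the hand. The measure $\pi_1$ is the product measure on $\Omega$ under which all arrows, including the one in the hand, are i.i.d. uniform on $\{-1,+1\}$. Maps on $\Omega$: the shift $\tau_\star$ given by $\tau_\star\omega(x)=\omega(x+\omega(\star))$ for $x\ne\star$ and $\tau_\star\omega(\star)=\omega(\star)$; the swap $\sigma$, which exchanges the values $\omega(0)$ and $\omega(\star)$ and leaves the others unchanged. M1 model: the environment process seen from the walker has generator $Gf(\omega)=f(\sigma\tau_\star\omega)-f(\omega)$; that is, at rate 1 the walker steps in the direction of its hand arrow and then swaps the hand arrow and the arrow at its new site. M2 model: the environment process has generator $\widetilde Gf(\omega)=\tfrac14 f(\tau_\star\omega)+\tfrac14 f(\sigma\tau_\star\omega)+\tfrac14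 f(\tau_\star\sigma\omega)+\tfrac14 f(\sigma\tau_\star\sigma\omega)-f(\omega)$; that is, at rate 1 the hand and site arrows are swapped with probability $1/2$, then the walker steps in the direction of the arrow now in its hand, then the hand and site arrows are again swapped with probability $1/2$, all swaps being independent. The expectation in $E(t)$ is over both the random initial configuration and the dynamics. True self-avoiding walk (TSAW; B. Tóth, 1995): the one-dimensional nearest-neighbour walk repelled by its own edge local time. In the form relevant here, with $t$ counting jumps, each edge $(x,x+1)$ carries a value $\ell_t(x,x+1)$ that increases by one every time the walker crosses that edge in either direction, and with $\nabla\ell_t(x)=\ell_t(x,x+1)-\ell_t(x-1,x)$ the walk obeys $\mathbb{P}(X_{t+1}=x\pm1\mid X_t=x)=1/2$ if $\nabla\ell_t(x)=0$, $=1$ if $\nabla\ell_t(x)=\mp2$, and $=0$ if $\nabla\ell_t(x)=\pm2$. In the M2 model the initial profile $\ell_0$ is the one whose negative gradient is the initial arrow configuration (at the walker's site, the sum of the hand and site arrows).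
   Formalization: The bounds C t^{4/3} ≤ E(t) ≤ D t^{4/3} are proved for t ≥ 1; in continuous time E(t) behaves like t as t → 0, so the upper bound cannot hold for all small t > 0. *)

(* Defs.v *)
From HB Require Import structures.
From mathcomp Require Import all_boot all_order all_algebra finmap.
From mathcomp Require Import all_classical all_reals all_analysis.
From mathcomp Require Import ring.
Import Order.TTheory GRing.Theory Num.Theory.
Import numFieldNormedType.Exports.
Set Implicit Arguments.
Unset Strict Implicit.
Unset Printing Implicit Defensive.
Local Open Scope classical_set_scope.
Local Open Scope ring_scope.

(** * Arrow configurations *)

(* [None] is the extra symbol indexing the hand arrow, and [Some x] the site at
   displacement [x] from the walker; an arrow [true] is +1, [false] is -1. *)
Definition config := option int -> bool.

Definition arrow (b : bool) : int := if b then 1 else -1.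

Definition shift (om : config) : config := fun x =>
  if x is Some y then om (Some (y + arrow (om None))) else om None.

Definition swap (om : config) : config := fun x =>
  match x with
  | None => om (Some 0)
  | Some y => if y == 0 then om None else om (Some y)
  end.

Definition swap_if (b : bool) (om : config) : config :=
  if b then swap om else om.

Definition M1_step (om : config) : config := swap (shift om).

(* [b] and [a] decide the swaps made before and after the walker's step. *)
Definition M2_step (b a : bool) (om : config) : config :=
  swap_if a (shift (swap_if b om)).

Definition M1_generator (R : realType) (f : config -> R) (om : config) : R :=
  f (swap (shift om)) - f om.

Definition M2_generator (R : realType) (f : config -> R) (om : config) : R :=
  4^-1 * f (shift om) + 4^-1 * f (swap (shift om))
  + 4^-1 * f (shift (swap om)) + 4^-1 * f (swap (shift (swap om))) - f om.

Lemma M1_generatorE (R : realType) (f : config -> R) (om : config) :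
  M1_generator f om = f (M1_step om) - f om.
Proof. by []. Qed.

Lemma M2_generatorE (R : realType) (f : config -> R) (om : config) :
  M2_generator f om =
  \sum_(b : bool) \sum_(a : bool) 2^-1 * 2^-1 * f (M2_step b a om) - f om.
Proof.
rewrite /M2_generator !big_bool /M2_step /=.
by field.
Qed.

(** * Jump chains: environment seen from the walker, and walker's position *)

Fixpoint M1_chain (om : config) (n : nat) : config * int :=
  if n is m.+1 then
    let: (eta, x) := M1_chain om m in (M1_step eta, x + arrow (eta None))
  else (om, 0).

Fixpoint M2_chain (om : config) (b a : nat -> bool) (n : nat) : config * int :=
  if n is m.+1 then
    let: (eta, x) := M2_chain om b a m in
    (M2_step (b m) (a m) eta, x + arrow (swap_if (b m) eta None))
  else (om, 0).

(** * Continuous time *)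

(* Number of jumps made up to time [t] when the successive holding times are
   [h 0, h 1, ...]: the least [n] with [t < h 0 + ... + h n].  The default
   value 0 only occurs when the holding times have a bounded sum, which has
   probability 0 for i.i.d. exponential holding times. *)
Definition jump_count (R : realType) (h : nat -> R) (t : R) : nat :=
  match pselect (exists n, t < \sum_(k < n.+1) h k) with
  | left ex => ex_minn ex
  | right _ => 0%N
  end.

Definition M1_position (R : realType) (om : config) (h : nat -> R) (t : R)
    : int :=
  (M1_chain om (jump_count h t)).2.

Definition M2_position (R : realType) (om : config) (b a : nat -> bool)
    (h : nat -> R) (t : R) : int :=
  (M2_chain om b a (jump_count h t)).2.

(** * The driving randomness *)

Section Randomness.
Context (d : measure_display) (T : measurableType d) (R : realType)
  (P : probability T R).

Definition mutually_independent (I : choiceType) (F : I -> set (set T)) : Prop :=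
  forall (J : {fset I}) (A : I -> set T),
    (forall i, i \in J -> F i (A i)) ->
    P (\bigcap_(i in [set` J]) A i) = (\prod_(i <- J) P (A i))%E.

Definition sigma_rv (d' : measure_display) (T' : measurableType d')
    (X : T -> T') : set (set T) :=
  preimage_set_system setT X measurable.

Definition fair (X : {RV P >-> bool}) : Prop :=
  forall A, distribution P X A = bernoulli_prob (2^-1 : R) A.

Definition exp1 (X : {RV P >-> R}) : Prop :=
  forall A, measurable A -> distribution P X A = exponential_prob (1 : R) A.

Definition rate1_clock (h : nat -> {RV P >-> R}) : Prop :=
  (forall n, exp1 (h n)) /\ mutually_independent (fun n => sigma_rv (h n)).

Definition M2_sigma (om : option int -> {RV P >-> bool})
    (b a : nat -> {RV P >-> bool}) (h : nat -> {RV P >-> R})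
    (i : option int + nat + nat + nat) : set (set T) :=
  match i with
  | inl (inl (inl x)) => sigma_rv (om x)
  | inl (inl (inr n)) => sigma_rv (b n)
  | inl (inr n) => sigma_rv (a n)
  | inr n => sigma_rv (h n)
  end.

(* Initial configuration of law pi_1 (i.i.d. uniform arrows, hand included),
   swap decisions and holding times, all mutually independent. *)
Definition M2_noise (om : option int -> {RV P >-> bool})
    (b a : nat -> {RV P >-> bool}) (h : nat -> {RV P >-> R}) : Prop :=
  [/\ forall x, fair (om x), forall n, fair (b n), forall n, fair (a n),
      forall n, exp1 (h n) & mutually_independent (M2_sigma om b a h)].

(** * The true self-avoiding walk *)

(* A profile [l : int -> int] gives the edge (x, x+1) the value [l x]. *)
Definition grad (l : int -> int) (x : int) : int := l x - l (x - 1).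

Definition crosses (x y z : int) : bool :=
  (y == x) && (z == x + 1) || (y == x + 1) && (z == x).

Definition profile (l0 : int -> int) (X : nat -> int) (n : nat) (x : int)
    : int :=
  l0 x + \sum_(m < n) (crosses x (X m) (X m.+1) : nat)%:Z.

(* Probability of a step [s] in {-1, +1} from a site where the gradient of the
   profile is [g] in {-2, 0, 2}. *)
Definition tsaw_prob (s g : int) : R :=
  if g == 0 then 2^-1 else (g == - 2%:Z * s)%:R.

(* Only the gradient of the initial profile matters, an additive constant in
   the profile being irrelevant to the walk. *)
Definition tsaw_history (l0 : T -> int -> int) (X : nat -> T -> int) (n : nat)
    : set (set T) :=
  <<s [set A | exists x k, A = [set w | grad (l0 w) x = k]] `|`
      [set A | exists m x, (m <= n)%N /\ A = [set w | X m w = x]] >>.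

(* The transition rule, conditionally on the history [tsaw_history l0 X n]. *)
Definition is_TSAW (l0 : T -> int -> int) (X : nat -> T -> int) : Prop :=
  let g n w x := grad (profile (l0 w) (X ^~ w) n) x in
  [/\ forall n, tsaw_history l0 X n `<=` measurable,
      forall w, X 0%N w = 0,
      forall n w, g n w (X n w) \in [:: -2%:Z; 0; 2%:Z] &
      forall (n : nat) (E : set T) (x s k : int),
        tsaw_history l0 X n E -> s \in [:: -1; 1] ->
        k \in [:: -2%:Z; 0; 2%:Z] ->
        let H := E `&` [set w | X n w = x /\ g n w x = k] in
        P (H `&` [set w | X n.+1 w = x + s]) = (P H * (tsaw_prob s k)%:E)%E].

End Randomness.

(* Total drift of the arrows at absolute site [x] at time 0; the walker, at the
   origin, holds the hand arrow there. *)
Definition arrows_at (om : config) (x : int) : int :=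
  if x == 0 then arrow (om (Some 0)) + arrow (om None) else arrow (om (Some x)).

(* Main.v *)
Require Import Defs.
From mathcomp Require Import all_boot all_order all_algebra finmap.
From mathcomp Require Import all_classical all_reals all_analysis.
From mathcomp Require Import measurable_realfun.
From mathcomp Require Import ring lra zify.
Import Order.TTheory GRing.Theory Num.Theory.
Import numFieldNormedType.Exports.
Set Implicit Arguments.
Unset Strict Implicit.
Unset Printing Implicit Defensive.
Local Open Scope classical_set_scope.
Local Open Scope ring_scope.

Local Notation shift := Defs.shift.

(** ** Why the walk is ballistic in M1 and of order t^(2/3) in M2

    M1. Call a configuration aligned in direction s when the hand arrow and the
    arrow under the walker both point to s.  From an aligned state one step to
    s meets either an arrow s, and the new state is aligned again, or an arrow
    -s, and then the walker goes back, returns, and is aligned one site further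
    on after three steps ([aligned_step]).  An aligned state appears within
    three steps ([aligned_soon]), so after n jumps the walker is at distance at
    least n/3 up to a constant ([M1_ballistic]).  The exponential clock makes
    at least t(1 - o(1)) jumps by time t, by a Chernoff bound and
    Borel-Cantelli, which gives the speed 1/3.

    M2 and the true self-avoiding walk. Minus the gradient of the profile at a
    site is the total drift of the arrows there: crossing an edge raises the
    profile there, and carries the arrow just used from one end of the edge to
    the other, which changes the drift accordingly ([profile_env]).  At
    gradient 0 the hand and site arrows are opposite, and the first swap coin
    chooses between them independently of the past; at gradient -2 or 2 they
    agree and the step is forced ([M2_is_TSAW]).

    Upper bound. Let the walk start at 0 and stop when it hits L > 0.  Edge
    (x, x+1) with 0 <= x < L has been crossed 2e+1 times for some e >= 0, and
    conditionally on the arrows e performs, as x decreases from L-1, a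
    reflected walk driven by the arrow at each site and by one fair coin.  This
    discrete Ray-Knight description suggests an explicit potential V, the
    expectation of q to the number of crossings still to come of the edges of
    [0, L], and the inequality q Q V <= V for the one step operator Q is
    checked directly ([potential_super]).  The probability of reaching L within
    n steps is thus at most q^(-n) times V at the origin, and averaging V over
    the arrows turns it into the L-th power of the operator
    k |-> q^(2e+1) (k(e-1)/4 + k(e)/2 + k(e+1)/4)
    ([mean_potential]).  With q = exp(-s^3), an explicit supersolution shows
    that each power costs a factor 1 - s^2/200 ([supersolution_ineq]).  For
    s = n^(-1/3), the displacement after n steps has an exponential tail on the
    scale n^(2/3) ([msd_upper]).

    Lower bound. Under pi_1 the profile seen from the origin is a random walk,
    up to its step at the walker's site, and pi_1 is stationary for M2
    ([mean_iter_step_op]), so the profile seen from the walker at time N has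
    the same law.  The number of crossings of an edge is the difference of the
    two, hence changes only by O(N^(1/3)) over N^(2/3) sites ([mean_hsq],
    [ltime_comparison]).  Were the walk to spend most of N steps within
    kappa N^(2/3) of the origin, the edges there would be crossed many times,
    and by comparison so would all edges in a box of size N^(2/3), more than N
    crossings in all.  So the mean square displacement is of order N^(4/3) at
    some time before N ([msd_large_somewhere]).  Stationarity and the triangle
    inequality give msd(jn) <= j^2 msd(n) ([msd_mul]), which with the upper
    bound carries the estimate to every time ([msd_lower]).

    Continuous time. The clock is independent of arrows and coins, so the mean
    square displacement at time t is the average of msd(n) over the law of the
    number n of jumps ([M2_msdE]), which is of order t up to exponentially
    small probabilities. *)

(** * Averages over fair bits, and stationarity of the environment *)

Section Averages.
Context {R : realType} {I : eqType}.
Implicit Types (F G : (I -> bool) -> R) (z : I -> bool) (i : I) (J : seq I).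

Definition upd z i (e : bool) : I -> bool := fun j => if j == i then e else z j.

Definition avg1 i F : (I -> bool) -> R :=
  fun z => 2^-1 * (F (upd z i true) + F (upd z i false)).

(** The average of [F] over the values of the bits in [J], the other bits
    being kept: a finite substitute for integration, under which reindexing and
    independence are algebraic identities. *)
Fixpoint avg J F : (I -> bool) -> R :=
  if J is i :: J' then avg J' (avg1 i F) else F.

Lemma avg_cons i J F : avg (i :: J) F = avg J (avg1 i F).
Proof. by []. Qed.

Definition supp J F := forall z z', {in J, z =1 z'} -> F z = F z'.

Lemma updC z i j e e' : i != j -> upd (upd z i e) j e' = upd (upd z j e') i e.
Proof.
move=> ij; apply: funext => k; rewrite /upd.
by case: (eqVneq k j) => [->|//]; rewrite eq_sym (negPf ij).
Qed.

Lemma upd_upd z i e e' : upd (upd z i e) i e' = upd z i e'.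
Proof. by apply: funext => k; rewrite /upd; case: eqP. Qed.

Lemma avg1C i j F : avg1 i (avg1 j F) = avg1 j (avg1 i F).
Proof.
apply: funext => z; rewrite /avg1.
case: (eqVneq i j) => [->//|ij].
rewrite (updC z true true ij) (updC z true false ij).
rewrite (updC z false true ij) (updC z false false ij); ring.
Qed.

Lemma avg_avg1 J i F : avg J (avg1 i F) = avg1 i (avg J F).
Proof. by elim: J F => //= j J IH F; rewrite avg1C IH. Qed.

Lemma avgC J J' F : avg J (avg J' F) = avg J' (avg J F).
Proof. by elim: J F => //= i J IH F; rewrite -IH (avg_avg1 J'). Qed.

Lemma avg_cst J (c : R) : avg J (fun=> c) = fun=> c.
Proof.
elim: J => //= i J IH; rewrite -[RHS]IH; congr avg.
by apply: funext => z; rewrite /avg1; lra.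
Qed.

Lemma avgD J F G : avg J (fun z => F z + G z) = fun z => avg J F z + avg J G z.
Proof.
elim: J F G => //= i J IH F G; rewrite -IH; congr avg.
by apply: funext => z; rewrite /avg1; lra.
Qed.

Lemma avgZ J (c : R) F : avg J (fun z => c * F z) = fun z => c * avg J F z.
Proof.
elim: J F => //= i J IH F; rewrite -IH; congr avg.
by apply: funext => z; rewrite /avg1; ring.
Qed.

Lemma avg_sum J (K : Type) (s : seq K) (P : pred K)
    (F : K -> (I -> bool) -> R) :
  avg J (fun z => \sum_(k <- s | P k) F k z) =
  fun z => \sum_(k <- s | P k) avg J (F k) z.
Proof.
elim: s => [|k s IH].
  rewrite (_ : (fun _ => _) = fun=> 0) ?avg_cst; first by apply: funext=> z; rewrite big_nil.
  by apply: funext=> z; rewrite big_nil.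
rewrite (_ : (fun z => _) = fun z => (if P k then F k z else 0) +
    \sum_(k <- s | P k) F k z); last first.
  by apply: funext => z; rewrite big_cons; case: ifP => //; rewrite add0r.
rewrite avgD IH; apply: funext => z; rewrite big_cons.
by case: ifP => // _; rewrite avg_cst add0r.
Qed.

Lemma avg_le J F G z : (forall z, F z <= G z) -> avg J F z <= avg J G z.
Proof.
elim: J F G => //= i J IH F G FG; apply: IH => {}z.
by rewrite /avg1 ler_pM2l// lerD.
Qed.

Lemma supp_avg1 i J F : supp (i :: J) F -> supp J (avg1 i F).
Proof.
move=> sF z z' zz'; rewrite /avg1; congr (_ * (_ + _)); apply: sF => j;
  by rewrite inE /upd; case: eqVneq => //= _ /zz'.
Qed.

Lemma avg_const J F z z' : supp J F -> avg J F z = avg J F z'.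
Proof.
elim: J F => [F sF|i J IH F sF] /=; first by apply: sF.
by apply: IH; exact: supp_avg1.
Qed.

Lemma sub_supp J J' F : {subset J <= J'} -> supp J F -> supp J' F.
Proof. by move=> JJ' sF z z' zz'; apply: sF => j /JJ' /zz'. Qed.

Lemma avg_supp J J' F z z' : supp J F -> {subset J <= J'} ->
  avg J F z = avg J' F z'.
Proof.
move=> sF JJ'.
have sF' := sub_supp JJ' sF.
have e1 : avg J F = fun=> avg J F z by apply: funext => y; exact: avg_const.
have e2 : avg J' F = fun=> avg J' F z' by apply: funext => y; exact: avg_const.
have := congr1 (fun f => f z) (avgC J J' F).
by rewrite e1 e2 !avg_cst.
Qed.

(** Permuting the bits, or flipping all of them, preserves the fair
    coin measure.  The transported index set is [map s' J] because [J] lists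
    the bits of the new configuration. *)
Lemma avg_reindex (s s' : I -> I) (c : bool) J F : cancel s s' -> cancel s' s ->
  avg J (fun z => F (fun i => z (s i) (+) c)) =
  fun z => avg (map s' J) F (fun i => z (s i) (+) c).
Proof.
move=> sK s'K; elim: J F => //= i J IH F; rewrite -IH; congr avg.
apply: funext => z; rewrite /avg1.
have E e : (fun j => upd z i e (s j) (+) c) =
           upd (fun j => z (s j) (+) c) (s' i) (e (+) c).
  apply: funext => j; rewrite /upd; case: (eqVneq j (s' i)) => [->|ji].
    by rewrite s'K eqxx.
  by case: eqVneq => // /(congr1 s'); rewrite sK => /eqP; rewrite (negPf ji).
by rewrite !E; case: (c) => //=; rewrite addrC.
Qed.

End Averages.

(** The quenched transition operator of the pair (environment seen from
    the walker, position) in M2. *)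
Definition step_op {R : realType} (f : config -> int -> R) : config -> int -> R :=
  fun om p => 4^-1 * \sum_(b : bool) \sum_(a : bool)
    f (M2_step b a om) (p + arrow (swap_if b om None)).

(** The hand and the sites within distance [k]: after one step the state on
    [window k] depends on [window k.+1] only. *)
Definition window (k : nat) : seq (option int) :=
  None :: [seq Some (i%:Z - k%:Z) | i <- iota 0 (k.*2.+1)].

Lemma mem_window k (x : int) : (Some x \in window k) = (`|x| <= k)%N.
Proof.
rewrite /window in_cons orFb; apply/mapP/idP => [[i]|xk].
  by rewrite mem_iota => /andP[_ ik] [->]; lia.
exists (absz (x + k%:Z)); last by congr Some; lia.
by rewrite mem_iota; lia.
Qed.

Lemma window_None k : None \in window k.
Proof. by rewrite inE. Qed.

Lemma window_sub k k' : (k <= k')%N -> {subset window k <= window k'}.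
Proof. by move=> kk' [x|//]; rewrite !mem_window => /leq_trans; apply. Qed.

Lemma swap_eq_on k (om om' : config) : {in window k, om =1 om'} ->
  {in window k, swap om =1 swap om'}.
Proof.
move=> H [x|] xk /=; last by apply: H; rewrite mem_window.
by case: eqP => // _; apply: H => //.
Qed.

Lemma shift_eq_on k (om om' : config) : {in window k.+1, om =1 om'} ->
  {in window k, shift om =1 shift om'}.
Proof.
move=> H [x|] xk /=; last by apply: H; rewrite window_None.
rewrite (H None) ?window_None//; apply: H; move: xk; rewrite !mem_window /arrow.
by case: ifP; lia.
Qed.

Lemma swap_if_eq_on k b (om om' : config) : {in window k, om =1 om'} ->
  {in window k, swap_if b om =1 swap_if b om'}.
Proof. by case: b => //=; exact: swap_eq_on. Qed.

Lemma M2_step_eq_on k b a (om om' : config) : {in window k.+1, om =1 om'} ->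
  {in window k, M2_step b a om =1 M2_step b a om'}.
Proof. by move=> H; apply/swap_if_eq_on/shift_eq_on/swap_if_eq_on. Qed.

Section Stationarity.
Context {R : realType}.
Implicit Types (F : config -> R).

Definition mean k F : R := avg (window k) F (fun=> true).

Lemma mean_swap_if k b F : supp (window k) F ->
  mean k (fun om => F (swap_if b om)) = mean k F.
Proof.
case: b => //= sF; rewrite /mean.
pose s (x : option int) : option int :=
  match x with None => Some 0 | Some y => if y == 0 then None else Some y end.
have sK : cancel s s by case=> [x|] //=; case: (eqVneq x 0) => [->//|/negPf/= ->].
rewrite (_ : (fun om => F (swap om)) = fun om => F (fun i => om (s i) (+) false)).
  rewrite (avg_reindex _ _ _ sK sK); apply/esym/avg_supp => // x xk.
  apply/mapP; exists (s x); rewrite ?sK//.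
  case: x xk => [x|] //= xk; first by case: eqP => // _; rewrite inE.
  by rewrite mem_window.
by apply: funext => om; congr F; apply: funext => -[x|] /=; rewrite addbF//; case: eqP.
Qed.

(** Conditionally on the hand arrow [e], which the shift keeps, the shift is a
    translation of the sites by [arrow e]. *)
Lemma mean_shift k K F : supp (window k) F -> (k < K)%N ->
  mean K (fun om => F (shift om)) = mean K F.
Proof.
move=> sF kK.
pose s (e : bool) (x : option int) := omap (fun y => y + arrow e) x.
pose s' (e : bool) (x : option int) := omap (fun y => y - arrow e) x.
have sK e : cancel (s e) (s' e) by case=> [x|] //=; rewrite addrK.
have s'K e : cancel (s' e) (s e) by case=> [x|] //=; rewrite subrK.
pose Fe e om := F (upd om None e).
have E om e : F (shift (upd om None e)) = Fe e (fun i => om (s e i) (+) false).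
  by congr F; apply: funext => -[x|]; rewrite /upd /= ?addbF.
have idem : avg (window K) (avg1 None F) = avg (window K) F.
  rewrite /=; congr avg; apply: funext => om; rewrite /avg1 !upd_upd; lra.
have idem' : avg (window K) (avg1 None (fun om => F (shift om))) =
             avg (window K) (fun om => F (shift om)).
  by rewrite /=; congr avg; apply: funext => om; rewrite /avg1 !upd_upd; lra.
rewrite /mean -idem -idem' /avg1 !avgZ !avgD; congr (_ * _).
have sFe e : supp (window k) (Fe e).
  by move=> z z' zz'; apply: sF => j jk; rewrite /upd; case: ifP => // _; exact: zz'.
have main e : avg (window K) (fun om => F (shift (upd om None e))) (fun=> true) =
              avg (window K) (fun om => F (upd om None e)) (fun=> true).
  rewrite (_ : (fun om => _) = fun om => Fe e (fun i => om (s e i) (+) false)).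
    rewrite (avg_reindex _ _ _ (sK e) (s'K e)).
    have A J z : {subset window k <= J} -> avg J (Fe e) z = avg (window k) (Fe e) (fun=> true).
      by move=> kJ; apply/esym/avg_supp.
    rewrite A ?[RHS]A//; first exact/window_sub/ltnW.
    move=> x xk; apply/mapP; exists (s e x); rewrite ?sK//.
    case: x xk => [x|] //; rewrite !mem_window /arrow.
    by case: (e) => /=; lia.
  by apply: funext => om; exact: E.
by rewrite !main.
Qed.

Lemma mean_M2_step k K b a F : supp (window k) F -> (k < K)%N ->
  mean K (fun om => F (M2_step b a om)) = mean K F.
Proof.
move=> sF kK.
have s1 : supp (window k) (fun om => F (swap_if a om)).
  by move=> z z' /swap_if_eq_on H; exact: sF.
have s2 : supp (window k.+1) (fun om => F (swap_if a (shift om))).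
  by move=> z z' /shift_eq_on H; exact: s1.
have s3 m (G : config -> R) : (m <= K)%N -> supp (window m) G -> supp (window K) G.
  by move=> mK; apply: sub_supp; exact: window_sub.
rewrite /M2_step (@mean_swap_if K b (fun om => F (swap_if a (shift om)))); last exact: s3 s2.
rewrite (@mean_shift k K (fun om => F (swap_if a om)))//.
by rewrite mean_swap_if//; apply: s3 sF; exact: ltnW.
Qed.

Lemma iter_step_op_supp k n (f : config -> int -> R) :
  (forall p, supp (window k) (f ^~ p)) ->
  forall p, supp (window (k + n)) ((iter n step_op f) ^~ p).
Proof.
move=> sf; elim: n => [|n IH] p; first by rewrite addn0.
move=> z z' zz' /=; rewrite /step_op; congr (_ * _).
apply: eq_bigr => b _; apply: eq_bigr => a _.
have -> : swap_if b z None = swap_if b z' None.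
  by apply: (swap_if_eq_on _ zz'); exact: window_None.
by apply: IH; apply: M2_step_eq_on; rewrite -addnS.
Qed.

Lemma iter_step_op_env n (F : config -> R) om p :
  iter n step_op (fun om _ => F om) om p = iter n step_op (fun om _ => F om) om 0.
Proof.
elim: n om p => //= n IH om p; rewrite /step_op; congr (_ * _).
by apply: eq_bigr => b _; apply: eq_bigr => a _; rewrite IH [RHS]IH.
Qed.

(** The law pi_1 is stationary for M2, since a step is a
    composition of swaps and a shift, each of which preserves pi_1.  The window
    loses one site per step, hence the bound on [K]. *)
Theorem mean_iter_step_op k n K (F : config -> R) : supp (window k) F ->
  (k + n <= K)%N ->
  mean K (fun om => iter n step_op (fun om _ => F om) om 0) = mean K F.
Proof.
move=> sF; elim: n => //= n IH knK.
pose G om := iter n step_op (fun om _ => F om) om 0.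
have sG : supp (window (k + n)) G by apply: (@iter_step_op_supp k n (fun om _ => F om)).
rewrite -IH; last lia.
rewrite (_ : (fun om => _) = fun om => 4^-1 *
   \sum_(b : bool) \sum_(a : bool) G (M2_step b a om)); last first.
  apply: funext => om; rewrite /step_op; congr (_ * _).
  by apply: eq_bigr => b _; apply: eq_bigr => a _; exact: iter_step_op_env.
rewrite /mean avgZ avg_sum.
rewrite (eq_bigr (fun=> 2 * mean K G)).
  by rewrite big_bool /= /mean; lra.
move=> b _; rewrite avg_sum (eq_bigr (fun=> mean K G)) ?big_bool /=; first by lra.
by move=> a _; rewrite -(@mean_M2_step (k + n) K b a) //; lia.
Qed.

End Stationarity.

(** * A Ray-Knight potential for hitting a site *)

Definition rsites (om : config) (a : int) n :=
  [seq om (Some (a + i%:Z)) | i <- iota 0 n].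

Definition lsites (om : config) n :=
  [seq om (Some (- i.+1%:Z)) | i <- iota 0 n].

Lemma lsites_swap om n : lsites (swap om) n = lsites om n.
Proof. by apply/eq_map. Qed.

Lemma rsites_swap om (a : int) n : 0 < a -> rsites (swap om) a n = rsites om a n.
Proof. by move=> a0; apply/eq_map => i /=; rewrite ifF//; apply/eqP; lia. Qed.

Lemma rsites_cons om a n : rsites om a n.+1 = om (Some a) :: rsites om (a + 1) n.
Proof.
rewrite /rsites /= addr0; congr cons; rewrite -[1%N]addn0 iotaDl -map_comp.
by apply: eq_map => i /=; congr (om (Some _)); lia.
Qed.

Lemma rsites_shift om a n :
  rsites (shift om) a n = rsites om (a + arrow (om None)) n.
Proof. by apply: eq_map => i /=; congr (om (Some _)); lia. Qed.

Lemma lsites_shift_right om n : om None = true ->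
  lsites (shift om) n.+1 = om (Some 0) :: lsites om n.
Proof.
move=> o; rewrite /lsites /= o; congr cons.
rewrite -[1%N]addn0 iotaDl -map_comp; apply: eq_map => i /=; rewrite ?o.
by congr (om (Some _)); rewrite /arrow; lia.
Qed.

Lemma lsites_shift_left om n : om None = false ->
  lsites om n.+1 = om (Some (-1)) :: lsites (shift om) n.
Proof.
move=> o; rewrite /lsites /=; congr cons.
rewrite -[1%N]addn0 iotaDl -map_comp; apply: eq_map => i /=; rewrite ?o.
by congr (om (Some _)); rewrite /arrow; lia.
Qed.

Section RayKnight.
Context {R : realType} (q : R).
Hypotheses (q0 : 0 < q) (q1 : q <= 1).
Implicit Types (k w u : nat -> R) (e : nat) (ls rs : seq bool).

(** Crossing numbers across one site whose two arrows are [h] and [t].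
    [k] is the weight of what lies to the left, as a function of the number of
    round trips over the left edge; this number differs from the number [e] of
    round trips over the right edge by a shift given by the arrows and by one
    fair coin.  The
    truncated predecessor in [k e.-1] is the reflection at 0.  The factor
    [q ^+ e.*2.+1] counts the round trips over the right edge and the
    final passage. *)
Definition site_op (h t : bool) k e : R := q ^+ e.*2.+1 * (2^-1 *
  match h, t with
  | true, true => k e.-1 + k e
  | false, false => k e.+1 + k e.+2
  | _, _ => k e + k e.+1
  end).

(** The weight of the sites between 0 and the walker when the edge next to
    the walker is still to be crossed [2e] times.  If it is not crossed at all
    then nothing further to the left is visited either, which is why [e = 0] is
    absorbing. *)
Fixpoint left_weight ls e : R := q ^+ e.*2 *
  match ls, e with
  | [::], _ => 1
  | _ :: ls', 0%N => left_weight ls' 0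
  | true :: ls', e'.+1 => 2^-1 * (left_weight ls' e' + left_weight ls' e)
  | false :: ls', _ => 2^-1 * (left_weight ls' e + left_weight ls' e.+1)
  end.

(** The sites on the right have not been visited, so that on the first
    arrival the hand arrow points to the right: the first argument of [site_op]
    is [true]. *)
Fixpoint right_weight k rs : R :=
  if rs is s :: rs' then right_weight (site_op true s k) rs' else k 0%N.

(** The edge (0, 1) is crossed an odd number of times by a walk going
    from a nonpositive site to [L]; what happens on the left of it is not
    counted. *)
Definition start_weight e : R := q ^+ e.*2.+1.

(** The expectation of [q] to the number of future crossings of the edges
    of [0, L] before the walk, now at [p] in the environment [om], hits [L].
    The arrows at the sites up to 0 are irrelevant: whatever they are, an
    excursion there ends with a crossing of the edge (0, 1). *)
Definition potential (L : nat) (om : config) (p : int) : R :=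
  if L%:Z <= p then 1 else
  match p with
  | Posz n.+1 =>
      right_weight (site_op (om None) (om (Some 0)) (left_weight (lsites om n))) (rsites om 1 (L.-1 - n.+1))
  | _ => right_weight start_weight (rsites om (1 - p) L.-1)
  end.

Lemma site_opC h t k : site_op h t k = site_op t h k.
Proof. by case: h; case: t. Qed.

Lemma site_opZ h t (c : R) k : site_op h t (fun e => c * k e) = fun e => c * site_op h t k e.
Proof. by apply: funext => e; rewrite /site_op; case: h; case: t; ring. Qed.

Lemma site_opD h t k w : site_op h t (fun e => k e + w e) = fun e => site_op h t k e + site_op h t w e.
Proof. by apply: funext => e; rewrite /site_op; case: h; case: t; ring. Qed.

Lemma right_weightZ (c : R) k rs : right_weight (fun e => c * k e) rs = c * right_weight k rs.
Proof. by elim: rs k => //= s rs IH k; rewrite site_opZ IH. Qed.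

Lemma right_weightD k w rs : right_weight (fun e => k e + w e) rs = right_weight k rs + right_weight w rs.
Proof. by elim: rs k w => //= s rs IH k w; rewrite site_opD IH. Qed.

Lemma site_op_ge0 h t k : (forall e, 0 <= k e) -> forall e, 0 <= site_op h t k e.
Proof.
move=> k_ge0 e; rewrite /site_op mulr_ge0 ?exprn_ge0 ?(ltW q0)//.
by rewrite mulr_ge0//; case: h; case: t; rewrite addr_ge0.
Qed.

Lemma right_weight_ge0 k rs : (forall e, 0 <= k e) -> 0 <= right_weight k rs.
Proof. by elim: rs k => //= s rs IH k k_ge0; apply/IH/site_op_ge0. Qed.

Lemma left_weight_ge0 ls e : 0 <= left_weight ls e.
Proof.
elim: ls e => [|s ls IH] e /=; first by rewrite mulr1 exprn_ge0// ltW.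
rewrite mulr_ge0 ?exprn_ge0 ?(ltW q0)//.
by case: s; case: e => // e; rewrite mulr_ge0// addr_ge0.
Qed.

Lemma left_weight0 ls : left_weight ls 0 = 1.
Proof. by elim: ls => [|s ls IH] /=; rewrite ?expr0 ?mul1r//; case: s. Qed.

Lemma potential_ge0 L om p : 0 <= potential L om p.
Proof.
rewrite /potential; case: ifP => // _; have k0_ge0 e : 0 <= start_weight e by rewrite exprn_ge0// ltW.
case: p => [[|n]|n]; apply: right_weight_ge0 => //.
by apply: site_op_ge0; exact: left_weight_ge0.
Qed.

Lemma potential_swap L om p : potential L (swap om) p = potential L om p.
Proof.
rewrite /potential; case: ifP => // _; case: p => [[|n]|n]; rewrite rsites_swap//.
by rewrite /= site_opC lsites_swap.
Qed.

Lemma potential_swap_if L b om p : potential L (swap_if b om) p = potential L om p.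
Proof. by case: b => //=; exact: potential_swap. Qed.

(** When both arrows point to the right, the next step is to the right and
    the site left behind keeps one arrow pointing to the right; the factor [q]
    pays for the crossing. *)
Lemma site_op_tt ls : site_op true true (left_weight ls) = fun e => q * left_weight (true :: ls) e.
Proof.
apply: funext => -[|e]; rewrite /site_op /=.
  by rewrite expr0 expr1 mul1r; congr (_ * _); lra.
by rewrite exprS; ring.
Qed.

(** [u] is the weight of what remains to the left once the walker has
    crossed the left edge leftwards: one of its [e+1] round trips is half done,
    at the price of a factor [q]. *)
Definition left_of (w : nat -> R) u := forall e, w e.+1 = q * u e.

Lemma left_of_nil : left_of (left_weight [::]) start_weight.
Proof. by move=> e; rewrite /start_weight /= mulr1 -exprS. Qed.

Lemma left_of_cons s ls : left_of (left_weight (s :: ls)) (site_op false s (left_weight ls)).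
Proof. by move=> e; rewrite /site_op /= doubleS exprS; case: s; ring. Qed.

Lemma site_op_ff w u : left_of w u -> site_op false false w = fun e => q * site_op true false u e.
Proof. by move=> wu; apply: funext => e; rewrite /site_op !wu; ring. Qed.

(** Opposite arrows: the coin decides between the two neighbours, and both
    outcomes are read off the weight of the left edge. *)
Lemma site_op_tf ls u : left_of (left_weight ls) u ->
  site_op true false (left_weight ls) =
  fun e => q * (2^-1 * (left_weight (false :: ls) e + site_op true true u e)).
Proof.
move=> wu; apply: funext => -[|e]; rewrite /site_op /= !wu ?expr0 ?expr1; first by field.
by rewrite !exprS; field.
Qed.

Lemma potential_right L om n : (n < L)%N -> om None = true ->
  potential L (shift om) n.+1 =
  right_weight (left_weight (if n is n'.+1 then om (Some 0) :: lsites om n' else [::])) (rsites om 1 (L.-1 - n)).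
Proof.
move=> nL o; rewrite /potential; case: ifP => Ln.
  have -> : (L.-1 - n = 0)%N by lia.
  by rewrite [RHS]/= left_weight0.
have -> : (L.-1 - n = (L.-1 - n.+1).+1)%N by lia.
rewrite rsites_cons [RHS]/= rsites_shift o.
by case: n {nL Ln} => [|n]; rewrite ?lsites_shift_right//= o.
Qed.

Definition left_state om n := if n is n'.+1 then
  site_op false (om (Some (-1))) (left_weight (lsites (shift om) n')) else start_weight.

Lemma potential_left L om n : (n.+1 < L)%N -> om None = false ->
  potential L (shift om) n =
  right_weight (site_op true (om (Some 0)) (left_state om n)) (rsites om 1 (L.-1 - n.+1)).
Proof.
move=> nL o; rewrite /potential ifF; last by lia.
case: n nL => [|n] nL.
  rewrite subr0 rsites_shift o.
  have -> : L.-1 = (L.-1 - 1).+1 by lia.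
  by rewrite rsites_cons /=; congr right_weight; congr rsites; lia.
rewrite rsites_shift o (_ : (L.-1 - n.+1 = (L.-1 - n.+2).+1)%N); last by lia.
rewrite rsites_cons /= o.
by congr (right_weight (site_op _ (om (Some _)) _) (rsites _ _ _)); lia.
Qed.

Lemma left_stateP om n : om None = false -> left_of (left_weight (lsites om n)) (left_state om n).
Proof.
move=> o; case: n => [|n]; first exact: left_of_nil.
by rewrite lsites_shift_left//; exact: left_of_cons.
Qed.

Lemma step_op_potential L om p : step_op (potential L) om p =
  2^-1 * (potential L (shift om) (p + arrow (om None)) +
          potential L (shift (swap om)) (p + arrow (om (Some 0)))).
Proof. by rewrite /step_op !big_bool /M2_step !potential_swap_if /=; field. Qed.

(** Strictly between 0 and [L] every step crosses a counted edge, so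
    that [q] times the average over the coin is exactly the old potential.  The
    four cases are the values of the hand and site arrows. *)
Lemma potential_super_pos L om n : (n.+1 < L)%N -> q * step_op (potential L) om n.+1 = potential L om n.+1.
Proof.
move=> nL.
have key om' : om' None = om None -> potential L om' n.+1 =
    right_weight (site_op (om' None) (om' (Some 0)) (left_weight (lsites om' n))) (rsites om' 1 (L.-1 - n.+1)).
  by move=> _; rewrite /potential ifF//; lia.
have Rt om' : om' None = true -> potential L (shift om') (n.+1%:Z + 1) =
    right_weight (left_weight (om' (Some 0) :: lsites om' n)) (rsites om' 1 (L.-1 - n.+1)).
  by move=> o; rewrite (_ : n.+1%:Z + 1 = n.+2); [rewrite potential_right//; lia|lia].
have Lf om' : om' None = false -> potential L (shift om') (n.+1%:Z - 1) =
  right_weight (site_op true (om' (Some 0)) (left_state om' n)) (rsites om' 1 (L.-1 - n.+1)).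
  by move=> o; rewrite (_ : n.+1%:Z - 1 = n); [rewrite potential_left|lia].
have main om' : om' None = true -> om' (Some 0) = false ->
   q * (2^-1 * (potential L (shift om') (n.+1%:Z + 1) + potential L (shift (swap om')) (n.+1%:Z - 1)))
   = right_weight (site_op true false (left_weight (lsites om' n))) (rsites om' 1 (L.-1 - n.+1)).
  move=> o t; rewrite Rt// Lf//=  o t rsites_swap//.
  have H : left_of (left_weight (lsites om' n)) (left_state (swap om') n).
    by rewrite -(lsites_swap om'); apply: left_stateP; rewrite /= t.
  by rewrite (site_op_tf H) !right_weightZ right_weightD.
rewrite step_op_potential.
have aT : arrow true = 1 by []. have aF : arrow false = -1 by [].
case o: (om None); case t: (om (Some 0)); rewrite ?aT ?aF.
- by rewrite !Rt /= ?o ?t// lsites_swap rsites_swap// key// o t site_op_tt right_weightZ; field.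
- by rewrite main// key// o t.
- rewrite addrC -(potential_swap L om n.+1).
  have -> : shift om = shift (swap (swap om)).
    by congr shift; apply: funext => -[x|] //=; case: eqP => // ->.
  by rewrite [q * _]main /= ?t ?o//  /potential ifF /= ?t ?o//; lia.
- rewrite Lf// Lf//= o t rsites_swap// key// o t.
  have H := left_stateP n o.
  have H' : left_of (left_weight (lsites om n)) (left_state (swap om) n).
    by rewrite -(lsites_swap om); apply: left_stateP; rewrite /= t.
  have -> : left_state (swap om) n = left_state om n.
    by apply: funext => e; apply: (mulfI (lt0r_neq0 q0)); rewrite -H -H'.
  by rewrite (site_op_ff H) right_weightZ; field.
Qed.

Lemma potential_out_left L om p : (0 < L)%N -> p <= 0 -> om None = false ->
  potential L (shift om) (p - 1) = potential L om p.
Proof.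
move=> L0 p0 o; rewrite /potential !ifF; [|lia|lia].
have -> : rsites om (1 - p) L.-1 = rsites (shift om) (1 - (p - 1)) L.-1.
  by rewrite rsites_shift o; congr rsites; rewrite /arrow; lia.
by case: p p0 => [[|n]|n].
Qed.

Lemma potential_out_right L om p : (0 < L)%N -> p <= 0 -> om None = true ->
  q * potential L (shift om) (p + 1) <= potential L om p.
Proof.
move=> L0 p0 o.
have [->|pn] := eqVneq p 0.
  rewrite add0r potential_right// subn0 /potential ifF; last by lia.
  rewrite subr0 -right_weightZ (_ : (fun e => _) = start_weight)//.
  by apply: funext => e; rewrite /start_weight /= mulr1 -exprS.
have -> : potential L (shift om) (p + 1) = potential L om p.
  rewrite /potential !ifF; [|lia|lia].
  have -> : rsites om (1 - p) L.-1 = rsites (shift om) (1 - (p + 1)) L.-1.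
    by rewrite rsites_shift o; congr rsites; rewrite /arrow; lia.
  have : p + 1 <= 0 by lia.
  by case: (p + 1) => [[|n]|n] // _; case: p p0 pn => [[|m]|m].
by rewrite ler_piMl// potential_ge0.
Qed.

(** The supermartingale property.  At [p <= 0] the crossings are not
    counted, except that of the edge (0, 1), and equality becomes an
    inequality. *)
Lemma potential_super L om p : (0 < L)%N -> p < L%:Z -> q * step_op (potential L) om p <= potential L om p.
Proof.
move=> L0 pL; have [p0|p0] := leP p 0; last first.
  by case: p p0 pL => [[|n]|n] // _ nL; rewrite potential_super_pos.
rewrite step_op_potential.
have step om' : q * potential L (shift om') (p + arrow (om' None)) <= potential L om' p.
  case o: (om' None) => /=; first exact: potential_out_right.
  by rewrite potential_out_left// ler_piMl// potential_ge0.
have := step om; have := step (swap om); rewrite potential_swap /=; lra.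
Qed.

End RayKnight.

(** * Averaging the potential over the arrows *)

Section Operator.
Context {R : realType}.
Implicit Types (f g : config -> int -> R).

Lemma iter_step_op_le n f g om p :
  (forall om' p', (`|p' - p| <= n)%N -> f om' p' <= g om' p') ->
  iter n step_op f om p <= iter n step_op g om p.
Proof.
elim: n om p => [|n IH] om p fg; first by apply: fg; rewrite subrr.
rewrite /= /step_op ler_pM2l//; apply: ler_sum => b _; apply: ler_sum => a _.
apply: IH => om' p' pn; apply: fg; rewrite /arrow in pn.
by move: pn; case: ifP; lia.
Qed.

Lemma iter_step_op_cst n (c : R) : iter n step_op (fun _ _ => c) = fun _ _ => c.
Proof.
elim: n => //= n ->; apply: funext => om; apply: funext => p.
by rewrite /step_op !big_bool /=; field.
Qed.

Lemma iter_step_opZ n (c : R) f :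
  iter n step_op (fun om p => c * f om p) = fun om p => c * iter n step_op f om p.
Proof.
elim: n => //= n ->; apply: funext => om; apply: funext => p.
by rewrite /step_op !big_bool /=; field.
Qed.

Lemma iter_step_opD n f g :
  iter n step_op (fun om p => f om p + g om p) =
  fun om p => iter n step_op f om p + iter n step_op g om p.
Proof.
elim: n => //= n ->; apply: funext => om; apply: funext => p.
by rewrite /step_op !big_bool /=; field.
Qed.

Lemma iter_step_op_sum n (K : Type) (s : seq K) (P : pred K) (F : K -> config -> int -> R) :
  iter n step_op (fun om p => \sum_(k <- s | P k) F k om p) =
  fun om p => \sum_(k <- s | P k) iter n step_op (F k) om p.
Proof.
elim: s => [|k s IH].
  rewrite (_ : (fun _ _ => _) = fun _ _ => 0) ?iter_step_op_cst.
    by apply: funext => om; apply: funext => p; rewrite big_nil.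
  by apply: funext => om; apply: funext => p; rewrite big_nil.
rewrite (_ : (fun om p => _) = fun om p => (if P k then F k om p else 0) +
    \sum_(k <- s | P k) F k om p); last first.
  by apply: funext => om; apply: funext => p; rewrite big_cons; case: ifP => //; rewrite add0r.
rewrite iter_step_opD IH; apply: funext => om; apply: funext => p; rewrite big_cons.
by case: ifP => // _; rewrite iter_step_op_cst add0r.
Qed.

Lemma iter_step_op_translate n f om p :
  iter n step_op f om p = iter n step_op (fun om x => f om (p + x)) om 0.
Proof.
suff H x : iter n step_op f om (p + x) = iter n step_op (fun om x => f om (p + x)) om x.
  by rewrite -H addr0.
elim: n om x => //= n IH om x; rewrite /step_op; congr (_ * _).
by apply: eq_bigr => b _; apply: eq_bigr => a _; rewrite -addrA IH.
Qed.

(** Reversing space and all arrows: the dynamics is unchanged, so that a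
    bound on hitting [L] also bounds hitting [-L]. *)
Definition mirror (om : config) : config := fun x => ~~ om (omap -%R x).

Lemma mirror_M2_step b a om : M2_step b a (mirror om) = mirror (M2_step b a om).
Proof.
have sw om' : swap (mirror om') = mirror (swap om').
  by apply: funext => -[x|] //=; rewrite /mirror /= oppr_eq0; case: eqP.
have swi c om' : swap_if c (mirror om') = mirror (swap_if c om').
  by case: c => //=.
have sh om' : shift (mirror om') = mirror (shift om').
  apply: funext => -[x|] //=; rewrite /mirror /=; congr (~~ om' (Some _)).
  by case: (om' None); rewrite /arrow/=; lia.
by rewrite /M2_step swi sh swi.
Qed.

Lemma iter_step_op_mirror n f om p :
  iter n step_op (fun om p => f (mirror om) (- p)) om p = iter n step_op f (mirror om) (- p).
Proof.
elim: n om p => //= n IH om p; rewrite /step_op; congr (_ * _).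
apply: eq_bigr => b _; apply: eq_bigr => a _; rewrite IH mirror_M2_step.
congr (iter n step_op f _ _); rewrite opprD; congr (_ + _).
have -> : swap_if b (mirror om) None = ~~ swap_if b om None by case: b.
by case: (swap_if b om None).
Qed.

Lemma mean_mirror k (F : config -> R) : supp (window k) F ->
  mean k (fun om => F (mirror om)) = mean k F.
Proof.
move=> sF; rewrite /mean.
have oK : cancel (omap -%R) (omap -%R : option int -> option int).
  by case=> [x|] //=; rewrite opprK.
rewrite (_ : (fun om => _) = fun om => F (fun i => om (omap -%R i) (+) true)).
  rewrite (avg_reindex _ _ _ oK oK); apply/esym/avg_supp => // x xk.
  apply/mapP; exists (omap -%R x); last by rewrite oK.
  by case: x xk => [x|]//=; rewrite !mem_window abszN.
by apply: funext => om; congr F; apply: funext => i; rewrite addbT.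
Qed.

End Operator.

Section Tail.
Context {R : realType} (q : R).
Hypotheses (q0 : 0 < q) (q1 : q <= 1).

Definition reached (L : nat) (p : int) : R := ((L%:Z <= p)%R : nat)%:R.

(** At most [n] crossings occur in [n] steps, so that on hitting [L] by
    then the power of [q] is at least [q ^+ n]; formally, a supermartingale bound by
    induction on [n]. *)
Lemma hit_le_potential n L om p : (0 < L)%N ->
  iter n step_op (fun _ => reached L) om p <= q^-1 ^+ n * potential q L om p.
Proof.
move=> L0; have qV1 : 1 <= q^-1 by rewrite invf_ge1.
have qV0 : 0 <= q^-1 by rewrite invr_ge0 ltW.
elim: n om p => [|n IH] om p.
  rewrite expr0 mul1r /= /reached; case: (leP (Posz L) p) => Lp; last exact: potential_ge0.
  by rewrite /potential Lp.
have [Lp|pL] := leP (Posz L) p.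
  rewrite {1}/potential Lp mulr1 (@le_trans _ _ 1) ?exprn_ege1//.
  have H : iter n.+1 (@step_op R) (fun _ _ => 1) om p = 1 by rewrite iter_step_op_cst.
  rewrite -[leRHS]H; apply: iter_step_op_le => om' p' _.
  by rewrite /reached lern1; case: (_ <= _).
have -> : q^-1 ^+ n.+1 * potential q L om p = q^-1 ^+ n * (q^-1 * potential q L om p).
  by rewrite exprSr mulrA.
apply: (@le_trans _ _ (q^-1 ^+ n * step_op (potential q L) om p)); last first.
  rewrite ler_wpM2l ?exprn_ge0//.
  by rewrite ler_pdivlMl// potential_super.
have E := iter_step_opZ 1 (q^-1 ^+ n) (potential q L); rewrite /= in E.
have -> : q^-1 ^+ n * step_op (potential q L) om p = step_op (fun om p => q^-1 ^+ n * potential q L om p) om p.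
  by rewrite E.
rewrite /= /step_op ler_pM2l//; apply: ler_sum => b _; apply: ler_sum => a _.
exact: IH.
Qed.

(** The average of [site_op true s] over the fair arrow [s]: a lazy
    reflected walk. *)
Definition avg_site_op (k : nat -> R) e : R :=
  q ^+ e.*2.+1 * (4^-1 * k e.-1 + 2^-1 * k e + 4^-1 * k e.+1).

Lemma avg_right_weight k (a : int) n z :
  avg [seq Some (a + i%:Z) | i <- iota 0 n]
    (fun om => right_weight q k (rsites om a n)) z = iter n avg_site_op k 0%N.
Proof.
elim: n k a => [//|n IH] k a; rewrite iterSr -(IH _ (a + 1)).
have -> : [seq Some (a + i%:Z) | i <- iota 0 n.+1] =
          Some a :: [seq Some (a + 1 + i%:Z) | i <- iota 0 n].
  rewrite /= addr0 -[1%N]addn0 iotaDl -map_comp; congr cons.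
  by apply: eq_map => i /=; congr Some; lia.
rewrite avg_cons; congr (avg _ _ z); apply: funext => om; rewrite /avg1.
have E e : rsites (upd om (Some a) e) a n.+1 = e :: rsites om (a + 1) n.
  rewrite rsites_cons {1}/upd eqxx; congr cons; apply/eq_map => i; rewrite /upd.
  by case: eqP => // -[]; lia.
rewrite !E [right_weight _ _ (true :: _)]/= [right_weight _ _ (false :: _)]/= -right_weightD -right_weightZ.
congr right_weight; apply: funext => e; rewrite /avg_site_op /site_op; by field.
Qed.

(** At the origin the potential sees each of the arrows at 1, ..., L
    once, so their average factors into a power of one operator. *)
Lemma mean_potential K L : (L <= K)%N -> mean K (fun om => potential q L.+1 om 0) = iter L avg_site_op (start_weight q) 0%N.
Proof.
move=> LK; rewrite -(avg_right_weight _ 1 L (fun=> true)) /mean.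
rewrite (_ : (fun om => potential q L.+1 om 0) = fun om => right_weight q (start_weight q) (rsites om 1 L)).
  apply/esym/avg_supp.
    move=> z z' zz'; congr right_weight; apply/eq_in_map => i iL; apply: zz'.
    by apply/mapP; exists i.
  by move=> x /mapP[i]; rewrite mem_iota => /andP[_ iL] ->; rewrite mem_window; lia.
by apply: funext => om; rewrite /potential /= subr0.
Qed.

Lemma iter_avg_site_op_le (rho : R) (g k : nat -> R) n : 0 <= rho ->
  (forall e, avg_site_op g e <= rho * g e) -> (forall e, k e <= g e) ->
  forall e, iter n avg_site_op k e <= rho ^+ n * g e.
Proof.
move=> rho0 Hg kg; elim: n => [|n IH] e; first by rewrite expr0 mul1r.
rewrite /= exprSr -mulrA (@le_trans _ _ (rho ^+ n * avg_site_op g e))//; last first.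
  by rewrite ler_wpM2l// exprn_ge0.
rewrite /avg_site_op mulrCA ler_wpM2l ?exprn_ge0 ?(ltW q0)//.
by have := IH e.-1; have := IH e; have := IH e.+1; lra.
Qed.

End Tail.

Section Supersolution.
Context {R : realType} (s : R).
Hypotheses (s0 : 0 < s) (s1 : s <= 1).

(** A bounded perturbation of 1: its concavity near [e = 0] on the scale
    [1 / s] beats the lack of killing there, while at larger [e] the killing
    [q ^+ e.*2.+1] suffices. *)
Definition supersolution (e : nat) : R := 1 + 4^-1 * (1 + (s * e%:R) ^+ 2)^-1.

Lemma supersolution_bounds e : 1 <= supersolution e <= 5 / 4.
Proof.
have h : 1 <= 1 + (s * e%:R) ^+ 2 by rewrite lerDl sqr_ge0.
have : 0 <= (1 + (s * e%:R) ^+ 2)^-1 <= 1.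
  by rewrite invr_ge0 invf_le1 ?h ?andbT// ?(le_trans _ h) // (lt_le_trans ltr01 h).
rewrite /supersolution; lra.
Qed.

Lemma second_difference (u : R) : 
  (1 + (u - s) ^+ 2)^-1 + (1 + (u + s) ^+ 2)^-1 - 2 * (1 + u ^+ 2)^-1 =
  2 * s ^+ 2 * (3 * u ^+ 2 - 1 - s ^+ 2) / 
  ((1 + (u - s) ^+ 2) * (1 + (u + s) ^+ 2) * (1 + u ^+ 2)).
Proof.
have P (x : R) : 1 + x ^+ 2 != 0.
  by rewrite gt_eqF// (lt_le_trans ltr01)// lerDl sqr_ge0.
by field; rewrite !P.
Qed.

(** The spectral gap of the killed reflected walk is of order
    [s ^+ 2]; the constant 200 is not optimised.
    For [u = s e] at least 1/2 the killing factor [1 + 2 u s^2] wins; below, the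
    second difference of [1 / (1 + u^2)] is negative enough. *)
Lemma supersolution_ineq (q : R) : 0 < q ->
  (forall e, q ^+ e.*2.+1 * (1 + 2 * e%:R * s ^+ 3) <= 1) ->
  forall e, avg_site_op q supersolution e <= (1 - s ^+ 2 / 200) * supersolution e.
Proof.
move=> q0 hq e; rewrite /avg_site_op.
have s2 : 0 < s ^+ 2 by rewrite exprn_gt0.
have s21 : s ^+ 2 <= 1 by rewrite exprn_ile1// ltW.

set A := _ + _ + _; have c0 : 0 < 1 + 2 * e%:R * s ^+ 3.
  by rewrite ltr_pwDl// mulr_ge0 ?mulr_ge0 ?exprn_ge0// ltW.
suff H : A <= (1 - s ^+ 2 / 200) * supersolution e * (1 + 2 * e%:R * s ^+ 3).
  apply: (@le_trans _ _ (q ^+ e.*2.+1 * ((1 - s ^+ 2 / 200) * supersolution e * (1 + 2 * e%:R * s ^+ 3)))).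
    by rewrite ler_wpM2l// exprn_ge0// ltW.
  rewrite mulrCA ler_piMr//; have /andP[g1 _] := supersolution_bounds e.
  by rewrite mulr_ge0//; lra.
have /andP[g1 g54] := supersolution_bounds e.
case: e @A hq c0 g1 g54 => [|e] A hq c0 g1 g54.
  rewrite /A /supersolution /= !mulr0 !mul0r expr0n /= addr0 invr1 !mulr1.
  have : (1 + s ^+ 2)^-1 <= 1 - s ^+ 2 / 2.
    rewrite -[leLHS]mul1r ler_pdivrMr; last lra.
    have : 0 <= (s ^+ 2) * (1 - s ^+ 2) by apply: mulr_ge0; lra. lra.
  lra.
set g := supersolution e.+1 in g1 g54 *.
pose u := s * e.+1%:R.
have su : s <= u by rewrite /u ler_peMr ?(ltW s0)// ler1n.
have P (x : R) : 1 <= 1 + x ^+ 2 by rewrite lerDl sqr_ge0.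
pose D2 := (1 + (u - s) ^+ 2)^-1 + (1 + (u + s) ^+ 2)^-1 - 2 * (1 + u ^+ 2)^-1.
have EA : A = g + 16^-1 * D2.
  rewrite /A /g /supersolution /D2 [_.-1]/=.
  have -> : s * e%:R = u - s by rewrite /u -natr1; ring.
  have -> : s * e.+2%:R = u + s by rewrite /u -[e.+2%:R]natr1; ring.
  rewrite -/u; field; rewrite !lt0r_neq0//; exact: lt_le_trans ltr01 (P _).
have -> : 2 * e.+1%:R * s ^+ 3 = 2 * u * s ^+ 2 by rewrite /u; ring.
pose den := (1 + (u - s) ^+ 2) * (1 + (u + s) ^+ 2) * (1 + u ^+ 2).
have den1 : 1 + u ^+ 2 <= den.
  rewrite /den ler_peMl//; first exact: le_trans ler01 (P _).
  by rewrite mulr_ege1.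
have den0 : 0 < den by rewrite (lt_le_trans _ den1)// (lt_le_trans ltr01 (P _)).
have ED : D2 * den = 2 * s ^+ 2 * (3 * u ^+ 2 - 1 - s ^+ 2).
  by rewrite /D2 second_difference -/den divfK// gt_eqF.
have [u2|u2] := leP 2^-1 u.
  (* Here 3 u^2 - 1 - s^2 is at most 3 (1 + u^2), and den is at least 1 + u^2. *)
  have D6 : D2 <= 6 * s ^+ 2.
    rewrite -(ler_pM2r den0) ED.
    have : 0 <= s ^+ 2 * (den - (1 + u ^+ 2)) by apply: mulr_ge0; lra.
    have : 0 <= s ^+ 2 * s ^+ 2 by apply: mulr_ge0; lra.
    lra.
  have : g + 16^-1 * D2 <= g * (1 + 3/8 * s ^+ 2).
    have : 0 <= (g - 1) * s ^+ 2 by apply: mulr_ge0; lra.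
    lra.
  have : (1 + 3/8 * s ^+ 2) <= (1 - s ^+ 2 / 200) * (1 + 2 * u * s ^+ 2).
    have : 0 <= s ^+ 2 * (2 * u - 1) * (1 - s ^+ 2 / 200).
      by apply: mulr_ge0; [apply: mulr_ge0|]; lra.
    have : 0 <= s ^+ 2 * (1 - s ^+ 2) by apply: mulr_ge0; lra.
    lra.
  rewrite EA => h1 h2; apply: (le_trans h2).
  rewrite [leRHS]mulrAC [leRHS]mulrC ler_pM2l//; lra.
have u0 : 0 < u by exact: lt_le_trans su.
have sq4 (x : R) : 0 < x -> x <= 2^-1 -> x ^+ 2 <= 4^-1.
  by move=> x0 x2; rewrite (_ : 4^-1 = 2^-1 ^+ 2) ?lerXn2r// ?nnegrE; [lra|lra|field].
have us2 : u ^+ 2 <= 4^-1 by apply: sq4 => //; exact: ltW.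
have ss2 : s ^+ 2 <= 4^-1 by apply: sq4 => //; exact: le_trans su (ltW u2).
have den2 : den <= 45 / 16.
  have E : (1 + (u - s) ^+ 2) * (1 + (u + s) ^+ 2) = 
     (1 + u ^+ 2 + s ^+ 2) ^+ 2 - 4 * u ^+ 2 * s ^+ 2 by ring.
  have E1 : (1 + (u - s) ^+ 2) * (1 + (u + s) ^+ 2) <= 9 / 4 by rewrite E; nra.
  rewrite /den; have := P (u - s); have := P (u + s); nra.
have D6 : D2 <= - (8 / 45) * s ^+ 2.
  rewrite -(ler_pM2r den0) ED.
  apply: (@le_trans _ _ (- 2^-1 * s ^+ 2)); nra.
rewrite EA; apply: (@le_trans _ _ ((1 - s ^+ 2 / 200) * g)); first by nra.
rewrite ler_peMr//; first by apply: mulr_ge0; lra.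
by rewrite lerDl mulr_ge0// ltW// mulr_gt0.
Qed.

End Supersolution.

(** * The upper bound in discrete time *)

Section Msd.
Context {R : realType}.

Definition sq (p : int) : R := p%:~R ^+ 2.

(** The mean square displacement of the jump chain of M2 under pi_1. *)
Definition msd n : R := mean n (fun om => iter n step_op (fun _ p => sq p) om 0).

Lemma iter_step_op_walk_supp n (f : int -> R) p :
  supp (window n) (fun om => iter n step_op (fun _ => f) om p).
Proof.
have := @iter_step_op_supp R 0 n (fun _ => f); rewrite add0n => H.
by apply: H => {}p z z' _.
Qed.

Lemma mean_widen k K (F : config -> R) : supp (window k) F -> (k <= K)%N ->
  mean K F = mean k F.
Proof. by move=> sF kK; apply/esym/avg_supp => //; exact: window_sub. Qed.

Lemma mean_le k (F G : config -> R) : (forall om, F om <= G om) -> mean k F <= mean k G.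
Proof. exact: avg_le. Qed.

Lemma meanZ k c (F : config -> R) : mean k (fun om => c * F om) = c * mean k F.
Proof. by rewrite /mean avgZ. Qed.

Lemma meanD k (F G : config -> R) : mean k (fun om => F om + G om) = mean k F + mean k G.
Proof. by rewrite /mean avgD. Qed.

Lemma mean_sum k (K : Type) (s : seq K) (P : pred K) (F : K -> config -> R) :
  mean k (fun om => \sum_(i <- s | P i) F i om) = \sum_(i <- s | P i) mean k (F i).
Proof. by rewrite /mean avg_sum. Qed.

Lemma mean_cst k (c : R) : mean k (fun=> c) = c.
Proof. by rewrite /mean avg_cst. Qed.

Lemma sum_odd m : (\sum_(L < m) (L.*2.+1%:R : R)) = m%:R ^+ 2.
Proof.
elim: m => [|m IH]; first by rewrite big_ord0 expr0n.
by rewrite big_ord_recr /= IH -[m.+1%:R]natr1 -[_.*2.+1%:R]natr1 -muln2 natrM; ring.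
Qed.

(** The layer-cake formula, which turns tail bounds into second moments: [p^2] is
    the sum of the odd numbers below [2|p|]. *)
Lemma sq_layer n (p : int) : (`|p| <= n)%N ->
  sq p = \sum_(L < n) L.*2.+1%:R * (reached L.+1 p + reached L.+1 (- p)) :> R.
Proof.
move=> pn; have -> : sq p = (absz p)%:R ^+ 2 :> R.
  by rewrite /sq -(real_normK (num_real p%:~R)) -intr_norm -abszE -pmulrn.
rewrite -sum_odd (big_ord_widen n (fun L => L.*2.+1%:R) pn) big_mkcond/=.
apply: eq_bigr => L _; rewrite /reached -natrD.
case: ltnP => Lp.
  suff -> : (((L.+1%:Z <= p)%R : nat) + ((L.+1%:Z <= - p)%R : nat) = 1)%N by rewrite mulr1.
  by case: (leP (Posz L.+1) p) => h1; case: (leP (Posz L.+1) (- p)) => h2 //; lia.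
suff -> : (((L.+1%:Z <= p)%R : nat) + ((L.+1%:Z <= - p)%R : nat) = 0)%N by rewrite mulr0.
by case: (leP (Posz L.+1) p) => h1; case: (leP (Posz L.+1) (- p)) => h2 //; lia.
Qed.

Lemma sum_arith_geom (rho : R) n : 0 <= rho < 1 ->
  \sum_(L < n) L.*2.+1%:R * rho ^+ L <= 2 / (1 - rho) ^+ 2.
Proof.
move=> /andP[r0 r1]; have c0 : 0 < (1 - rho) ^+ 2 by rewrite exprn_gt0// subr_gt0.
apply: (@le_trans _ _ (\sum_(L < n) 2 * (L.+1%:R * rho ^+ L))).
  apply: ler_sum => L _; rewrite mulrA ler_wpM2r ?exprn_ge0//.
  by rewrite -natrM ler_nat; lia.
rewrite -mulr_sumr ler_pM2l// -[leRHS]mul1r ler_pdivlMr//.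
have E : (\sum_(L < n) L.+1%:R * rho ^+ L) * (1 - rho) ^+ 2 =
   1 - (n%:R + 1) * rho ^+ n + n%:R * rho ^+ n.+1.
  elim: n => [|n IH]; first by rewrite big_ord0 expr0; ring.
  by rewrite big_ord_recr /= mulrDl IH -!natr1 !exprS; ring.
rewrite E exprS; have h : 0 <= rho ^+ n by rewrite exprn_ge0.
have : 0 <= n%:R * rho ^+ n * (1 - rho) by rewrite mulr_ge0// ?mulr_ge0// subr_ge0 ltW.
nra.
Qed.

(** With [x] the cube root of [n] and [s = 1 / x], the price [q ^- n] is
    the constant [expR 1], and the tail decays at rate [s ^+ 2 / 200], i.e. on the
    scale [x ^+ 2]. *)
Lemma msd_upper_root (x : R) n : 1 <= x -> x ^+ 3 = n%:R ->
  msd n <= 5 * expR 1 * 200 ^+ 2 * x ^+ 4.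
Proof.
move=> x1 xn; have x0 : 0 < x by exact: lt_le_trans ltr01 x1.
pose s := x^-1; have s0 : 0 < s by rewrite invr_gt0.
have s1 : s <= 1 by rewrite invf_le1.
pose q := expR (- s ^+ 3); have q0 : 0 < q by exact: expR_gt0.
have s3 : 0 <= s ^+ 3 by rewrite exprn_ge0// ltW.
have q1 : q <= 1 by rewrite -expR0 ler_expR oppr_le0.
(* Here the choice s = n^(-1/3) is used: s^3 n = 1. *)
have qV : q^-1 ^+ n = expR 1.
  rewrite /q -expRN opprK -expRM_natl -xn /s; congr expR.
  by rewrite -exprMn divff ?expr1n// gt_eqF.
pose rho := 1 - s ^+ 2 / 200.
have s2 : 0 < s ^+ 2 by rewrite exprn_gt0.
have s21 : s ^+ 2 <= 1 by rewrite exprn_ile1// ltW.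
have rho0 : 0 <= rho by rewrite /rho; lra.
have rho1 : rho < 1 by rewrite /rho; lra.
have hq e : q ^+ e.*2.+1 * (1 + 2 * e%:R * s ^+ 3) <= 1.
  rewrite /q -expRM_natl.
  apply: (@le_trans _ _ (expR (e.*2.+1%:R * - s ^+ 3) * expR (2 * e%:R * s ^+ 3))).
    by rewrite ler_wpM2l ?expR_ge0// expR_ge1Dx// !mulr_ge0.
  rewrite -expRD -[leRHS]expR0 ler_expR -natr1 -muln2 natrM; lra.
have sup := supersolution_ineq s0 s1 q0 hq.
have tail L : (L <= n)%N ->
    mean n (fun om => iter n step_op (fun _ => reached L.+1) om 0) <= expR 1 * (rho ^+ L * (5 / 4)).
  move=> Ln; apply: (@le_trans _ _ (mean n (fun om => q^-1 ^+ n * potential q L.+1 om 0))).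
    by apply: mean_le => om; exact: hit_le_potential.
  rewrite meanZ qV ler_pM2l ?expR_gt0// mean_potential//.
  apply: (@le_trans _ _ (rho ^+ L * supersolution s 0)).
    apply: iter_avg_site_op_le => // e; apply: (@le_trans _ _ 1).
      by rewrite /start_weight exprn_ile1// ltW.
    by have /andP[] := supersolution_bounds s e.
  by rewrite ler_wpM2l ?exprn_ge0//; have /andP[] := supersolution_bounds s 0.
have tail' L : (L <= n)%N ->
    mean n (fun om => iter n step_op (fun _ p => reached L.+1 (- p)) om 0) <= expR 1 * (rho ^+ L * (5 / 4)).
  move=> Ln; rewrite (_ : (fun om => _) =
    fun om => iter n step_op (fun _ => reached L.+1) (mirror om) 0).
    by rewrite (mean_mirror (@iter_step_op_walk_supp n _ 0)); exact: tail.
  by apply: funext => om; rewrite (iter_step_op_mirror n (fun _ => reached L.+1)) oppr0.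
apply: (@le_trans _ _ (mean n (fun om => iter n step_op (fun _ p =>
    \sum_(L < n) L.*2.+1%:R * (reached L.+1 p + reached L.+1 (- p))) om 0))).
  apply: mean_le => om; apply: iter_step_op_le => om' p; rewrite subr0 => pn.
  by rewrite (sq_layer pn).
rewrite (_ : (fun om => _) = fun om => \sum_(L < n) L.*2.+1%:R *
   (iter n step_op (fun _ => reached L.+1) om 0 + iter n step_op (fun _ p => reached L.+1 (- p)) om 0)).
  rewrite mean_sum.
  apply: (@le_trans _ _ (\sum_(L < n) L.*2.+1%:R * rho ^+ L * (expR 1 * (5 / 2)))).
    apply: ler_sum => L _; rewrite meanZ meanD -mulrA ler_wpM2l//.
    have := tail L (ltnW (ltn_ord L)); have := tail' L (ltnW (ltn_ord L)); lra.
  rewrite -mulr_suml.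
  have -> : 5 * expR 1 * 200 ^+ 2 * x ^+ 4 =
      2 / (1 - rho) ^+ 2 * (expR 1 * (5 / 2)) :> R.
    rewrite /rho /s; field; rewrite gt_eqF//= gt_eqF//.
    by rewrite opprB addrC subrK.
  apply: ler_wpM2r; first by apply: mulr_ge0; [exact: expR_ge0|lra].
  by apply: sum_arith_geom; rewrite rho0.
apply: funext => om; rewrite (iter_step_op_sum n _ _ (fun (L : 'I_n) _ p => _)).
by apply: eq_bigr => L _; rewrite iter_step_opZ iter_step_opD.
Qed.

Lemma cube_root n : (0 < n)%N -> exists x : R,
  [/\ 1 <= x, x ^+ 3 = n%:R & n%:R `^ (4 / 3) = x ^+ 4].
Proof.
move=> n0; exists (n%:R `^ 3^-1); have n1 : 1 <= n%:R :> R by rewrite ler1n.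
split.
- by rewrite -[leLHS](congr1 (@^~ 3^-1) (@powR1 R)); apply: ge0_ler_powR => //; rewrite ?nnegrE ?invr_ge0 ?ler0n.
- by rewrite -powR_mulrn ?powR_ge0// -powRrM mulVf// powRr1.
- by rewrite -powR_mulrn ?powR_ge0// -powRrM mulrC.
Qed.

Lemma msd_upper : exists2 D : R, 0 < D & forall n, msd n <= D * n%:R `^ (4 / 3).
Proof.
exists (5 * expR 1 * 200 ^+ 2); first by rewrite !mulr_gt0// ?expR_gt0// exprn_gt0.
case=> [|n].
  by rewrite /msd /mean avg_cst /sq /= expr0n powR0 ?mulr0//; lra.
have [x [x1 x3 ->]] := @cube_root n.+1 isT.
exact: msd_upper_root.
Qed.

End Msd.

(** * The walk as a function of bits, and its edge local time profile *)

Section MoreAvg.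
Context {R : realType} {I : eqType}.
Implicit Types (F G : (I -> bool) -> R) (z : I -> bool) (i : I) (J : seq I).

Lemma avg1_id i F : (forall z e, F (upd z i e) = F z) -> avg1 i F = F.
Proof. by move=> H; apply: funext => z; rewrite /avg1 !H; lra. Qed.

Lemma avg_absorb i J F : i \in J -> avg J (avg1 i F) = avg J F.
Proof.
have idem : avg1 i (avg1 i F) = avg1 i F.
  by apply: avg1_id => z e; rewrite /avg1 !upd_upd.
elim: J F idem => //= j J IH F idem; rewrite inE => /orP[/eqP <-|iJ].
  by rewrite idem.
rewrite avg1C; apply: IH => //.
by apply: avg1_id => z e; rewrite /avg1 !upd_upd.
Qed.

(** A function that changes sign with a single bit has average 0: all the
    decorrelation used below. *)
Lemma avg_odd i J F z : i \in J ->
  (forall z, F (upd z i false) = - F (upd z i true)) -> avg J F z = 0.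
Proof.
move=> iJ H; rewrite -(avg_absorb _ iJ) (_ : avg1 i F = fun=> 0) ?avg_cst//.
by apply: funext => y; rewrite /avg1 H subrr mulr0.
Qed.

Lemma avg_cat J J' F : avg (J ++ J') F = avg J' (avg J F).
Proof. by elim: J F => //= i J IH F. Qed.

End MoreAvg.

Section Noise.
Context {R : realType}.

Definition noise := (option int + nat + nat)%type.

Implicit Types z : noise -> bool.

Definition arrows_of z : config := fun x => z (inl (inl x)).
Definition swap_before z : nat -> bool := fun n => z (inl (inr n)).
Definition swap_after z : nat -> bool := fun n => z (inr n).

(** The jump chain of M2 as a function of all its random bits: the initial
    arrows, the swaps before and the swaps after each step. *)
Definition walk z n : config * int := M2_chain (arrows_of z) (swap_before z) (swap_after z) n.
Definition env z n : config := (walk z n).1.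
Definition pos z n : int := (walk z n).2.

Fixpoint coins n : seq noise :=
  if n is m.+1 then inl (inr m) :: inr m :: coins m else [::].

Lemma walkS z n : walk z n.+1 = (M2_step (swap_before z n) (swap_after z n) (env z n),
  pos z n + arrow (swap_if (swap_before z n) (env z n) None)).
Proof. by rewrite /env /pos /walk /=; case: (M2_chain _ _ _ n). Qed.

Lemma walk_coins z z' n : arrows_of z = arrows_of z' ->
  (forall m, (m < n)%N -> swap_before z m = swap_before z' m /\ swap_after z m = swap_after z' m) ->
  walk z n = walk z' n.
Proof.
move=> o; elim: n => [|n IH] H; first by rewrite /walk /= o.
rewrite !walkS /env /pos IH; last by move=> m mn; apply: H; lia.
by have [-> ->] := H n (ltnSn n).
Qed.

Lemma walk_upd_b z n m e : (n <= m)%N -> walk (upd z (inl (inr m)) e) n = walk z n.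
Proof.
move=> nm; apply: walk_coins => // k kn; split=> //; rewrite /swap_before /upd.
by case: eqP => // -[]; lia.
Qed.

Lemma walk_upd_a z n m e : (n <= m)%N -> walk (upd z (inr m) e) n = walk z n.
Proof.
move=> nm; apply: walk_coins => // k kn; split=> //; rewrite /swap_after /upd.
by case: eqP => // -[]; lia.
Qed.

(** Averaging over the coins of the first [n] steps, the last one first,
    gives the [n]-th power of the transition operator. *)
Lemma avg_coins n (f : config -> int -> R) z :
  avg (coins n) (fun z => f (env z n) (pos z n)) z = iter n step_op f (arrows_of z) 0.
Proof.
elim: n f z => [|n IH] f z //; rewrite iterSr -IH [coins n.+1]/= !avg_cons.
congr (avg _ _ z); apply: funext => y; rewrite /avg1 /env /pos !walkS /=.
rewrite /step_op !big_bool /env /pos /swap_before /swap_after !walk_upd_b// !walk_upd_a//.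
by rewrite /upd !eqxx /=; field.
Qed.

Lemma avg_coins_le n N (f : config -> int -> R) z : (n <= N)%N ->
  avg (coins N) (fun z => f (env z n) (pos z n)) z = iter n step_op f (arrows_of z) 0.
Proof.
elim: N => [|N IH] nN.
  by move: nN; rewrite leqn0 => /eqP ->; rewrite -(avg_coins 0).
move: nN; rewrite leq_eqVlt => /orP[/eqP->|nN]; first exact: avg_coins.
rewrite [coins N.+1]/= !avg_cons -IH//; congr (avg _ _ z).
by rewrite !avg1_id => // y e; rewrite /env /pos ?walk_upd_b ?walk_upd_a.
Qed.

Lemma avg_arrows_of J (G : config -> R) z :
  avg [seq (inl (inl x) : noise) | x <- J] (fun z => G (arrows_of z)) z = avg J G (arrows_of z).
Proof.
by elim: J G z => //= x J IH G z; rewrite -IH; congr (avg _ _ z).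
Qed.

(** The average over the first [N] pairs of coins and over the arrows of
    [window K]. *)
Definition annealed K N (F : (noise -> bool) -> R) : R :=
  avg (coins N ++ [seq inl (inl x) | x <- window K]) F (fun=> true).

Lemma annealedE K N n (f : config -> int -> R) : (n <= N)%N ->
  annealed K N (fun z => f (env z n) (pos z n)) =
  mean K (fun om => iter n step_op f om 0).
Proof.
move=> nN; rewrite /annealed avg_cat.
rewrite (_ : avg (coins N) _ = fun z => iter n step_op f (arrows_of z) 0).
  by rewrite (avg_arrows_of _ (fun om => iter n step_op f om 0)).
by apply: funext => z; exact: avg_coins_le.
Qed.

Lemma annealed_le K N F G : (forall z, F z <= G z) -> annealed K N F <= annealed K N G.
Proof. exact: avg_le. Qed.
Lemma annealedD K N F G : annealed K N (fun z => F z + G z) = annealed K N F + annealed K N G.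
Proof. by rewrite /annealed avgD. Qed.
Lemma annealedZ K N c F : annealed K N (fun z => c * F z) = c * annealed K N F.
Proof. by rewrite /annealed avgZ. Qed.
Lemma annealed_cst K N c : annealed K N (fun=> c) = c.
Proof. by rewrite /annealed avg_cst. Qed.
Lemma annealed_sum K N (T : Type) (s : seq T) (P : pred T) F :
  annealed K N (fun z => \sum_(i <- s | P i) F i z) = \sum_(i <- s | P i) annealed K N (F i).
Proof. by rewrite /annealed avg_sum. Qed.

End Noise.

Section Profile.

Lemma arrows_at_swap_if b om x : arrows_at (swap_if b om) x = arrows_at om x.
Proof.
by case: b => //; rewrite /arrows_at /=; case: eqP => // _; exact: addrC.
Qed.

(** The arrow that has just been followed moves from one end of the
    edge to the other: whatever its direction, the drift falls by 1 at the left
    end and rises by 1 at the right end.  Swaps do not change the drift. *)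
Lemma arrows_at_step b a om y : let d := arrow (swap_if b om None) in
  arrows_at (M2_step b a om) (y - d) =
  arrows_at om y - (crosses y 0 d : nat)%:Z + (crosses (y - 1) 0 d : nat)%:Z.
Proof.
move=> d; rewrite /M2_step arrows_at_swap_if -(arrows_at_swap_if b om) {}/d.
move: (swap_if b om) => {b a}om; rewrite /arrows_at /crosses /=.
have [->|y0] := eqVneq y 0.
  by case: (om None); rewrite /= ?(subrK 1) ?(subrK (-1)); move: (arrow _) => v; lia.
rewrite subrK; case o: (om None); rewrite /arrow /=.
- have [->|y1] := eqVneq y 1; first by rewrite /= add0r; case: (om _).
  by rewrite subr_eq0 (negPf y1); case: (om _); repeat case: eqP; lia.
- have [->|y1] := eqVneq y (-1); first by rewrite /= add0r; case: (om _).
  by rewrite subr_eq0 (negPf y1); case: (om _); repeat case: eqP; lia.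
Qed.

Lemma crosses_translate x y d u : crosses u (x + y) (x + d) = crosses (u - x) y d.
Proof. by rewrite /crosses; congr (_ && _ || _ && _); apply/eqP/eqP; lia. Qed.

(** By induction: both sides change by the same amount in a step, which is
    [arrows_at_step] seen from the old position. *)
Lemma profile_env (l0 : int -> int) (z : noise -> bool) n x :
  (forall x, - grad l0 x = arrows_at (arrows_of z) x) ->
  - grad (profile l0 (pos z) n) x = arrows_at (env z n) (x - pos z n).
Proof.
move=> hl; elim: n x => [|n IH] x.
  by have h := hl x; rewrite /grad in h; rewrite /profile /grad !big_ord0 !addr0 h.
have E : - grad (profile l0 (pos z) n.+1) x = - grad (profile l0 (pos z) n) x
   - (crosses x (pos z n) (pos z n.+1) : nat)%:Z
   + (crosses (x - 1) (pos z n) (pos z n.+1) : nat)%:Z.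
  by rewrite /profile /grad !big_ord_recr /=; ring.
have P1 : pos z n.+1 = pos z n + arrow (swap_if (swap_before z n) (env z n) None).
  by rewrite {1}/pos walkS.
have E1 : env z n.+1 = M2_step (swap_before z n) (swap_after z n) (env z n) by rewrite {1}/env walkS.
rewrite E IH E1 P1 opprD addrA arrows_at_step.
have T u d : crosses u (pos z n) (pos z n + d) = crosses (u - pos z n) 0 d.
  by rewrite -crosses_translate addr0.
by rewrite !T [x - 1 - _]addrAC.
Qed.

(** A reference profile: differences of local times do not depend on the choice of
    the initial profile. *)
Definition height (om : config) (x : int) : int :=
  match x with
  | Posz n => - \sum_(i < n) arrows_at om i.+1%:Z
  | Negz n => \sum_(i < n.+1) arrows_at om (- i%:Z)
  end.

Lemma grad_height om x : - grad (height om) x = arrows_at om x.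
Proof.
rewrite /grad; case: x => [[|n]|n].
- by rewrite (_ : 0%:Z - 1 = Negz 0)// /height big_ord0 big_ord1 oppr0; ring.
- rewrite (_ : n.+1%:Z - 1 = n); last by lia.
  by rewrite /height big_ord_recr /=; ring.
- rewrite (_ : Negz n - 1 = Negz n.+1); last by lia.
  by rewrite /height [in X in _ - X]big_ord_recr /= -NegzE; ring.
Qed.

Lemma height_diff l om x n : (forall x, - grad l x = arrows_at om x) ->
  l x - l (x + n%:Z) = \sum_(i < n) arrows_at om (x + i.+1%:Z).
Proof.
move=> hl; elim: n => [|n IH]; first by rewrite big_ord0 addr0 subrr.
rewrite big_ord_recr /= -IH -hl /grad.
by rewrite (_ : x + n.+1%:Z - 1 = x + n); [ring|lia].
Qed.

(** Both sides, as functions of [y], have the same gradient by [profile_env],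
    and they vanish at [y = x]. *)
Lemma height_env (l0 : int -> int) (z : noise -> bool) n x y :
  (forall x, - grad l0 x = arrows_at (arrows_of z) x) ->
  profile l0 (pos z) n x - profile l0 (pos z) n y =
  height (env z n) (x - pos z n) - height (env z n) (y - pos z n).
Proof.
move=> hl; set l := profile l0 _ _.
have hl' u : - grad (fun v => height (env z n) (v - pos z n)) u =
             arrows_at (env z n) (u - pos z n).
  by rewrite -grad_height /grad addrAC.
have main u k : l u - l (u + k%:Z) =
   height (env z n) (u - pos z n) - height (env z n) (u + k%:Z - pos z n).
  elim: k => [|k IH]; first by rewrite addr0 !subrr.
  have e1 := profile_env n (u + k.+1%:Z) hl; have e2 := hl' (u + k.+1%:Z).
  rewrite -e2 /grad (_ : u + k.+1%:Z - 1 = u + k) in e1; last by lia.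
  by rewrite -/l in e1; lia.
have [xy|yx] := leP x y.
  have := main x (absz (y - x)); have -> : x + `|y - x|%N%:Z = y by lia.
  by [].
have := main y (absz (x - y)); have -> : y + `|x - y|%N%:Z = x by lia.
by lia.
Qed.

End Profile.

(** * Fluctuations of the profile and time spent near the origin *)

Section Heights.
Context {R : realType}.

Definition hsq (om : config) (x y : int) : R := (height om x - height om y)%:~R ^+ 2.

Lemma hsqC om x y : hsq om x y = hsq om y x.
Proof. by rewrite /hsq -sqrrN -mulrNz opprB. Qed.

Lemma arrows_at_eq_on k (om om' : config) x : {in window k, om =1 om'} ->
  (absz x <= k)%N -> arrows_at om x = arrows_at om' x.
Proof.
move=> H xk; rewrite /arrows_at (H None) ?window_None// !H ?mem_window//.
Qed.

Lemma height_eq_on k (om om' : config) x : {in window k, om =1 om'} ->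
  (absz x <= k)%N -> height om x = height om' x.
Proof.
move=> H; case: x => n /= nk.
  by congr -%R; apply: eq_bigr => i _; apply: (arrows_at_eq_on H); move: (ltn_ord i) nk => /=; lia.
by apply: eq_bigr => i _; apply: (arrows_at_eq_on H); have := ltn_ord i; lia.
Qed.

Lemma hsq_supp k x y : (absz x <= k)%N -> (absz y <= k)%N ->
  supp (window k) (fun om => hsq om x y).
Proof. by move=> xk yk z z' H; rewrite /hsq !(height_eq_on H). Qed.

Definition asum (om : config) (x : int) n : R :=
  (\sum_(i < n) arrows_at om (x + i.+1%:Z))%:~R.

Lemma arrows_at_upd om x y e : x != y ->
  arrows_at (upd om (Some y) e) x = arrows_at om x.
Proof.
move=> xy; have U u : u != y -> upd om (Some y) e (Some u) = om (Some u).
  by move=> uy; rewrite /upd ifF//; apply/eqP => -[] /eqP; rewrite (negPf uy).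
by rewrite /arrows_at; case: eqP => [x0|_]; rewrite !U// -x0.
Qed.

Lemma arrows_at_upd_None om x e : x != 0 ->
  arrows_at (upd om None e) x = arrows_at om x.
Proof. by move=> x0; rewrite /arrows_at (negPf x0). Qed.

(** The drift at a site is a sum of one or two fair arrows used
    nowhere else, so it is uncorrelated with the drifts at other sites. *)
Lemma mean_asum_arrow k (x : int) n : (absz (x + n.+1%:Z)%R <= k)%N ->
  mean k (fun om => asum om x n * (arrows_at om (x + n.+1%:Z))%:~R) = 0.
Proof.
set y := x + _ => yk.
have asumS om e : asum (upd om (Some y) e) x n = asum om x n.
  rewrite /asum; congr (_%:~R); apply: eq_bigr => i _; apply: arrows_at_upd.
  by rewrite /y; apply/eqP; have := ltn_ord i; lia.
have odd : mean k (fun om => asum om x n * (arrow (om (Some y)))%:~R) = 0.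
  apply: (@avg_odd _ _ (Some y)); first by rewrite mem_window.
  by move=> om; rewrite !asumS /upd eqxx /= -mulrN.
have [y0|y0] := eqVneq y 0; last first.
  by rewrite -[RHS]odd /mean; congr (avg _ _ _); apply: funext => om; rewrite /arrows_at (negPf y0).
have odd' : mean k (fun om => asum om x n * (arrow (om None))%:~R) = 0.
  apply: (@avg_odd _ _ None); first exact: window_None.
  move=> om; have asumN e : asum (upd om None e) x n = asum om x n.
    rewrite /asum; congr (_%:~R); apply: eq_bigr => i _; apply: arrows_at_upd_None.
    by move: y0; rewrite /y => y0; apply/eqP; have := ltn_ord i; lia.
  by rewrite !asumN /upd eqxx /= -mulrN.
rewrite (_ : (fun om => _) = fun om => asum om x n * (arrow (om (Some y)))%:~R
   + asum om x n * (arrow (om None))%:~R) ?meanD ?odd ?odd' ?addr0//.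
by apply: funext => om; rewrite /arrows_at y0 eqxx -mulrDr -intrD.
Qed.

Lemma mean_arrow_sq k (y : int) : (absz y <= k)%N ->
  mean k (fun om => (arrows_at om y)%:~R ^+ 2 : R) <= 2.
Proof.
move=> yk; have a1 b : (arrow b)%:~R ^+ 2 = 1 :> R by case: b => //=; rewrite ?sqrrN expr1n.
have [y0|y0] := eqVneq y 0; last first.
  rewrite (_ : (fun om => _) = fun=> 1) ?mean_cst; first by lra.
  by apply: funext => om; rewrite /arrows_at (negPf y0) a1.
have odd : mean k (fun om => (arrow (om (Some 0)))%:~R * (arrow (om None))%:~R : R) = 0.
  apply: (@avg_odd _ _ None); first exact: window_None.
  by move=> om; rewrite /upd /= -mulrN.
rewrite (_ : (fun om => _) = fun om => 2 + 2 * ((arrow (om (Some 0)))%:~R * (arrow (om None))%:~R)).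
  by rewrite meanD mean_cst meanZ odd; lra.
by apply: funext => om; rewrite /arrows_at y0 eqxx intrD sqrrD !a1; ring.
Qed.

Lemma mean_asum_sq k (x : int) n : (forall i, (i < n)%N -> (absz (x + i.+1%:Z)%R <= k)%N) ->
  mean k (fun om => asum om x n ^+ 2) <= 2 * n%:R.
Proof.
elim: n => [|n IH] H.
  rewrite (_ : (fun om => _) = fun=> 0) ?mean_cst ?mulr0//.
  by apply: funext => om; rewrite /asum big_ord0 expr0n.
rewrite (_ : (fun om => _) = fun om => asum om x n ^+ 2 +
   (2 * (asum om x n * (arrows_at om (x + n.+1%:Z))%:~R) +
   (arrows_at om (x + n.+1%:Z))%:~R ^+ 2)).
  rewrite !meanD meanZ mean_asum_arrow; last exact: H.
  have h1 := IH (fun i ni => H i (ltnW ni)).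
  have h2 := mean_arrow_sq (H n (ltnSn n)).
  by rewrite -natr1; lra.
by apply: funext => om; rewrite /asum big_ord_recr /= intrD; ring.
Qed.

(** The height function is a random walk with independent steps of variance
    1, or 2 at the walker. *)
Lemma mean_hsq k (x y : int) : (absz x <= k)%N -> (absz y <= k)%N ->
  mean k (fun om => hsq om x y) <= 2 * (absz (x - y)%R)%:R.
Proof.
wlog xy : x y / x <= y => [H|] xk yk.
  have [xy|yx] := leP x y; first exact: H.
  rewrite (_ : (fun om => _) = fun om => hsq om y x); last by apply: funext => om; exact: hsqC.
  by rewrite distnC; apply: H => //; exact: ltW.
rewrite (_ : (fun om => _) = fun om => asum om x (absz (x - y)) ^+ 2).
  by apply: mean_asum_sq => i ni; lia.
apply: funext => om; rewrite /hsq /asum -(height_diff _ _ (grad_height om)).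
by congr ((_ - height om _)%:~R ^+ 2); lia.
Qed.

End Heights.

Section Boxes.

Definition box m : seq int := [seq i%:Z - m%:Z | i <- iota 0 m.*2.+1].

Lemma mem_box m x : (x \in box m) = (absz x <= m)%N.
Proof.
apply/mapP/idP => [[i]|xm].
  by rewrite mem_iota => /andP[_ im] ->; lia.
by exists (absz (x + m%:Z)); rewrite ?mem_iota; lia.
Qed.

Lemma box_uniq m : uniq (box m).
Proof. by rewrite map_inj_uniq ?iota_uniq// => i j; lia. Qed.

Lemma size_box m : size (box m) = m.*2.+1.
Proof. by rewrite size_map size_iota. Qed.

Lemma sum_subset (R : numDomainType) (T : eqType) (s t : seq T) (f : T -> R) :
  uniq s -> uniq t -> {subset s <= t} -> (forall x, 0 <= f x) ->
  \sum_(x <- s) f x <= \sum_(x <- t) f x.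
Proof.
move=> us ut st f0.
rewrite (perm_big [seq x <- t | x \in s]) /=; last first.
  apply: uniq_perm; rewrite ?filter_uniq// => x; rewrite mem_filter.
  by case xs: (x \in s) => //=; rewrite st.
by rewrite big_filter [leRHS](bigID (mem s)) /= lerDl sumr_ge0.
Qed.

Lemma sum_box_translate (R : numDomainType) A B (p : int) (f : int -> R) :
  (absz p + A <= B)%N -> (forall x, 0 <= f x) ->
  \sum_(x <- box A) f (x - p) <= \sum_(x <- box B) f x.
Proof.
move=> pAB f0; rewrite -(big_map (fun x => x - p) xpredT f).
apply: sum_subset => //; rewrite ?box_uniq//.
  by rewrite map_inj_uniq ?box_uniq//; exact: addIr.
by move=> x /mapP[y]; rewrite !mem_box => yA ->; lia.
Qed.

End Boxes.

Section LocalTime.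
Context {R : realType}.
Implicit Types z : noise -> bool.

Definition visits w N z : R := \sum_(k < N) ((absz (pos z k) <= w)%N : nat)%:R.

(** The left endpoint of the edge crossed by the step number [k]. *)
Definition edge z k : int :=
  if pos z k.+1 == pos z k + 1 then pos z k else pos z k - 1.

Lemma crosses_edge z k x : crosses x (pos z k) (pos z k.+1) = (x == edge z k).
Proof.
have PS : pos z k.+1 = pos z k + arrow (swap_if (swap_before z k) (env z k) None).
  by rewrite {1}/pos walkS.
rewrite /edge /crosses PS; move: (pos z k) => p.
case: (swap_if _ _ _); rewrite /arrow.
  by rewrite eqxx; apply/idP/eqP; lia.
by rewrite ifF; [apply/idP/eqP; lia|lia].
Qed.

Lemma edge_dist z k : (absz (edge z k) <= (absz (pos z k)).+1)%N.
Proof. by rewrite /edge; case: ifP => _; lia. Qed.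

Definition ltime N z (x : int) : R := \sum_(k < N) ((x == edge z k) : nat)%:R.

Lemma sum_edge (s : seq int) z k : uniq s ->
  \sum_(x <- s) ((x == edge z k) : nat)%:R = ((edge z k \in s) : nat)%:R :> R.
Proof.
move=> us; rewrite -natr_sum -(count_uniq_mem _ us) -sum1_count [in RHS]big_mkcond.
by congr (_%:R); apply: eq_bigr => x _ /=; case: eqP.
Qed.

Lemma visits_le_ltime w N z : visits w N z <= \sum_(x <- box w.+1) ltime N z x.
Proof.
rewrite exchange_big; apply: ler_sum => k _; rewrite sum_edge ?box_uniq// ler_nat.
have [h|//] := leqP (absz (pos z k)) w.
by rewrite mem_box (leq_trans (edge_dist z k)).
Qed.

Lemma sum_ltime_le r N z : \sum_(x <- box r) ltime N z x <= N%:R.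
Proof.
rewrite exchange_big (@le_trans _ _ (\sum_(k < N) 1))//.
  by apply: ler_sum => k _; rewrite sum_edge ?box_uniq// lern1; case: (_ \in _).
by rewrite sumr_const card_ord.
Qed.

(** The local time of an edge is its profile at time [N] minus its profile at
    time 0; both are height functions. *)
Lemma ltime_diff N z x y :
  ltime N z x - ltime N z y =
  (height (env z N) (x - pos z N) - height (env z N) (y - pos z N))%:~R
  - (height (arrows_of z) x - height (arrows_of z) y)%:~R.
Proof.
rewrite -(height_env N x y (grad_height (arrows_of z))) -intrB /profile.
have E u : ltime N z u =
   (\sum_(m < N) (crosses u (pos z m) (pos z m.+1) : nat)%:Z)%:~R.
  by rewrite raddf_sum; apply: eq_bigr => k _; rewrite crosses_edge.
by rewrite !E -intrB; congr (_%:~R); ring.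
Qed.

(** Young's inequality with parameter [rho] linearises the local time
    difference into squared heights, whose averages are known. *)
Lemma ltime_comparison N z x y (rho : R) : 0 < rho ->
  ltime N z x <= ltime N z y + rho + (2 * rho)^-1 *
   (hsq (env z N) (x - pos z N) (y - pos z N) + hsq (arrows_of z) x y).
Proof.
move=> r0; have := ltime_diff N z x y; rewrite /hsq.
set A := _%:~R; set B := (height (arrows_of z) x - _)%:~R.
have sqb (a : R) : a <= rho / 2 + (2 * rho)^-1 * a ^+ 2.
  rewrite -subr_ge0 (_ : _ - a = (2 * rho)^-1 * (a - rho) ^+ 2).
    by rewrite mulr_ge0 ?sqr_ge0// invr_ge0; lra.
  by field; rewrite gt_eqF.
have := sqb A; have := sqb (- B); rewrite sqrrN; lra.
Qed.

(** Averaging the comparison over [y] in a larger box: the local times there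
    have total at most [N]. *)
Lemma visits_bound w r N z (rho : R) : 0 < rho ->
  r.*2.+1%:R * visits w N z <= w.*2.+3%:R * (N%:R + r.*2.+1%:R * rho) +
   (2 * rho)^-1 * (\sum_(x <- box w.+1) \sum_(y <- box r) 
   (hsq (env z N) (x - pos z N) (y - pos z N) + hsq (arrows_of z) x y)).
Proof.
move=> r0; apply: (@le_trans _ _ (\sum_(x <- box w.+1) r.*2.+1%:R * ltime N z x)).
  by rewrite -mulr_sumr ler_wpM2l// visits_le_ltime.
rewrite mulr_sumr.
have -> : w.*2.+3%:R * (N%:R + r.*2.+1%:R * rho) =
    \sum_(x <- box w.+1) (N%:R + r.*2.+1%:R * rho).
  by rewrite big_const_seq count_predT size_box iter_addr_0 -[RHS]mulr_natl.
rewrite -big_split /=; apply: ler_sum => x _.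
apply: (@le_trans _ _ (\sum_(y <- box r) (ltime N z y + rho + (2 * rho)^-1 *
   (hsq (env z N) (x - pos z N) (y - pos z N) + hsq (arrows_of z) x y)))).
  rewrite (_ : _ * _ = \sum_(y <- box r) ltime N z x).
    by apply: ler_sum => y _; exact: ltime_comparison.
  by rewrite big_const_seq count_predT size_box iter_addr_0 -[RHS]mulr_natl.
rewrite big_split [in leLHS]big_split /= -mulr_sumr lerD2r lerD//; first exact: sum_ltime_le.
by rewrite big_const_seq count_predT size_box iter_addr_0 -[leLHS]mulr_natl.
Qed.

End LocalTime.

(** * The lower bound in discrete time *)

Section LowerBound.
Context {R : realType}.
Implicit Types z : noise -> bool.

Lemma annealed_sq K N k : (k <= N)%N -> (N <= K)%N ->
  annealed K N (fun z => sq (pos z k) : R) = msd k.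
Proof.
move=> kN NK; rewrite (annealedE K (fun _ p => sq p) kN).
by rewrite (mean_widen (@iter_step_op_walk_supp R k sq 0)) ?(leq_trans kN).
Qed.

Lemma annealed_hsq_env K N x y : (absz x + absz y + N <= K)%N ->
  annealed K N (fun z => hsq (env z N) x y : R) <= 2 * (absz x + absz y)%:R.
Proof.
move=> h; rewrite (annealedE K (fun om _ => hsq om x y) (leqnn N)).
rewrite (@mean_iter_step_op _ (absz x + absz y) N K)//; last by apply: hsq_supp; lia.
apply: (le_trans (mean_hsq _ _)); [lia|lia|].
by rewrite ler_pM2l// ler_nat; lia.
Qed.

Lemma annealed_hsq_start K N x y : (absz x + absz y <= K)%N ->
  annealed K N (fun z => hsq (arrows_of z) x y : R) <= 2 * (absz x + absz y)%:R.
Proof.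
move=> h; have := @annealedE R K N 0 (fun om _ => hsq om x y) (leq0n N).
rewrite /env /= => ->; apply: (le_trans (mean_hsq _ _)); [lia|lia|].
by rewrite ler_pM2l// ler_nat; lia.
Qed.

Lemma sum_box_le A B (f : int -> int -> R) c :
  (forall x y, (absz x <= A)%N -> (absz y <= B)%N -> f x y <= c) ->
  \sum_(x <- box A) \sum_(y <- box B) f x y <= A.*2.+1%:R * (B.*2.+1%:R * c).
Proof.
move=> H.
apply: (@le_trans _ _ (\sum_(x <- box A) \sum_(y <- box B) c)).
  rewrite big_seq [leRHS]big_seq; apply: ler_sum => x; rewrite mem_box => xA.
  rewrite big_seq [leRHS]big_seq; apply: ler_sum => y; rewrite mem_box => yB.
  exact: H.
by rewrite !big_const_seq !count_predT !size_box !iter_addr_0 -[leLHS]mulr_natl -[c *+ _]mulr_natl.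
Qed.

(** The indicator that the walk ends within distance [w] of 0: on this event
    a box around the walker is contained in a box around the origin. *)
Definition near_origin w z N : R := ((absz (pos z N) <= w)%N : nat)%:R.

Lemma sq_ge w (p : int) : (w < absz p)%N -> w%:R ^+ 2 <= sq p :> R.
Proof.
move=> wp; rewrite /sq -(real_normK (num_real p%:~R)) -intr_norm -abszE -pmulrn.
by rewrite lerXn2r ?nnegrE// ler_nat ltnW.
Qed.

Lemma sq_ge0 p : 0 <= sq p :> R.
Proof. exact: sqr_ge0. Qed.

(** Markov's inequality in pointwise form: it will be averaged when the mean
    square displacements up to [N] are small against [w^2], and then the walk is
    near the origin most of the time, and also at time [N]. *)
Lemma visits_lower w N z : (0 < w)%N ->
  N%:R - (w%:R ^+ 2)^-1 * (\sum_(k < N) sq (pos z k) + N%:R * sq (pos z N)) <=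
  near_origin w z N * visits w N z :> R.
Proof.
move=> w0; have W0 : 0 < (w%:R ^+ 2 : R) by rewrite exprn_gt0// ltr0n.
have E : N%:R - (w%:R ^+ 2)^-1 * (\sum_(k < N) sq (pos z k) + N%:R * sq (pos z N)) =
   \sum_(k < N) (1 - (w%:R ^+ 2)^-1 * (sq (pos z k) + sq (pos z N))) :> R.
  rewrite sumrB -mulr_sumr big_split/= !sumr_const card_ord -[sq _ *+ N]mulr_natl.
  by [].
rewrite E mulr_sumr; apply: ler_sum => k _; rewrite /near_origin.
have V0 : 0 <= (w%:R ^+ 2)^-1 :> R by rewrite invr_ge0 ltW.
have s1 := sq_ge0 (pos z k); have s2 := sq_ge0 (pos z N).
have [h|/sq_ge h] := leqP (absz (pos z N)) w; last first.
  rewrite mul0r subr_le0 -[leLHS](mulVf (lt0r_neq0 W0)).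
  by rewrite ler_wpM2l//; lra.
rewrite mul1r; have [h'|/sq_ge h'] := leqP (absz (pos z k)) w; last first.
  rewrite subr_le0 -[leLHS](mulVf (lt0r_neq0 W0)).
  by rewrite ler_wpM2l//; lra.
by rewrite gerBl mulr_ge0// addr_ge0.
Qed.

Lemma hsq_ge0 om x y : 0 <= hsq om x y :> R.
Proof. exact: sqr_ge0. Qed.

(** The heights at time [N] are indexed by the distance to the walker.
    Translating the boxes by the final position, at most [w], removes this
    dependence, so that stationarity applies to each term. *)
Lemma visits_upper w r N z (rho : R) : 0 < rho ->
  r.*2.+1%:R * (near_origin w z N * visits w N z) <=
  w.*2.+3%:R * (N%:R + r.*2.+1%:R * rho) + (2 * rho)^-1 *
   (\sum_(x <- box w.*2.+1) \sum_(y <- box (r + w)) hsq (env z N) x y +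
    \sum_(x <- box w.+1) \sum_(y <- box r) hsq (arrows_of z) x y).
Proof.
move=> r0; have c0 : 0 <= (2 * rho)^-1 by rewrite invr_ge0; lra.
rewrite /near_origin; case: leqP => h; last first.
  rewrite mul0r mulr0 addr_ge0//; first by rewrite mulr_ge0// addr_ge0// mulr_ge0// ltW.
  rewrite mulr_ge0// addr_ge0//;
    by apply: sumr_ge0 => x _; apply: sumr_ge0 => y _; exact: hsq_ge0.
rewrite mul1r; apply: (le_trans (visits_bound w r N z r0)).
rewrite lerD2l ler_wpM2l//.
under eq_bigr do rewrite big_split/=.
rewrite big_split/= lerD2r.
apply: (@le_trans _ _ (\sum_(x <- box w.+1) \sum_(y <- box (r + w)) hsq (env z N) (x - pos z N) y)).
  apply: ler_sum => x _; apply: (@sum_box_translate _ _ _ _ (hsq (env z N) (x - pos z N))).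
    by lia.
  by move=> y; exact: hsq_ge0.
apply: (@sum_box_translate _ _ _ _ (fun u => \sum_(y <- box (r + w)) hsq (env z N) u y)).
  by lia.
by move=> x; apply: sumr_ge0 => y _; exact: hsq_ge0.
Qed.

Lemma msd1 : msd 1 = 1 :> R.
Proof.
rewrite /msd (_ : (fun om => _) = fun=> 1) ?mean_cst//.
apply: funext => om /=; rewrite /step_op !big_bool /= add0r /sq.
have a1 b : (arrow b)%:~R ^+ 2 = 1 :> R by case: b => //=; rewrite ?sqrrN expr1n.
by rewrite !add0r !a1; field.
Qed.

(** With boxes of radii [W] (at most [x^2 / 1000]) and about [x^2], the lower
    bound on the weighted visits is of order [x^5], while the upper bound is of
    order [W x^3]. *)
Lemma box_numerics (x W Rr S : R) : 1 <= x -> 1 <= W -> W <= Rr ->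
  x ^+ 2 <= Rr -> Rr <= 2 * x ^+ 2 -> 1000 * W <= x ^+ 2 ->
  x ^+ 3 * (6 / 10) <= S ->
  (2 * Rr + 1) * S <=
  (2 * W + 3) * (x ^+ 3 + (2 * Rr + 1) * x) +
  (2 * x)^-1 *
  ((2 * (2 * W + 1) + 1) *
   ((2 * (Rr + W) + 1) * (2 * (2 * W + 1 + (Rr + W)))) +
   (2 * W + 3) * ((2 * Rr + 1) * (2 * (W + 1 + Rr)))) -> False.
Proof.
move=> x1 W1 wr rx rx2 Wx low.
have x0' : 0 <= x by lra.
have x30 : 0 < x ^+ 3 by rewrite exprn_gt0//; lra.
have prod3 (a b c a' b' c' : R) : 0 <= a <= a' -> 0 <= b <= b' -> 0 <= c <= c' ->
    a * (b * c) <= a' * (b' * c').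
  move=> /andP[a0 aa] /andP[b0 bb] /andP[c0 cc].
  by apply: ler_pM => //; [exact: mulr_ge0|exact: ler_pM].
have g1 : (2 * W + 3) * (x ^+ 3 + (2 * Rr + 1) * x) <= 30 * (W * x ^+ 3).
  apply: (@le_trans _ _ (5 * W * (x ^+ 3 + 5 * x ^+ 2 * x))).
    have x21 : 1 <= x ^+ 2 by rewrite exprn_ege1.
    clear low Wx x30; apply: ler_pM; [lra| |lra|].
      by rewrite addr_ge0 ?exprn_ge0// mulr_ge0//; lra.
    by rewrite lerD2l ler_wpM2r//; lra.
  by rewrite (_ : 5 * x ^+ 2 * x = 5 * x ^+ 3); [lra|ring].
have g2 : (2 * (2 * W + 1) + 1) * ((2 * (Rr + W) + 1) * (2 * (2 * W + 1 + (Rr + W)))) <=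
    7 * W * (5 * Rr * (10 * Rr)) by clear g1 low Wx x30 rx rx2 x0'; apply: prod3; lra.
have g3 : (2 * W + 3) * ((2 * Rr + 1) * (2 * (W + 1 + Rr))) <=
    5 * W * (3 * Rr * (6 * Rr)) by clear g1 g2 low Wx x30 rx rx2 x0'; apply: prod3; lra.
set T1 := _ * (_ * (2 * (2 * W + 1 + (Rr + W)))) in g2 *.
set T2 := _ * (_ * (2 * (W + 1 + Rr))) in g3 *.
have h1 : x ^+ 2 * x ^+ 3 * (12 / 10) <= (2 * Rr + 1) * S.
  apply: (@le_trans _ _ ((2 * Rr + 1) * (x ^+ 3 * (6 / 10)))); last by rewrite ler_wpM2l//; clear g1; lra.
  have ab : x ^+ 2 * x ^+ 3 <= Rr * x ^+ 3 by rewrite ler_wpM2r// ltW.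
  rewrite (_ : (2 * Rr + 1) * _ = Rr * x ^+ 3 * (12 / 10) + x ^+ 3 * (6 / 10)); last by field.
  by rewrite -subr_ge0 in ab; clear g1; lra.
have h2 : 1000 * (W * x ^+ 3) <= x ^+ 2 * x ^+ 3.
  by rewrite mulrA ler_wpM2r//; lra.
have h3 : 0 < x ^+ 2 * x ^+ 3 by rewrite mulr_gt0// exprn_gt0//; lra.
have RR : Rr * Rr <= 4 * (x * x ^+ 3).
  apply: (@le_trans _ _ (2 * x ^+ 2 * (2 * x ^+ 2))); last by rewrite le_eqVlt; apply/orP; left; apply/eqP; ring.
  by clear g1 g2 g3 h1 h2 h3 low Wx x30 T1 T2; apply: ler_pM; lra.
have WRR : W * (Rr * Rr) <= W * (4 * (x * x ^+ 3)).
  by rewrite ler_wpM2l//; clear g1 g2 g3 h1 h2 h3; lra.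
have g4 : (2 * x)^-1 * (T1 + T2) <= 880 * (W * x ^+ 3).
  rewrite ler_pdivrMl; last by rewrite mulr_gt0//; lra.
  apply: (le_trans (lerD g2 g3)).
  rewrite (_ : _ + _ = 440 * (W * (Rr * Rr))); last by ring.
  rewrite (_ : 2 * x * _ = 440 * (W * (4 * (x * x ^+ 3)))); last by ring.
  by rewrite ler_pM2l.
move: g1 g4 h1 h2 h3; clear; rewrite -/T1 -/T2.
set A := (2 * Rr + 1) * S; set B := _ * (x ^+ 3 + _); set C := _^-1 * _.
move: A B C (W * _) (x ^+ 2 * _) => A B C u v; lra.
Qed.

(** Otherwise the annealed bounds of [visits_lower] and [visits_upper] on
    the same quantity contradict each other. *)
Lemma msd_large_somewhere (kap x : R) N : 0 < kap -> 1000 * kap <= 1 ->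
  1 <= x -> x ^+ 3 = N%:R ->
  exists2 k, (k <= N)%N & kap ^+ 2 / 20 * x ^+ 4 <= msd k.
Proof.
move=> kap0 kap1 x1 xN; have x0 : 0 < x by lra.
have N0 : (0 < N)%N.
  by rewrite -(ltr_nat R) -xN exprn_gt0.
have x21 : 1 <= x ^+ 2 by rewrite exprn_ege1.
apply: contrapT => H.
have {}H k : (k <= N)%N -> msd k < kap ^+ 2 / 20 * x ^+ 4.
  by move=> kN; rewrite ltNge; apply/negP => Hk; apply: H; exists k.
pose y := kap * x ^+ 2; have y4 : kap ^+ 2 / 20 * x ^+ 4 = y ^+ 2 / 20.
  by rewrite /y; ring.
rewrite y4 in H; have y0 : 0 < y by rewrite mulr_gt0// exprn_gt0.
have yx : 1000 * y <= x ^+ 2 by rewrite /y mulrA ler_piMl// ltW// exprn_gt0.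
clearbody y.
have [ys|yb] := ltP y 1.
  have := H 1%N N0; rewrite msd1.
  have : 0 <= (1 - y) * (1 + y) by apply: mulr_ge0; lra.
  lra.
(* The radii of the boxes are the integer parts of kappa x^2 and of x^2 + 1. *)
have [w /andP[w1 w2]] : exists w : nat, w%:R <= y < w.+1%:R.
  by exists (Num.truncn y); apply: truncn_itv; lra.
have [r' /andP[r1 r2]] : exists r : nat, r%:R <= x ^+ 2 < r.+1%:R.
  by exists (Num.truncn (x ^+ 2)); apply: truncn_itv; lra.
rewrite -natr1 in w2; rewrite -natr1 in r2.
have [r rE] : exists r, r%:R = r'%:R + 1 :> R by exists r'.+1; rewrite natr1.
have w0 : (0 < w)%N.
  case: w w1 w2 => // _; lra.
have W1 : 1 <= w%:R :> R by rewrite ler1n.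
have [K KE] : exists K, K = (N + (w.*2.+1 + (r + w)))%N by eexists.
have aE k : (k <= N)%N -> annealed K N (fun z => sq (pos z k)) = msd k :> R.
  by move=> kN; apply: (annealed_sq kN); rewrite KE leq_addr.
have KN a : (a <= w.*2.+1 + (r + w))%N -> (a + N <= K)%N.
  by move=> aw; rewrite KE [leqRHS]addnC leq_add2r.
have KN' a : (a <= w.+1 + r)%N -> (a <= K)%N.
  move=> aw; rewrite KE (leq_trans aw)// (leq_trans _ (leq_addl _ _))// leq_add//.
    by rewrite ltnS -addnn leq_addr.
  exact: leq_addr.
pose S := annealed K N (fun z => near_origin w z N * visits w N z).
have low : N%:R * (6 / 10) <= S.
  apply: (@le_trans _ _ (annealed K N (fun z => N%:R + (- (w%:R ^+ 2)^-1) *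
     (\sum_(k < N) sq (pos z k) + N%:R * sq (pos z N))))); last first.
    by apply: annealed_le => z; rewrite mulNr; exact: visits_lower.
  rewrite annealedD annealed_cst annealedZ annealedD annealed_sum annealedZ.
  rewrite (aE N (leqnn N)) (eq_bigr (fun k : 'I_N => msd k)); last first.
    by move=> k _; apply: aE; exact: ltnW (ltn_ord k).
  set T := \sum_(k < N) _ + _.
  have TN : T <= N%:R * (y ^+ 2 / 10).
    have -> : N%:R * (y ^+ 2 / 10) = \sum_(k < N) (y ^+ 2 / 20) +
        N%:R * (y ^+ 2 / 20).
      by rewrite sumr_const card_ord -[_ *+ N]mulr_natl; lra.
    apply: lerD; last by rewrite ler_wpM2l// ltW// H.
    apply: ler_sum => k _; by rewrite ltW// H// ltnW// ltn_ord.
  have W0 : 0 < (w%:R ^+ 2 : R) by rewrite exprn_gt0// ltr0n.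
  have : (w%:R ^+ 2)^-1 * T <= N%:R * (4 / 10).
    rewrite ler_pdivrMl//; apply: (le_trans TN).
    rewrite [leRHS]mulrCA ler_wpM2l//.
    have : 0 <= (2 * w%:R - y) * (2 * w%:R + y) by apply: mulr_ge0; lra.
    lra.
  lra.
have up : r.*2.+1%:R * S <= w.*2.+3%:R * (N%:R + r.*2.+1%:R * x) + (2 * x)^-1 *
   (w.*2.+1.*2.+1%:R * ((r + w).*2.+1%:R * (2 * (w.*2.+1 + (r + w))%:R)) +
    w.+1.*2.+1%:R * (r.*2.+1%:R * (2 * (w.+1 + r)%:R))).
  rewrite /S -annealedZ.
  apply: (le_trans (annealed_le K N (fun z => visits_upper w r N z x0))).
  rewrite annealedD annealed_cst annealedZ annealedD lerD2l ler_wpM2l//.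
    by rewrite invr_ge0; lra.
  apply: lerD; rewrite annealed_sum.
    under eq_bigr do rewrite annealed_sum.
    apply: sum_box_le => u v uA vB.
    apply: (le_trans (annealed_hsq_env _)); first by apply: KN; exact: leq_add.
    by rewrite ler_pM2l// ler_nat leq_add.
  under eq_bigr do rewrite annealed_sum.
  apply: sum_box_le => u v uA vB.
  apply: (le_trans (annealed_hsq_start _ _)); first by apply: KN'; exact: leq_add.
  by rewrite ler_pM2l// ler_nat leq_add.
have rx : x ^+ 2 <= r%:R by rewrite rE; lra.
have rx2 : r%:R <= 2 * x ^+ 2 by rewrite rE; lra.
have wr : w%:R <= r%:R :> R by lra.
have d2 m : (m.*2%:R = 2 * m%:R :> R) by rewrite -mul2n natrM.
have d1 m : (m.*2.+1%:R = 2 * m%:R + 1 :> R) by rewrite -natr1 d2.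
have e1 : w.*2.+3%:R = 2 * w%:R + 3 :> R by rewrite -addn3 natrD d2.
have e2 : (w.+1 + r)%:R = w%:R + 1 + r%:R :> R by rewrite natrD -natr1.
have e3 : w.+1%:R = w%:R + 1 :> R by rewrite natr1.
move: up; rewrite e1 e2 natrD !d1 !natrD -xN; rewrite -xN in low.
move: (w%:R : R) (r%:R : R) S low w1 w2 W1 rx rx2 wr {rE} => W Rr S low w1 w2 W1 rx rx2 wr up.
apply: (box_numerics x1 W1 wr rx rx2 _ low up).
apply: (le_trans _ yx); rewrite ler_wpM2l ?ler0n//.
Qed.

(** The increments after time [n] are those of a walk started from the
    stationary law; the weights [t], [1/t] come from the square of a sum. *)
Lemma msd_add (t : R) n m : 0 < t ->
  msd (n + m) <= (1 + t) * msd n + (1 + t^-1) * msd m.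
Proof.
move=> t0.
pose G om := iter m step_op (fun _ p => sq p) om 0 : R.
have sG : supp (window m) G by exact: iter_step_op_walk_supp.
have step om p : iter m step_op (fun _ p => sq p) om p <=
   (1 + t) * sq p + (1 + t^-1) * G om.
  rewrite iter_step_op_translate /G.
  have -> : (1 + t) * sq p + (1 + t^-1) * iter m step_op (fun _ p => sq p) om 0 =
     iter m step_op (fun _ u => (1 + t) * sq p + (1 + t^-1) * sq u) om 0.
    rewrite (iter_step_opD m (fun _ _ => (1 + t) * sq p) (fun _ u => (1 + t^-1) * sq u)).
    by rewrite iter_step_op_cst iter_step_opZ.
  apply: iter_step_op_le => om' u _; rewrite /sq intrD.
  move: (p%:~R : R) (u%:~R : R) => a b; rewrite -subr_ge0.
  rewrite (_ : _ - _ = t^-1 * (t * a - b) ^+ 2); last by field; rewrite gt_eqF.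
  by rewrite mulr_ge0 ?sqr_ge0// invr_ge0 ltW.
rewrite {1}/msd.
apply: (@le_trans _ _ (mean (n + m) (fun om => iter n step_op (fun om p =>
   (1 + t) * sq p + (1 + t^-1) * G om) om 0))).
  by apply: mean_le => om; rewrite iterD; apply: iter_step_op_le => om' p _; exact: step.
rewrite (_ : (fun om => _) = fun om => (1 + t) * iter n step_op (fun _ p => sq p) om 0 +
   (1 + t^-1) * iter n step_op (fun om _ => G om) om 0); last first.
  by apply: funext => om; rewrite iter_step_opD !iter_step_opZ.
rewrite meanD !meanZ (mean_widen (@iter_step_op_walk_supp R n sq 0)) ?leq_addr//.
rewrite (mean_iter_step_op sG) ?(addnC m)//.
by rewrite (mean_widen sG) ?leq_addl.
Qed.

Lemma msd_ge0 n : 0 <= msd n :> R.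
Proof.
rewrite -(mean_cst n (0 : R)) /msd; apply: mean_le => om.
have <- : iter n step_op (fun _ _ => 0 : R) om 0 = 0 by rewrite iter_step_op_cst.
by apply: iter_step_op_le => om' p _; exact: sq_ge0.
Qed.

Lemma msd0 : msd 0 = 0 :> R.
Proof. by rewrite /msd /= mean_cst /sq expr0n. Qed.

(** The triangle inequality in L^2 for [j] stationary increments; taking
    [t = 1 / j] at each stage makes the induction exact. *)
Lemma msd_mul j n : msd (j * n) <= j%:R ^+ 2 * msd n :> R.
Proof.
elim: j => [|[|j] IH]; first by rewrite mul0n msd0 expr0n mul0r.
  by rewrite mul1n expr1n mul1r.
rewrite mulSnr; have j0 : 0 < j.+1%:R :> R by rewrite ltr0n.
have := @msd_add (j.+1%:R^-1) (j.+1 * n) n; rewrite invr_gt0 => /(_ j0) h.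
apply: (le_trans h); rewrite invrK.
apply: (@le_trans _ _ ((1 + j.+1%:R^-1) * (j.+1%:R ^+ 2 * msd n) + (1 + j.+1%:R) * msd n)).
  by rewrite lerD2r ler_wpM2l// addr_ge0// invr_ge0 ltW.
rewrite -[j.+2%:R]natr1; have := msd_ge0 n.
move: (j.+1%:R : R) j0 => v v0 m0; rewrite le_eqVlt; apply/orP; left; apply/eqP.
by field; rewrite gt_eqF.
Qed.

(** Some time [k <= M n] has a mean square displacement at least
    [c (m^3 n)^(4/3) = c m^4 n^(4/3)] where [M = m^3].  Writing [k = j n + r],
    the remainder contributes at most [2 D n^(4/3)] by the upper bound, which is
    negligible for [m] large, so that the rest is due to [j^2 msd(n)]. *)
Lemma msd_lower : exists2 C : R, 0 < C & forall n, C * n%:R `^ (4 / 3) <= msd n.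
Proof.
have [D D0 up] := @msd_upper R.
pose kap : R := 1000^-1; pose c := kap ^+ 2 / 20.
have kap0 : 0 < kap by rewrite invr_gt0 ltr0n.
have c0 : 0 < c by rewrite divr_gt0// exprn_gt0.
have kap1 : 1000 * kap <= 1 by rewrite /kap mulfV ?pnatr_eq0.
have [m m1 mD] : exists2 m : nat, (0 < m)%N & 4 * D <= c * m%:R ^+ 4.
  exists (Num.truncn (4 * D / c)).+1 => //.
  have h : 4 * D / c < (Num.truncn (4 * D / c)).+1%:R by exact: truncnS_gt.
  rewrite -ler_pdivrMl// mulrC (le_trans (ltW h))//.
  by rewrite -[leLHS]expr1 ler_weXn2l// ler1n.
pose M := (m ^ 3)%N; have M0 : (0 < M)%N by rewrite expn_gt0 m1.
exists (D / M%:R ^+ 2); first by rewrite divr_gt0// exprn_gt0// ltr0n.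
case=> [|n].
  by rewrite msd0 powR0 ?mulr0//; lra.
have [x [x1 x3 xE]] := @cube_root R n.+1 isT; rewrite xE.
have m1' : 1 <= m%:R :> R by rewrite ler1n.
(* The cube root of M n is m x. *)
have [k kN kc] := @msd_large_somewhere kap (m%:R * x) (M * n.+1) kap0 kap1
   (mulr_ege1 m1' x1) (ltac:(by rewrite exprMn x3 natrM natrX)).
have x40 : 0 < x ^+ 4 by rewrite exprn_gt0//; lra.
have kle : msd k <= 2 * (D * x ^+ 4) + 2 * (M%:R ^+ 2 * msd n.+1).
  rewrite {1}(divn_eq k n.+1).
  have := @msd_add 1 (k %/ n.+1 * n.+1) (k %% n.+1) ltr01; rewrite invr1 => h.
  apply: (le_trans h); rewrite addrC; apply: lerD.
    rewrite -[1 + 1]/2 ler_pM2l//; apply: (le_trans (up _)).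
    rewrite ler_pM2l// -xE; apply: ge0_ler_powR; rewrite ?nnegrE ?ler0n ?divr_ge0//.
    by rewrite ler_nat ltnW// ltn_mod.
  rewrite -[1 + 1]/2 ler_pM2l//; apply: (le_trans (msd_mul _ _)).
  rewrite ler_wpM2r ?msd_ge0// lerXn2r ?nnegrE// ler_nat.
  by rewrite -(leq_pmul2r (ltn0Sn n)) (leq_trans _ kN)// leq_divM.
rewrite -/c in kc.
have M20 : 0 < M%:R ^+ 2 :> R by rewrite exprn_gt0// ltr0n.
rewrite mulrAC ler_pdivrMr// mulrC.
have : 4 * D * x ^+ 4 <= c * (m%:R * x) ^+ 4.
  by rewrite exprMn [leRHS]mulrA ler_wpM2r// ltW.
lra.
Qed.

End LowerBound.

(** * Independence of blocks of sigma-algebras *)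

Section Independence.
Context d (T : measurableType d) (R : realType) (P : probability T R).
Local Open Scope ereal_scope.

(** Dynkin's theorem: the events independent of [A] form a Dynkin system. *)
Lemma indep_pi_system (G : set (set T)) (A : set T) : measurable A ->
  setI_closed G -> (forall E, G E -> measurable E /\ P (E `&` A) = P E * P A) ->
  forall E, <<s G >> E -> measurable E /\ P (E `&` A) = P E * P A.
Proof.
move=> mA GI GA; rewrite -setI_closed_g_dynkin_g_sigma_algebra//.
apply: smallest_sub => //; split.
- by split; [exact: measurableT|rewrite setTI probability_setT mul1e].
- move=> E [mE PE]; split; first exact: measurableC.
  rewrite (setIC (~` E)) -setDE measureD//; last by rewrite ltey_eq fin_num_measure.
  rewrite [A `&` E]setIC [X in _ - X]PE (@probability_setC _ _ _ P)//.
  by rewrite muleBl ?mul1e ?fin_num_measure// fin_num_adde_defl.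
- move=> F tF HF; have mF n : measurable (F n) by have [] := HF n.
  split; first exact: bigcup_measurable.
  rewrite setI_bigcupl !measure_bigcup//; last 2 first.
  + by move=> n _; exact: measurableI.
  + by under eq_fun do rewrite setIC; exact: trivIset_setIl.
  rewrite (@eq_eseriesr _ _ (fun n => (fine (P A))%:E * P (F n))).
    rewrite nneseriesZl; first by rewrite fineK ?fin_num_measure// muleC.
    by move=> n _; exact: measure_ge0.
  move=> n _; transitivity (P (F n) * P A); first exact: (HF n).2.
  by rewrite fineK ?fin_num_measure// muleC.
Qed.

(** Finite intersections of events of the block form a pi-system that
    generates it, and on them the product rule is the assumption. *)
Lemma independent_block (I : choiceType) (F : I -> set (set T)) (D : set I)
    (J0 : {fset I}) (B : I -> set T) :
  mutually_independent P F ->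
  (forall i, setI_closed (F i)) -> (forall i, F i setT) ->
  (forall i A, F i A -> measurable A) ->
  (forall j, j \in J0 -> F j (B j) /\ ~ D j) ->
  forall E, <<s \bigcup_(i in D) F i >> E ->
    measurable E /\
    P (E `&` \bigcap_(j in [set` J0]) B j) =
    P E * P (\bigcap_(j in [set` J0]) B j).
Proof.
move=> indF FI FT mF BJ0.
pose G := [set E | exists (J : {fset I}) (E' : I -> set T),
  (forall i, i \in J -> D i /\ F i (E' i)) /\ E = \bigcap_(i in [set` J]) E' i].
have mbig (J : {fset I}) (E' : I -> set T) : (forall i, i \in J -> F i (E' i)) ->
    measurable (\bigcap_(i in [set` J]) E' i).
  move=> H; apply: fin_bigcap_measurable; first exact: finite_fset.
  by move=> i /= iJ; exact: mF (H i iJ).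
have GI : setI_closed G.
  move=> _ _ [J1 [E1 [H1 ->]]] [J2 [E2 [H2 ->]]].
  pose E3 i := (if i \in J1 then E1 i else setT) `&` (if i \in J2 then E2 i else setT).
  exists (J1 `|` J2)%fset, E3; split.
    move=> i iJ; split.
      by move: iJ; rewrite in_fsetU => /orP[/H1[]|/H2[]].
    by apply: FI; case: ifPn => // h; [case: (H1 _ h)|case: (H2 _ h)].
  apply/seteqP; split=> [w [w1 w2] i /= _|w w3].
    by split; case: ifPn => // h; [exact: w1|exact: w2].
  split=> i /= iJ; have : (i \in J1 `|` J2)%fset by rewrite in_fsetU iJ ?orbT.
    by move=> /w3[+ _]; rewrite iJ.
  by move=> /w3[_ +]; rewrite iJ.
have GP E : G E -> measurable E /\ P (E `&` \bigcap_(j in [set` J0]) B j) =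
    P E * P (\bigcap_(j in [set` J0]) B j).
  move=> [J [E' [HJ ->]]]; split; first by apply: mbig => i /HJ[].
  have JJ0 i : i \in J -> i \notin J0.
    by move=> /HJ[Di _]; apply/negP => /BJ0[_]; exact.
  pose E3 i := if i \in J0 then B i else E' i.
  rewrite (_ : _ `&` _ = \bigcap_(i in [set` (J `|` J0)%fset]) E3 i); last first.
    apply/seteqP; split=> [w [w1 w2] i /=|w w3].
      by rewrite in_fsetU /E3; case: ifPn => h; rewrite ?orbF//; [move=> _; exact: w2|exact: w1].
    split=> i /= iJ; have := w3 i; rewrite /= in_fsetU iJ ?orbT /E3.
      by rewrite (negPf (JJ0 _ iJ)); exact.
    by rewrite iJ; exact.
  rewrite indF; last first.
    move=> i; rewrite in_fsetU /E3; case: ifPn => [/BJ0[]//|_].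
    by rewrite orbF => /HJ[].
  rewrite indF; last by move=> i /HJ[].
  rewrite indF; last by move=> i /BJ0[].
  rewrite (perm_big (J ++ J0)); last first.
    apply: uniq_perm; rewrite ?fset_uniq//.
      rewrite cat_uniq !fset_uniq/= andbT; apply/hasPn => i iJ0.
      by apply/negP => /JJ0; rewrite iJ0.
    by move=> i; rewrite mem_cat in_fsetU.
  rewrite big_cat /=; congr (_ * _).
    by apply: eq_big_seq => i iJ; rewrite /E3 (negPf (JJ0 _ iJ)).
  by apply: eq_big_seq => i iJ; rewrite /E3 iJ.
have mB : measurable (\bigcap_(j in [set` J0]) B j).
  by apply: mbig => j /BJ0[].
move=> E sE; apply: (indep_pi_system mB GI GP).
move: E sE; apply: smallest_sub; first exact: smallest_sigma_algebra.
move=> A [i Di FA]; apply: sub_gen_smallest.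
exists [fset i]%fset, (fun=> A); split.
  by move=> j; rewrite in_fset1 => /eqP ->.
apply/seteqP; split => w; first by move=> Aw j.
by move=> /(_ i); apply; rewrite /= in_fset1.
Qed.

Section SigmaRV.
Context d' (T' : measurableType d') (X : T -> T').
Hypothesis mX : measurable_fun setT X.

Lemma sigma_rvI : setI_closed (sigma_rv X).
Proof.
move=> _ _ [A mA <-] [B mB <-]; exists (A `&` B); first exact: measurableI.
by rewrite !setTI.
Qed.

Lemma sigma_rvT : sigma_rv X setT.
Proof. by exists setT => //; rewrite setTI. Qed.

Lemma sigma_rv_measurable A : sigma_rv X A -> measurable A.
Proof. by move=> [B mB <-]; exact: mX. Qed.

Lemma sigma_rv_preimage B : measurable B -> sigma_rv X (X @^-1` B).
Proof. by move=> mB; exists B => //; rewrite setTI. Qed.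

End SigmaRV.

End Independence.

Section Expectation.
Context d (T : measurableType d) (R : realType) (P : probability T R).
Local Open Scope ereal_scope.

(** The joint law of independent variables is a product measure, so
    this is Tonelli's theorem. *)
Lemma integral_indep_mul (X Y : {RV P >-> R}) (f g : measurableTypeR R -> \bar R) :
  (forall A B, measurable A -> measurable B ->
    P (X @^-1` A `&` Y @^-1` B) = P (X @^-1` A) * P (Y @^-1` B)) ->
  measurable_fun setT f -> measurable_fun setT g ->
  (forall x, 0 <= f x) -> (forall x, 0 <= g x) ->
  \int[P]_w (f (X w) * g (Y w)) = \int[P]_w f (X w) * \int[P]_w g (Y w).
Proof.
move=> XY mf mg f0 g0.
have mZ : measurable_fun setT (fun w => (X w, Y w)) by exact: measurable_fun_pair.
pose Z : {RV P >-> (R * R)%type} :=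
  mfun_Sub (mem_set mZ).
pose m1 := distribution P X; pose m2 := distribution P Y.
pose h (z : R * R) := f z.1 * g z.2.
have mh : measurable_fun setT h.
  by apply: emeasurable_funM; exact: measurableT_comp.
have h0 z : 0 <= h z by exact: mule_ge0.
have E1 : \int[P]_w (f (X w) * g (Y w)) = \int[distribution P Z]_z h z.
  by rewrite ge0_integral_distribution.
have E2 : \int[distribution P Z]_z h z = \int[(m1 \x m2)%E]_z h z.
  apply: eq_measure_integral => A mA _; apply/esym.
  by apply: product_measure_unique mA => B C mB mC; rewrite -XY.
rewrite E1 E2 fubini_tonelli1//.
transitivity (\int[m1]_x (f x * \int[m2]_y g y)).
  by apply: eq_integral => x _; rewrite /fubini_F /h /= ge0_integralZl.
rewrite ge0_integralZr//; last exact: integral_ge0.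
by rewrite !ge0_integral_distribution.
Qed.

End Expectation.

(** * Jump times of a rate one clock *)

Section Exponential.
Context d (T : measurableType d) (R : realType) (P : probability T R).
Local Notation mu := (@lebesgue_measure R).
Local Open Scope ereal_scope.

(** The density is the Radon-Nikodym derivative almost everywhere, by
    its uniqueness. *)
Lemma integral_density (m : probability (measurableTypeR R) R) (g : R -> R)
    (f : measurableTypeR R -> \bar R) :
  measurable_fun [set: measurableTypeR R] g -> (forall x, 0 <= g x)%R ->
  (forall A : set (measurableTypeR R), measurable A -> m A = \int[mu]_(x in A) (g x)%:E) ->
  measurable_fun [set: measurableTypeR R] f -> (forall x, 0 <= f x) ->
  \int[m]_x f x = \int[mu]_x (f x * (g x)%:E).
Proof.
move=> mg g0 mE mf f0.
have mu_m : m `<< mu.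
  apply/null_content_dominatesP => A mA A0; rewrite mE//; apply: null_set_integral => //.
  by apply: measurable_funTS; exact/measurable_EFinP.
rewrite -(Radon_Nikodym_SigmaFinite.change_of_variables mu_m f0 measurableT mf).
apply: ge0_ae_eq_integral => //.
- apply: emeasurable_funM => //.
  by have /integrableP[] := Radon_Nikodym_SigmaFinite.f_integrable mu_m.
- by apply: emeasurable_funM => //; exact/measurable_EFinP.
- by move=> x _; rewrite mule_ge0// Radon_Nikodym_SigmaFinite.f_ge0.
- by move=> x _; rewrite mule_ge0// lee_fin.
apply: ae_eqe_mul2l.
apply: integral_ae_eq => //.
- exact: Radon_Nikodym_SigmaFinite.f_integrable.
- exact/measurable_EFinP.
- move=> E _ mE'; rewrite -Radon_Nikodym_SigmaFinite.f_integral//; exact: mE.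
Qed.

(** Exponential tilting turns the rate 1 density into [1 / (1 - th)] times
    the density of rate [1 - th]. *)
Lemma exp_moment (X : {RV P >-> R}) (th : R) : exp1 X -> (th < 1)%R ->
  \int[P]_w (expR (th * X w))%:E = ((1 - th)^-1)%:E.
Proof.
move=> eX th1; have t0 : (0 < 1 - th)%R by rewrite subr_gt0.
have mexp : measurable_fun [set: measurableTypeR R] (fun x : R => (expR (th * x))%:E).
  by apply/measurable_EFinP; apply: measurableT_comp.
(* the law of X on the type that carries the Lebesgue measure *)
have mX : @measurable_fun _ _ T (measurableTypeR R) setT X.
  by move=> mT A mA; exact: (measurable_funPT X mT A mA).
pose X' : {RV P >-> measurableTypeR R} := @mfun_Sub _ _ T (measurableTypeR R) X (mem_set mX).
have E : \int[P]_w (expR (th * X w))%:E = \int[distribution P X']_x (expR (th * x))%:E.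
  by rewrite ge0_integral_distribution// => x; rewrite lee_fin expR_ge0.
rewrite E (@integral_density (distribution P X') (exponential_pdf 1) (fun x => (expR (th * x))%:E))//.
- rewrite (eq_integral (fun x : measurableTypeR R => ((1 - th)^-1)%:E * (exponential_pdf (1 - th) x)%:E)).
    rewrite ge0_integralZl//.
    + by rewrite integral_exponential_pdf// mule1.
    + by apply/measurable_EFinP; exact: measurable_exponential_pdf.
    + by move=> x _; rewrite lee_fin exponential_pdf_ge0// ltW.
    + by rewrite lee_fin invr_ge0 ltW.
  move=> x _; rewrite -!EFinM; congr EFin.
  have [x0|x0] := leP 0%R x; last by rewrite !lt0_exponential_pdf// !mulr0.
  rewrite !exponential_pdfE// mul1r -expRD mulrA mulVf ?gt_eqF// mul1r.
  by congr expR; ring.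
- exact: measurable_exponential_pdf.
- by move=> x; rewrite exponential_pdf_ge0.
Qed.

Lemma exp1_ge0 (X : {RV P >-> R}) : exp1 X -> P [set w | X w < 0]%R = 0.
Proof.
move=> eX; have := eX `]-oo, 0%R[%classic (measurable_itv _).
rewrite /distribution /pushforward /exponential_prob integral0_eq => [<-|x].
  by congr (P _); apply/seteqP; split => w /=; rewrite in_itv.
by rewrite /= in_itv/= => x0; rewrite lt0_exponential_pdf.
Qed.

Lemma exp1_le1 (X : {RV P >-> R}) : exp1 X ->
  (1 - (expR (-1))%:E) <= P [set w | X w <= 1]%R.
Proof.
move=> eX; have := eX `[0%R, 1%R]%classic (measurable_itv _).
rewrite exponential_prob_itv0c// mulr1 => <-.
rewrite /distribution /pushforward; apply: le_measure; rewrite ?inE.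
- exact: (measurable_funPTI X (measurable_itv _)).
- rewrite (_ : [set w | _] = X @^-1` `]-oo, 1%R]%classic).
    exact: (measurable_funPTI X (measurable_itv _)).
  by apply/seteqP; split => w /=; rewrite in_itv.
- by move=> w /=; rewrite in_itv/= => /andP[].
Qed.

Section Sums.
Variable h : nat -> {RV P >-> R}.
Hypothesis hclock : rate1_clock h.

Definition jump_time n (w : T) : R := (\sum_(k < n) h k w)%R.

Lemma measurable_jump_time n : measurable_fun setT (jump_time n).
Proof. by apply: measurable_sum => k. Qed.

Definition jump_time_rv n : {RV P >-> R} := mfun_Sub (mem_set (measurable_jump_time n)).

Definition clock_past n : set (set T) :=
  <<s \bigcup_(i in [set i | (i < n)%N]) sigma_rv (h i) >>.

Lemma clock_past_jump_time n A : measurable A -> clock_past n (jump_time n @^-1` A).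
Proof.
move=> mA.
pose T' := g_sigma_algebraType (\bigcup_(i in [set i | (i < n)%N]) sigma_rv (h i)).
have mt : measurable_fun [set: T'] (jump_time n).
  apply: measurable_sum => k mT B mB; apply: sub_gen_smallest.
  by exists k => //=; exists B.
by have := mt measurableT A mA; rewrite setTI.
Qed.

Lemma jump_time_indep n A B : measurable A -> measurable B ->
  P (jump_time n @^-1` A `&` h n @^-1` B) = P (jump_time n @^-1` A) * P (h n @^-1` B).
Proof.
move=> mA mB.
have := @independent_block _ _ _ P _ (fun n => sigma_rv (h n)) [set i | (i < n)%N]
  [fset n]%fset (fun=> h n @^-1` B) hclock.2.
have -> : \bigcap_(j in [set` [fset n]%fset]) h n @^-1` B = h n @^-1` B.
  apply/seteqP; split => w; first by move=> /(_ n); apply; rewrite /= in_fset1.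
  by move=> Aw j.
move=> H; have [] // := H _ _ _ _ _ (clock_past_jump_time (n := n) mA).
- by move=> i; exact: sigma_rvI.
- by move=> i; exact: sigma_rvT.
- by move=> i C; exact: sigma_rv_measurable.
- by move=> j; rewrite in_fset1 => /eqP ->; split; [exact: sigma_rv_preimage|rewrite /= ltnn].
Qed.

Lemma jump_time_moment n (th : R) : (th < 1)%R ->
  \int[P]_w (expR (th * jump_time n w))%:E = ((1 - th)^-1 ^+ n)%:E.
Proof.
move=> th1; elim: n => [|n IH].
  rewrite (eq_integral (cst 1)).
    by rewrite integral_cst// mul1e expr0; exact: probability_setT.
  by move=> w _; rewrite /jump_time big_ord0 mulr0 expR0.
rewrite exprSr EFinM -IH -(exp_moment (hclock.1 n) th1).
have mexp : measurable_fun [set: measurableTypeR R] (fun x : R => (expR (th * x))%:E).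
  by apply/measurable_EFinP; apply: measurableT_comp.
rewrite -(@integral_indep_mul _ _ _ P (jump_time_rv n) (h n) (fun x : R => (expR (th * x))%:E)
  (fun x : R => (expR (th * x))%:E))//.
- apply: eq_integral => w _; rewrite /jump_time big_ord_recr /= mulrDr expRD EFinM.
  by [].
- by move=> A B mA mB; exact: jump_time_indep.
Qed.

(** Markov's inequality for [expR (th * jump_time n)]; the sign of [th]
    decides which tail is estimated. *)
Lemma jump_time_chernoff n (th a : R) : (th < 1)%R -> 
  P [set w | a <= th * jump_time n w]%R <= (expR (- a) * (1 - th)^-1 ^+ n)%:E.
Proof.
move=> th1; rewrite EFinM -(jump_time_moment n th1) -ge0_integralZl//; last first.
  apply/measurable_EFinP; apply: measurableT_comp => //.
  by apply: measurable_funM => //; exact: measurable_jump_time.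
have mt : measurable_fun setT (fun w => th * jump_time n w)%R.
  by apply: measurable_funM => //; exact: measurable_jump_time.
have mA : measurable [set w | a <= th * jump_time n w]%R.
  rewrite (_ : [set w | _] = (fun w => th * jump_time n w)%R @^-1` `[a, +oo[%classic).
    by rewrite -[X in measurable X]setTI; apply: mt => //; exact: measurable_itv.
  by apply/seteqP; split => w /=; rewrite in_itv/= andbT.
rewrite -[X in P X]setIT -integral_indic//.
apply: ge0_le_integral => //.
- by apply/measurable_EFinP; exact: measurable_indic.
- apply: emeasurable_funM => //; apply/measurable_EFinP; exact: measurableT_comp.
- move=> w _; rewrite -EFinM lee_fin -expRD indicE.
case: (boolP (w \in _)) => [/set_mem/= aw|_]; last exact: expR_ge0.
by rewrite -expR0 ler_expR addrC subr_ge0.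
Qed.

Lemma measurable_jump_time_le n (c : R) : measurable [set w | (jump_time n w <= c)%R].
Proof.
rewrite -[X in measurable X]setTI.
by apply: measurable_fun_ler => //; exact: measurable_jump_time.
Qed.

Lemma jump_time_le_prob n (c : R) :
  P [set w | (jump_time n w <= c)%R] <= (expR c * 2^-1 ^+ n)%:E.
Proof.
have := jump_time_chernoff n (th := -1) (- c)%R; rewrite !opprK => H.
have lt1 : (-1 < 1 :> R)%R by lra.
apply: (le_trans _ (H lt1)); rewrite le_eqVlt; apply/orP; left; apply/eqP.
by congr (P _); apply/seteqP; split => w /=; rewrite mulN1r lerN2.
Qed.

(** Explosion: infinitely many jumps before time [t], the only case in which
    [jump_count] takes its default value. *)
Definition stuck (t : R) : set T := [set w | forall n, (jump_time n w <= t)%R].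

Lemma measurable_stuck t : measurable (stuck t).
Proof.
rewrite (_ : stuck t = \bigcap_n [set w | (jump_time n w <= t)%R]).
  apply: bigcap_measurable; first by exists 0%N.
  by move=> n _; exact: measurable_jump_time_le.
by apply/seteqP; split => w wn n; [move=> _|]; exact: wn.
Qed.

Lemma prob_stuck t : P (stuck t) = 0.
Proof.
apply/eqP; rewrite eq_le measure_ge0 andbT; apply/lee_addgt0Pr => e e0; rewrite add0e.
pose n := (Num.truncn (expR t / e)).+1.
apply: (@le_trans _ _ (P [set w | (jump_time n w <= t)%R])).
  apply: le_measure; rewrite ?inE.
  - exact: measurable_stuck.
  - exact: measurable_jump_time_le.
  by move=> w; exact.
apply: (le_trans (jump_time_le_prob n t)); rewrite lee_fin.
rewrite exprVn ler_pdivrMr ?exprn_gt0// -ler_pdivrMl// mulrC.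
apply: (@le_trans _ _ (n%:R)%R); first by rewrite ltW// truncnS_gt.
by rewrite -natrX ler_nat ltnW// ltn_expl.
Qed.

Definition negative_wait : set T := \bigcup_k [set w | (h k w < 0)%R].

Lemma measurable_negative : measurable negative_wait.
Proof.
apply: bigcup_measurable => k _; rewrite -[X in measurable X]setTI.
exact: measurable_fun_ltr.
Qed.

Lemma prob_negative : P negative_wait = 0.
Proof.
have hexp := hclock.1.
have mk k : measurable [set w | (h k w < 0)%R].
  by rewrite -[X in measurable X]setTI; exact: measurable_fun_ltr.
apply/eqP; rewrite eq_le measure_ge0 andbT.
apply: (le_trans (measure_sigma_subadditive P mk measurable_negative (@subset_refl _ _))).
rewrite eseries0// => k _ _; exact: (exp1_ge0 (hexp k)).
Qed.

End Sums.
End Exponential.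

(** * From random bits to averages, and the number of jumps *)

Section JumpCount.
Context {R : realType}.
Implicit Types (h : nat -> R) (t : R).

Lemma jump_count_ltP h t m : (m <= jump_count h t)%N ->
  forall j, (j < m)%N -> \sum_(k < j.+1) h k <= t.
Proof.
rewrite /jump_count; case: pselect => [ex|_]; last by rewrite leqn0 => /eqP ->.
case: ex_minnP => N _ minN mN j jm; rewrite leNgt; apply/negP => /minN; lia.
Qed.

Lemma jump_count_eq h t n : t < \sum_(k < n.+1) h k ->
  (forall j, (j < n)%N -> \sum_(k < j.+1) h k <= t) -> jump_count h t = n.
Proof.
move=> tn nt; rewrite /jump_count; case: pselect => [ex|[]]; last by exists n.
case: ex_minnP => N tN minN; apply/eqP; rewrite eqn_leq minN//= leqNgt.
by apply/negP => /nt; rewrite leNgt tN.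
Qed.

Lemma jump_count_none h t : ~ (exists n, t < \sum_(k < n.+1) h k) ->
  jump_count h t = 0%N.
Proof. by rewrite /jump_count; case: pselect. Qed.

Lemma jump_count_some h t : (exists n, t < \sum_(k < n.+1) h k) ->
  t < \sum_(k < (jump_count h t).+1) h k.
Proof.
by rewrite /jump_count; case: pselect => // ex _; case: ex_minnP.
Qed.

End JumpCount.

Section Bridge.
Context d (T : measurableType d) (R : realType) (P : probability T R).
Variables (om : option int -> {RV P >-> bool}) (b a : nat -> {RV P >-> bool})
  (h : nat -> {RV P >-> R}).
Hypothesis noiseP : M2_noise om b a h.
Local Open Scope ereal_scope.

(** The sample point read as a family of bits, so that [walk (bits w)] is the
    jump chain of M2 at [w]. *)
Definition bits (w : T) : noise -> bool := fun i =>
  match i with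
  | inl (inl x) => om x w
  | inl (inr n) => b n w
  | inr n => a n w
  end.

Definition bitRV (i : noise) : {RV P >-> bool} :=
  match i with
  | inl (inl x) => om x
  | inl (inr n) => b n
  | inr n => a n
  end.

Lemma bitsE i w : bits w i = bitRV i w.
Proof. by case: i => [[x|n]|n]. Qed.

Lemma bit_fair i (e : bool) : P [set w | bits w i = e] = (2^-1)%:E.
Proof.
have [f1 f2 f3 _ _] := noiseP.
have F : fair (bitRV i) by case: i => [[x|n]|n]; rewrite /bitRV.
have := F [set e]; rewrite /distribution /pushforward => E.
rewrite (_ : [set w | _] = bitRV i @^-1` [set e]); last first.
  by apply/seteqP; split => w /=; rewrite bitsE.
rewrite E bernoulli_probE; last by lra.
have dE c : \d_c [set e] = ((c == e)%:R)%:E :> \bar R.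
  rewrite diracE; congr (_%:R%:E); case: eqP => [->|ce].
    by rewrite mem_set.
  by rewrite memNset.
rewrite !dE; case: (e); rewrite /= ?mule1 ?mule0 ?adde0 ?add0e//.
by congr EFin; rewrite /unstable.onem; lra.
Qed.

Lemma measurable_bit i e : measurable [set w | bits w i = e].
Proof.
rewrite (_ : [set w | _] = bitRV i @^-1` [set e]).
  exact: measurable_funPTI.
by apply/seteqP; split => w /=; rewrite bitsE.
Qed.

Definition pattern (s : seq noise) (v : noise -> bool) : set T :=
  [set w | forall i, i \in s -> bits w i = v i].

Definition clock_events : set (set T) :=
  <<s \bigcup_(n in [set: nat]) sigma_rv (h n) >>.

Definition clocks : set (option int + nat + nat + nat) :=
  [set i | exists n, i = inr n].

(** The block of holding times and the events on single bits: a case of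
    [independent_block]. *)
Lemma noise_independent (A : set T) (s : seq noise) v : clock_events A -> uniq s ->
  measurable A /\ P (A `&` pattern s v) = P A * ((2^-1) ^+ size s)%:E.
Proof.
move=> hA us; have [_ _ _ _ ind] := noiseP.
pose J0 : {fset (option int + nat + nat + nat)} := [fset (inl i : option int + nat + nat + nat) | i in s]%fset.
pose B (i : option int + nat + nat + nat) : set T :=
  if i is inl j then [set w | bits w j = v j] else setT.
have BE : pattern s v = \bigcap_(i in [set` J0]) B i.
  apply/seteqP; split => [w ws i /=|w ws i iS].
    by move=> /imfsetP[j js ->] /=; exact: ws.
  by apply: (ws (inl i)); apply/imfsetP; exists i.
have sB j : j \in J0 -> M2_sigma om b a h j (B j).
  move=> /imfsetP[i _ ->]; rewrite /B (_ : [set w | _] = bitRV i @^-1` [set v i]); last first.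
    by apply/seteqP; split => w /=; rewrite bitsE.
  by case: i => [[x|n]|n]; exact: sigma_rv_preimage.
have [] // := @independent_block _ _ _ P _ (M2_sigma om b a h) clocks J0 B ind _ _ _ _ A.
- by move=> [[[x|n]|n]|n]; exact: sigma_rvI.
- by move=> [[[x|n]|n]|n]; exact: sigma_rvT.
- by move=> [[[x|n]|n]|n] C; apply: sigma_rv_measurable; exact: measurable_funPT.
- by move=> j jJ; split; [exact: sB|case; case/imfsetP: jJ => i _ -> ?].
- move: A hA; apply: smallest_sub; first exact: smallest_sigma_algebra.
  move=> C [n _ nC]; by apply: sub_gen_smallest; exists (inr n); [exists n|exact: nC].
move=> mA PA; split=> //; rewrite BE PA; congr (_ * _).
rewrite (ind _ _ sB) big_imfset /=; last by move=> ? ? _ _ [].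
rewrite big_seq (eq_bigr (fun=> (2^-1)%:E)) => [|i _]; last exact: bit_fair.
rewrite -big_seq (perm_big s); last first.
  by apply: uniq_perm; rewrite ?undup_uniq// => x; rewrite mem_undup.
rewrite big_const_seq count_predT.
elim: (size s) => [|n IH] //=; rewrite IH -EFinM exprS//.
Qed.

Definition coin_independent (A : set T) (J : seq noise) := forall s v, uniq s ->
  {subset s <= J} -> P (A `&` pattern s v) = P A * ((2^-1) ^+ size s)%:E.

Lemma measurable_bits (J : seq noise) (F : (noise -> bool) -> R) : supp J F ->
  measurable_fun setT (fun w => F (bits w)).
Proof.
elim: J F => [|i J IH] F sF.
  rewrite (_ : (fun w => _) = cst (F (fun=> true)))//.
  by apply: funext => w; exact: sF.
rewrite (_ : (fun w => _) = fun w => if bitRV i w then F (upd (bits w) i true)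
    else F (upd (bits w) i false)); last first.
  apply: funext => w; rewrite -bitsE.
  case E : (bits w i); congr F; apply: funext => j; rewrite /upd;
    by case: eqVneq => [->|].
have sFe e : supp J (fun z => F (upd z i e)).
  move=> z z' zz'; apply: sF => j; rewrite inE /upd.
  by case: eqVneq => //= _ /zz'.
by apply: measurable_fun_ifT => //; exact: (IH _ (sFe _)).
Qed.

(** Conditioning on the first bit splits [A] into two halves of equal
    probability, and the other bits are still independent of each half. *)
Lemma integral_bits (J : seq noise) (A : set T) (F : (noise -> bool) -> R) z0 :
  uniq J -> supp J F -> (forall z, 0 <= F z)%R -> measurable A ->
  coin_independent A J ->
  \int[P]_(w in A) (F (bits w))%:E = P A * (avg J F z0)%:E.
Proof.
elim: J A F => [|i J IH] A F uJ sF F0 mA HA.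
  rewrite (eq_integral (cst (F z0)%:E)).
    by rewrite integral_cst// muleC.
  by move=> w _; congr EFin; exact: sF.
move: uJ => /= /andP[iJ uJ].
pose Ae e := A `&` [set w | bits w i = e].
have mAe e : measurable (Ae e) by apply: measurableI => //; exact: measurable_bit.
have AU : A = Ae true `|` Ae false.
  apply/seteqP; split => [w Aw|w [[]|[]]//].
  by case E : (bits w i); [left|right].
pose Fe e z := F (upd z i e).
have PAe e : P (Ae e) = P A * (2^-1)%:E.
  have := HA [:: i] (fun=> e); rewrite expr1 => <- //; last first.
    by move=> j; rewrite !inE => ->.
  congr (P (_ `&` _)); apply/seteqP; split => [w /= <- j|w /= ->//].
    by rewrite inE => /eqP ->.
  by rewrite inE.
have step e : \int[P]_(w in Ae e) (F (bits w))%:E =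
    P (Ae e) * (avg J (Fe e) z0)%:E.
  rewrite (eq_integral (fun w => (Fe e (bits w))%:E)).
    apply: IH => //.
      move=> z z' zz'; apply: sF => j; rewrite inE /upd.
      by case: eqVneq => //= _ /zz'.
    by move=> z; exact: F0.
    move=> s v us sJ; have iS : i \notin s by apply: contra iJ => /sJ.
    have := HA (i :: s) (fun j => if j == i then e else v j).
    rewrite /= iS us => /(_ isT) E.
    rewrite PAe -muleA -EFinM -exprS -E; last first.
      by move=> j; rewrite !inE => /orP[->//|/sJ ->]; rewrite orbT.
    congr (P _); rewrite /Ae -setIA; congr (_ `&` _).
    apply/seteqP; split => [w [wi ws] j|w ws].
      rewrite inE; case: eqVneq => [-> _|ji /= js]; first exact: wi.
      by rewrite ws.
    split; first by have := ws i; rewrite inE eqxx => /(_ isT).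
    move=> j js; have := ws j; rewrite inE js orbT => /(_ isT).
    by case: eqVneq => // ji; move: iS; rewrite -ji js.
  move=> w /set_mem[_ /= <-]; congr EFin; rewrite /Fe; congr F.
  by apply: funext => j; rewrite /upd; case: eqVneq => [->|].
have avgE : (P A * (avg (i :: J) F z0)%:E = P (Ae true) * (avg J (Fe true) z0)%:E +
    P (Ae false) * (avg J (Fe false) z0)%:E).
  rewrite !PAe -!muleA -!EFinM avg_cons /avg1 avgZ avgD -/(Fe true) -/(Fe false).
  rewrite -[P A](fineK (fin_num_measure P A mA)) -!EFinM -EFinD; congr EFin.
  by ring.
have mF := measurable_bits sF.
rewrite avgE -!step {1}AU ge0_integral_setU//.
- by apply: measurable_funTS; exact/measurable_EFinP.
- by move=> w _; rewrite lee_fin.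
- by apply/disj_setPS => w [[_ /= w1] [_ /= w2]]; rewrite w1 in w2.
Qed.

End Bridge.

(** * The mean square displacement in continuous time *)

Section Locality.
Context {R : realType}.

(** Finite propagation speed: [n] steps depend on finitely many bits, and
    the environment is determined on a window that shrinks by one site per
    step. *)
Lemma walk_local n (z z' : noise -> bool) :
  {in window n, arrows_of z =1 arrows_of z'} ->
  (forall m, (m < n)%N -> swap_before z m = swap_before z' m /\ swap_after z m = swap_after z' m) ->
  forall k, (k <= n)%N ->
  pos z k = pos z' k /\ {in window (n - k), env z k =1 env z' k}.
Proof.
move=> hom hc; elim=> [|k IH] kn; first by rewrite subn0; split.
have [hp he] := IH (ltnW kn); have [hb ha] := hc k kn.
have nk : (n - k = (n - k.+1).+1)%N by lia.
rewrite /pos /env !walkS /= -/(pos z k) -/(pos z' k) hp hb ha; split.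
  congr (_ + arrow _); apply: (swap_if_eq_on _ he); exact: window_None.
by apply: M2_step_eq_on; rewrite -nk.
Qed.

Definition noise_window n : seq noise :=
  coins n ++ [seq inl (inl x) | x <- window n].

Lemma coins_b n m : (m < n)%N -> inl (inr m) \in coins n.
Proof.
elim: n => // n IH; rewrite ltnS leq_eqVlt => /orP[/eqP->|mn].
  by rewrite inE eqxx.
by rewrite /= !in_cons IH// !orbT.
Qed.

Lemma coins_a n m : (m < n)%N -> inr m \in coins n.
Proof.
elim: n => // n IH; rewrite ltnS leq_eqVlt => /orP[/eqP->|mn].
  by rewrite /= !in_cons eqxx orbT.
by rewrite /= !in_cons IH// !orbT.
Qed.

Lemma pos_supp n (f : int -> R) : supp (undup (noise_window n)) (fun z => f (pos z n)).
Proof.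
move=> z z' zz'; congr f; apply: (walk_local (n := n) _ _ (leqnn n)).1 => [x xn|m mn].
  by apply: zz'; rewrite mem_undup mem_cat map_f ?orbT.
by split; apply: zz'; rewrite mem_undup mem_cat ?coins_b ?coins_a.
Qed.

Lemma avg_pos_sq n z : avg (undup (noise_window n)) (fun z => sq (pos z n) : R) z = msd n.
Proof.
rewrite -(annealed_sq (leqnn n) (leqnn n)) /annealed.
by apply: avg_supp; [exact: pos_supp|move=> i; rewrite mem_undup].
Qed.

End Locality.

Section ContinuousTime.
Context d (T : measurableType d) (R : realType) (P : probability T R).
Variables (om : option int -> {RV P >-> bool}) (b a : nat -> {RV P >-> bool})
  (h : nat -> {RV P >-> R}).
Hypothesis noiseP : M2_noise om b a h.
Local Open Scope ereal_scope.

Lemma noise_clock : rate1_clock h.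
Proof.
have [_ _ _ hexp ind] := noiseP; split=> // J A JA.
pose J' : {fset (option int + nat + nat + nat)} :=
  [fset (inr i : option int + nat + nat + nat) | i in J]%fset.
pose B (i : option int + nat + nat + nat) := if i is inr n then A n else setT.
have := ind J' B.
rewrite big_imfset /=; last by move=> ? ? _ _ [].
rewrite (_ : \bigcap_(i in [set` J']) B i = \bigcap_(i in [set` J]) A i); last first.
  apply/seteqP; split => [w wB i /= iJ|w wA i /= /imfsetP[j jJ ->]]; last exact: wA.
  by apply: (wB (inr i)); apply/imfsetP; exists i.
by apply=> i /imfsetP[j jJ ->]; exact: JA.
Qed.

Variable t : R.

Definition njumps w : nat := jump_count (fun k => h k w) t.
Definition jumps_at n : set T := [set w | njumps w = n].

Let clock_space := g_sigma_algebraType (\bigcup_(n in [set: nat]) sigma_rv (h n)).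

Let mS n : measurable_fun [set: clock_space] (jump_time h n).
Proof.
apply: measurable_sum => k mT B mB; apply: sub_gen_smallest.
by exists (nat_of_ord k) => //=; exists B.
Qed.

Lemma jumps_atE n : (0 < n)%N -> jumps_at n =
  [set w | (t < jump_time h n.+1 w)%R] `&`
  \bigcap_(j in [set j | (j < n)%N]) [set w | (jump_time h j.+1 w <= t)%R].
Proof.
move=> n0; apply/seteqP; split => [w wn|w [tn nt]]; last first.
  by apply: jump_count_eq => // j jn; exact: nt.
split=> [|j jn] /=.
  have [ex|nex] := pselect (exists n, t < \sum_(k < n.+1) h k w)%R.
    by have := @jump_count_some _ (fun k => h k w) t ex; rewrite -/(njumps w) wn.
  by move: wn n0; rewrite /jumps_at /= /njumps jump_count_none// => <-.
by apply: (@jump_count_ltP _ (fun k => h k w) t n) => //; rewrite -/(njumps w) wn.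
Qed.

(** For [n > 0] the event is expressed by jump times; for [n = 0] it also
    contains the explosion event, hence the complement. *)
Lemma jumps_at_clock n : clock_events h (jumps_at n).
Proof.
suff H : @measurable _ clock_space (jumps_at n) by exact: H.
have pos m : (0 < m)%N -> @measurable _ clock_space (jumps_at m).
  move=> m0; rewrite jumps_atE//; apply: measurableI.
    by rewrite -[X in measurable X]setTI; apply: measurable_fun_ltr.
  apply: bigcap_measurable; first by exists 0%N.
  move=> j _; rewrite -[X in measurable X]setTI.
  by apply: measurable_fun_ler.
case: n => [|n]; last exact: pos.
rewrite (_ : jumps_at 0 = ~` \bigcup_n jumps_at n.+1).
  by apply: measurableC; apply: bigcup_measurable => k _; exact: pos.
apply/seteqP; split => [w w0 [k _]|w wn]; first by rewrite /jumps_at /= w0.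
by rewrite /jumps_at /=; case E : (njumps w) => [//|m]; exfalso; apply: wn; exists m.
Qed.

Lemma measurable_jumps_at n : measurable (jumps_at n).
Proof. by have [] := noise_independent noiseP (fun=> true) (jumps_at_clock n) (isT : uniq [::]). Qed.

Lemma trivIset_jumps : trivIset setT jumps_at.
Proof. by move=> i j _ _ [w [/= <- <-]]. Qed.

Lemma cover_jumps : \bigcup_n jumps_at n = setT.
Proof. by apply/seteqP; split => // w _; exists (njumps w). Qed.

Lemma integral_sq_jump n :
  \int[P]_(w in jumps_at n) (sq (pos (bits om b a w) n))%:E = P (jumps_at n) * (msd n)%:E.
Proof.
rewrite -(avg_pos_sq n (fun=> true)).
apply: (integral_bits (F := fun z => sq (pos z n))).
- exact: undup_uniq.
- exact: pos_supp.
- by move=> z; exact: sq_ge0.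
- exact: measurable_jumps_at.
- move=> s v us _; exact: (noise_independent noiseP v (jumps_at_clock n) us).2.
Qed.

Definition M2_msd := 'E_P[fun w => (`|(M2_position (fun y => om y w) (fun m => b m w)
   (fun m => a m w) (fun n => h n w) t)%:~R : R| ^+ 2)%R].

(** The number of jumps is a function of the clock only, hence independent of
    the jump chain. *)
Lemma M2_msdE : M2_msd = \sum_(n <oo) P (jumps_at n) * (msd n)%:E.
Proof.
rewrite /M2_msd unlock.
pose f w : \bar R := (sq (pos (bits om b a w) (njumps w)))%:E.
rewrite (eq_integral f); last first.
  move=> w _; congr EFin; rewrite /f /sq -(real_normK (num_real (_%:~R))).
  by [].
have fE n : {in jumps_at n, f =1 (fun w => (sq (pos (bits om b a w) n))%:E)}.
  by move=> w /set_mem; rewrite /jumps_at /f /= => ->.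
rewrite -cover_jumps ge0_integral_bigcup.
- by apply: eq_eseriesr => n _; rewrite -integral_sq_jump; apply: eq_integral => w /fE.
- exact: measurable_jumps_at.
- apply/measurable_fun_bigcup; first exact: measurable_jumps_at.
  move=> n; apply: (eq_measurable_fun (fun w => (sq (pos (bits om b a w) n))%:E)).
    by move=> w /fE.
  apply: measurable_funTS; apply/measurable_EFinP.
  by apply: (@measurable_bits _ _ _ P om b a (undup (noise_window n)) (fun z => sq (pos z n))); exact: pos_supp.
- by move=> w _; rewrite lee_fin sq_ge0.
- exact: trivIset_jumps.
Qed.

(** Chernoff bound; the factor [2^-1 ^+ n] beats [expR t] as soon as
    [n > 4 t]. *)
Lemma prob_jumps_at_le n : (0 < n)%N -> P (jumps_at n) <= (expR t * 2^-1 ^+ n)%:E.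
Proof.
move=> n0; apply: (le_trans _ (jump_time_le_prob noise_clock n t)); apply: le_measure; rewrite ?inE.
- exact: measurable_jumps_at.
- exact: measurable_jump_time_le.
move=> w; rewrite jumps_atE// => -[_ /(_ n.-1)] /=.
by rewrite prednK// leqnn => /(_ isT).
Qed.

Lemma sum_prob_jumps m : \sum_(0 <= n < m) P (jumps_at n) <= 1.
Proof.
rewrite big_mkord -measure_semi_additive_ord_I//; last 3 first.
- by move=> k _; exact: measurable_jumps_at.
- by apply: sub_trivIset trivIset_jumps.
- by apply: bigsetU_measurable => k _; exact: measurable_jumps_at.
by apply: probability_le1; apply: bigsetU_measurable => k _; exact: measurable_jumps_at.
Qed.

End ContinuousTime.

Section Numerics.
Context {R : realType}.

Lemma expR1_ge2 : 2 <= expR 1 :> R.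
Proof. by have := @expR_ge1Dx R 1; lra. Qed.

Lemma expR_quarter : expR (4^-1) <= 4 / 3 :> R.
Proof.
have := @expR_ge1Dx R (- 4^-1); rewrite expRN => H.
rewrite -[leLHS]invrK -[leRHS]invrK lef_pV2 ?posrE ?invr_gt0 ?expR_gt0//; lra.
Qed.

Lemma expR_eighth : expR (8^-1) <= 8 / 7 :> R.
Proof.
have := @expR_ge1Dx R (- 8^-1); rewrite expRN => H.
rewrite -[leLHS]invrK -[leRHS]invrK lef_pV2 ?posrE ?invr_gt0 ?expR_gt0//; lra.
Qed.

(** From [n^2 <= 256 exp (n / 8)] and [exp (1 / 8) <= 8 / 7]. *)
Lemma poly_exp_bound n : n%:R ^+ 2 * (2 / 3) ^+ n <= 256 * (16 / 21) ^+ n :> R.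
Proof.
have h1 : n%:R ^+ 2 <= 256 * expR (8^-1) ^+ n :> R.
  have h : n%:R / 16 <= expR (n%:R / 16) :> R.
    by apply: le_trans (expR_ge1Dx _); lra.
  rewrite -expRM_natl.
  have -> : expR (n%:R * 8^-1) = expR (n%:R / 16) ^+ 2 :> R.
    by rewrite -expRM_natl; congr expR; field.
  have : (n%:R / 16) ^+ 2 <= expR (n%:R / 16) ^+ 2 :> R.
    by rewrite lerXn2r ?nnegrE// ?expR_ge0// divr_ge0.
  rewrite expr_div_n; lra.
apply: (@le_trans _ _ (256 * expR (8^-1) ^+ n * (2 / 3) ^+ n)).
  by rewrite ler_wpM2r// exprn_ge0// divr_ge0.
rewrite -mulrA ler_pM2l// -exprMn lerXn2r ?nnegrE ?mulr_ge0 ?expR_ge0 ?divr_ge0//.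
have := expR_eighth; lra.
Qed.

Lemma geom_sum_le (r : R) m : 0 <= r < 1 -> \sum_(n < m) r ^+ n <= (1 - r)^-1.
Proof.
move=> /andP[r0 r1]; have c0 : 0 < 1 - r by lra.
rewrite -[leRHS]mul1r ler_pdivlMr// mulrC.
have -> : (1 - r) * \sum_(n < m) r ^+ n = 1 - r ^+ m.
  elim: m => [|m IH]; first by rewrite big_ord0 expr0; ring.
  by rewrite big_ord_recr /= mulrDr IH exprS; ring.
by rewrite gerBl exprn_ge0.
Qed.

End Numerics.

(** * Bounds of order t^(4/3) in continuous time *)

Section Bounds.
Context (R : realType).
Local Open Scope ereal_scope.

(** The indices [n <= 4 t] contribute at most [D (4 t)^(4/3)]; for the others
    [msd n <= D n^2] is beaten by the Chernoff bound. *)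
Lemma M2_upper : exists2 D : R, (0 < D)%R &
  forall d (T : measurableType d) (P : probability T R)
       (om : option int -> {RV P >-> bool}) (b a : nat -> {RV P >-> bool})
       (h : nat -> {RV P >-> R}) (t : R), M2_noise om b a h -> (1 <= t)%R ->
  M2_msd om b a h t <= (D * t `^ (4 / 3))%:E.
Proof.
have [D D0 up] := @msd_upper R.
exists (D * 4 `^ (4 / 3) + D * 256 * (21 / 5))%R.
  by rewrite addr_gt0// !mulr_gt0// powR_gt0.
move=> d T P om b a h t noiseP t1; rewrite (M2_msdE noiseP).
have t0 : (0 <= t)%R by lra.
have msd0' n : (0 <= msd n :> R)%R by exact: msd_ge0.
apply: lime_le.
  by apply: is_cvg_nneseries => n _ _; rewrite mule_ge0// lee_fin.
apply: nearW => m.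
pose c1 : R := (D * (4 * t) `^ (4 / 3))%R.
have c10 : (0 <= c1)%R by rewrite mulr_ge0 ?powR_ge0// ltW.
have term n : P (jumps_at h t n) * (msd n)%:E <=
    c1%:E * P (jumps_at h t n) + (D * (256 * (16 / 21) ^+ n))%:E.
  have [nt|nt] := leP (n%:R : R) (4 * t)%R.
    apply: (@le_trans _ _ (c1%:E * P (jumps_at h t n))).
      rewrite muleC lee_wpmul2r// lee_fin (le_trans (up n))// ler_wpM2l ?(ltW D0)//.
      by apply: ge0_ler_powR; rewrite ?nnegrE ?divr_ge0// mulr_ge0.
    by rewrite leeDl// lee_fin !mulr_ge0 ?exprn_ge0 ?divr_ge0 ?(ltW D0).
  have n0 : (0 < n)%N by rewrite -(ltr_nat R); apply: le_lt_trans nt; rewrite mulr_ge0.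
  apply: (@le_trans _ _ (D * (256 * (16 / 21) ^+ n))%:E); last first.
    by rewrite leeDr// mule_ge0.
  have h1 : P (jumps_at h t n) <= ((2 / 3) ^+ n)%:E.
    apply: (le_trans (prob_jumps_at_le noiseP t n0)); rewrite lee_fin.
    apply: (@le_trans _ _ ((4 / 3) ^+ n * 2^-1 ^+ n)%R).
      rewrite ler_wpM2r ?exprn_ge0//.
      apply: (@le_trans _ _ (expR 4^-1 ^+ n)%R).
        by rewrite -expRM_natl ler_expR; lra.
      by rewrite lerXn2r ?nnegrE ?expR_ge0 ?divr_ge0// expR_quarter.
    by rewrite -exprMn (_ : (4 / 3 * 2^-1 = 2 / 3 :> R)%R)//; field.
  have h2 : (msd n <= D * n%:R ^+ 2)%R.
    rewrite (le_trans (up n))// ler_wpM2l ?(ltW D0)// -powR_mulrn//.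
    by apply: ler_powR; rewrite ?ler1n//; lra.
  apply: (@le_trans _ _ (((2 / 3) ^+ n)%:E * (D * n%:R ^+ 2)%:E)).
    by apply: lee_pmul; rewrite ?lee_fin ?measure_ge0.
  rewrite -EFinM lee_fin mulrCA ler_wpM2l ?(ltW D0)// mulrC.
  exact: poly_exp_bound.
apply: (@le_trans _ _ (\sum_(0 <= n < m) (c1%:E * P (jumps_at h t n) +
   (D * (256 * (16 / 21) ^+ n))%:E))); first exact: lee_sum.
rewrite big_split /= -ge0_sume_distrr//.
apply: (@le_trans _ _ (c1%:E * 1 + (D * 256 * (21 / 5))%:E)).
  apply: leeD; first by rewrite lee_wpmul2l// (sum_prob_jumps noiseP).
  rewrite sumEFin lee_fin big_mkord -mulr_sumr -mulr_sumr mulrA.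
  rewrite ler_wpM2l ?mulr_ge0 ?(ltW D0)//.
  have := @geom_sum_le R (16 / 21) m; rewrite (_ : ((1 - 16 / 21)^-1 = 21 / 5)%R); last by field.
  by apply; apply/andP; split; lra.
have -> : c1 = (D * 4 `^ (4 / 3) * t `^ (4 / 3))%R by rewrite /c1 powRM// mulrA.
rewrite mule1 -EFinD lee_fin [leRHS]mulrDl lerD2l.
rewrite ler_peMr ?mulr_ge0 ?divr_ge0 ?(ltW D0)//.
by rewrite -[leLHS](congr1 (@^~ (4 / 3)%R) (@powR1 R)); apply: ge0_ler_powR; rewrite ?nnegrE ?divr_ge0.
Qed.

Section LowerProb.
Context d (T : measurableType d) (P : probability T R).
Variables (om : option int -> {RV P >-> bool}) (b a : nat -> {RV P >-> bool})
  (h : nat -> {RV P >-> R}).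
Hypothesis noiseP : M2_noise om b a h.
Variable t : R.

Definition many_jumps m : set T := \bigcup_n (if (m <= n)%N then jumps_at h t n else set0).

Lemma measurable_many_jumps m : measurable (many_jumps m).
Proof.
apply: bigcup_measurable => n _; case: ifP => // _.
exact: (measurable_jumps_at noiseP).
Qed.

Lemma trivIset_many m : trivIset setT (fun n => if (m <= n)%N then jumps_at h t n else set0).
Proof.
move=> i j _ _ [w []]; case: ifP => // _ wi; case: ifP => // _ wj.
by apply: (@trivIset_jumps _ _ _ _ h t) => //; exists w.
Qed.

(** Up to null events, the [m]-th jump occurring before [t] means that at
    least [m] jumps are counted; negative waiting times are excluded because
    [jump_count] looks for the first partial sum exceeding [t]. *)
Lemma many_jumps_cover m : [set w | (jump_time h m w <= t)%R] `<=`
  many_jumps m `|` (stuck h t `|` negative_wait h).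
Proof.
move=> w /= wm.
have [wn|/existsNP[n wn]] := pselect (stuck h t w); first by right; left.
have [wneg|wpos] := pselect (negative_wait h w); first by right; right.
left; exists (njumps h t w) => //.
have h0 k : (0 <= h k w)%R.
  by rewrite leNgt; apply/negP => hk; apply: wpos; exists k.
have jump_time_mono i j : (i <= j)%N -> (jump_time h i w <= jump_time h j w)%R.
  elim: j => [|j IH]; first by rewrite leqn0 => /eqP ->.
  rewrite leq_eqVlt => /orP[/eqP->//|/IH ij].
  by rewrite (le_trans ij)// /jump_time big_ord_recr /= lerDl.
case: ifP => // /negbT; rewrite -ltnNge => Nm; exfalso.
have ex : exists n, (t < \sum_(k < n.+1) h k w)%R.
  exists n; rewrite ltNge; apply/negP => H; apply: wn.
  by apply: le_trans H; exact: jump_time_mono.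
have := @jump_count_some _ (fun k => h k w) t ex.
rewrite -/(njumps h t w) ltNge => /negP; apply.
by apply: le_trans wm; exact: (jump_time_mono _ _ Nm).
Qed.

Lemma many_jumps_prob m : P [set w | (jump_time h m w <= t)%R] <= P (many_jumps m).
Proof.
have mN : measurable (stuck h t `|` negative_wait h).
  by apply: measurableU; [exact: measurable_stuck|exact: measurable_negative].
have N0 : P (stuck h t `|` negative_wait h) = 0.
  apply: null_set_setU; [exact: measurable_stuck|exact: measurable_negative|
    exact: prob_stuck (noise_clock noiseP) _|exact: prob_negative (noise_clock noiseP)].
rewrite -(measureU0 (measurable_many_jumps m) mN N0); apply: le_measure; rewrite ?inE.
- exact: measurable_jump_time_le.
- by apply: measurableU => //; exact: measurable_many_jumps.
exact: many_jumps_cover.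
Qed.

(** With probability at least 1/3 there are at least [t / 8] jumps: take
    [m] about [t / 4] and use the Chernoff bound, or [m = 1] for small [t]. *)
Lemma jump_time_le_lower : (1 <= t)%R -> exists m, (0 < m)%N /\ (t / 8 <= m%:R)%R /\
  ((3^-1)%:E <= P [set w | (jump_time h m w <= t)%R]).
Proof.
move=> t1; have [t4|t4] := ltP t 4%R.
  exists 1%N; split=> //; split; first by lra.
  have [_ _ _ hexp _] := noiseP.
  apply: (@le_trans _ _ (1 - (expR (-1))%:E)).
    rewrite -EFinB lee_fin expRN.
    have : ((expR 1)^-1 <= 2^-1 :> R)%R by rewrite lef_pV2 ?posrE ?expR_gt0// expR1_ge2.
    by lra.
  apply: (le_trans (exp1_le1 (hexp 0%N))); apply: le_measure; rewrite ?inE.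
  - by rewrite -[X in measurable X]setTI; exact: measurable_fun_ler.
  - exact: measurable_jump_time_le.
  by move=> w /= h1; rewrite /jump_time big_ord1 (le_trans h1).
have [m /andP[m1 m2]] : exists m : nat, (m%:R <= t / 4 < m.+1%:R)%R.
  by exists (Num.truncn (t / 4)%R); apply: truncn_itv; lra.
have m0 : (0 < m)%N by case: m m1 m2 => //; lra.
have m1' : (1 <= m%:R :> R)%R by rewrite ler1n.
rewrite -[m.+1%:R]natr1 in m2.
exists m; split=> //; split; first by lra.
have -> : [set w | (jump_time h m w <= t)%R] = ~` [set w | (t < jump_time h m w)%R].
  by apply/seteqP; split => w /=; rewrite leNgt => /negP.
have mgt : measurable [set w | (t < jump_time h m w)%R].
  rewrite -[X in measurable X]setTI; apply: measurable_fun_ltr => //.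
  exact: measurable_jump_time.
rewrite (@probability_setC _ _ _ P)// leeBrDr ?fin_num_measure//.
apply: (@le_trans _ _ ((3^-1)%:E + (2 / 3)%:E)); last by rewrite -EFinD lee_fin; lra.
rewrite leeD2l//.
have lt1 : (2^-1 < 1 :> R)%R by lra.
have H := jump_time_chernoff (noise_clock noiseP) m (t / 2)%R lt1.
apply: (@le_trans _ _ (P [set w | (t / 2 <= 2^-1 * jump_time h m w)%R])).
  apply: le_measure; rewrite ?inE//.
    rewrite -[X in measurable X]setTI; apply: measurable_fun_ler => //.
    by apply: measurable_funM => //; exact: measurable_jump_time.
  by move=> w /= tw; lra.
apply: (le_trans H); rewrite lee_fin.
rewrite (_ : (1 - 2^-1 = 2^-1)%R); last by field.
rewrite invrK.
apply: (@le_trans _ _ (expR (- 2) ^+ m * 2 ^+ m)%R).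
  rewrite ler_wpM2r ?exprn_ge0// -expRM_natl ler_expR; lra.
rewrite -exprMn.
have e20 : (0 <= expR (-2) * 2 :> R)%R by rewrite mulr_ge0 ?expR_ge0.
have e21 : (expR (-2) * 2 <= 2 / 3 :> R)%R.
  rewrite expRN; have := @expR_ge1Dx R 2 => e3.
  have : ((expR 2)^-1 <= 3^-1 :> R)%R by rewrite lef_pV2 ?posrE ?expR_gt0//; lra.
  lra.
apply: (le_trans _ e21); rewrite -[leRHS]expr1.
apply: ler_wiXn2l => //; apply: (le_trans e21); lra.
Qed.

End LowerProb.

(** The mean square displacement is of order [t^(4/3)] already on the event of
    at least [t / 8] jumps. *)
Lemma M2_lower : exists2 C : R, (0 < C)%R &
  forall d (T : measurableType d) (P : probability T R)
       (om : option int -> {RV P >-> bool}) (b a : nat -> {RV P >-> bool})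
       (h : nat -> {RV P >-> R}) (t : R), M2_noise om b a h -> (1 <= t)%R ->
  (C * t `^ (4 / 3))%:E <= M2_msd om b a h t.
Proof.
have [C C0 low] := @msd_lower R.
exists (C * 8^-1 `^ (4 / 3) * 3^-1)%R; first by rewrite !mulr_gt0// powR_gt0.
move=> d T P om b a h t noiseP t1; rewrite (M2_msdE noiseP).
have [m [m0 [tm pm]]] := jump_time_le_lower noiseP t1.
pose c : R := (C * m%:R `^ (4 / 3))%R.
have c0 : (0 <= c)%R by rewrite mulr_ge0 ?powR_ge0// ltW.
apply: (@le_trans _ _ (c%:E * P (many_jumps h t m))).
  apply: (@le_trans _ _ (c%:E * (3^-1)%:E)); last first.
    by rewrite lee_wpmul2l// (le_trans pm)// (many_jumps_prob noiseP).
  rewrite -EFinM lee_fin mulrAC ler_wpM2r// -mulrA ler_wpM2l ?(ltW C0)//.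
  rewrite -powRM//; last by lra.
  apply: ge0_ler_powR; rewrite ?nnegrE ?divr_ge0//; lra.
rewrite /many_jumps measure_bigcup//; last 2 first.
- by move=> n _; case: ifP => // _; exact: (measurable_jumps_at noiseP).
- exact: trivIset_many.
rewrite -nneseriesZl//.
rewrite [leRHS](@eq_eseriesl _ _ (fun x => x \in [set: nat])); last by move=> x; rewrite in_setT.
apply: lee_nneseries => n.
  by move=> _ _; rewrite mule_ge0.
move=> _; case: ifP => mn; last by rewrite measure0 mule0 mule_ge0// lee_fin msd_ge0.
rewrite muleC lee_wpmul2l// lee_fin (le_trans _ (low n))// ler_wpM2l ?(ltW C0)//.
by apply: ge0_ler_powR; rewrite ?nnegrE ?divr_ge0// ler_nat.
Qed.

End Bounds.

(** * The M2 walk is a true self-avoiding walk *)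

Section TSAW.
Context d (T : measurableType d) (R : realType) (P : probability T R).
Variables (om : option int -> {RV P >-> bool}) (b a : nat -> {RV P >-> bool})
  (h : nat -> {RV P >-> R}).
Hypothesis noiseP : M2_noise om b a h.
Local Open Scope ereal_scope.
Local Notation bits := (bits om b a).

(** The randomness used by the first [n] steps: the history of the walk and
    of the initial gradients is measurable with respect to it, and the coin
    [b n] is independent of it. *)
Definition noise_before n : set (option int + nat + nat + nat) := [set i |
  match i with
  | inl (inl (inl _)) => True
  | inl (inl (inr m)) | inl (inr m) => (m < n)%N
  | inr _ => False
  end].

Definition past_space n := g_sigma_algebraType (\bigcup_(i in noise_before n) M2_sigma om b a h i).

Lemma measurable_bit_before n i e : noise_before n (inl i) ->
  @measurable _ (past_space n) [set w | bits w i = e].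
Proof.
move=> Di; apply: sub_gen_smallest; exists (inl i) => //.
rewrite (_ : [set w | _] = bitRV om b a i @^-1` [set e]); last first.
  by apply/seteqP; split => w /=; rewrite bitsE.
by move: Di; case: i => [[x|m]|m] _; exact: sigma_rv_preimage.
Qed.

(** An event that depends on finitely many bits is a finite Boolean
    combination of events on single bits. *)
Lemma measurable_local_event n (J : seq noise) (S : (noise -> bool) -> Prop) :
  (forall i, i \in J -> noise_before n (inl i)) ->
  (forall z z', {in J, z =1 z'} -> S z -> S z') ->
  @measurable _ (past_space n) [set w | S (bits w)].
Proof.
elim: J S => [|i J IH] S HJ HS.
  have [S1|S1] := pselect (S (fun=> true)).
    rewrite (_ : [set w | _] = setT); first exact: measurableT.
    by apply/seteqP; split => // w _; apply: HS S1.
  rewrite (_ : [set w | _] = set0); first exact: measurable0.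
  by apply/seteqP; split => // w Sw; apply: S1; apply: HS Sw.
rewrite (_ : [set w | _] =
   ([set w | bits w i = true] `&` [set w | S (upd (bits w) i true)]) `|`
   ([set w | bits w i = false] `&` [set w | S (upd (bits w) i false)])).
  have m e : @measurable _ (past_space n) ([set w | bits w i = e] `&` [set w | S (upd (bits w) i e)]).
    apply: measurableI.
      by apply: measurable_bit_before; apply: HJ; rewrite inE eqxx.
    apply: (IH (fun z => S (upd z i e))).
      by move=> j jJ; apply: HJ; rewrite inE jJ orbT.
    move=> z z' zz'; apply: HS => j; rewrite inE /upd.
    by case: eqVneq => //= _ /zz'.
  exact: measurableU.
have U w : upd (bits w) i (bits w i) = bits w.
  by apply: funext => j; rewrite /upd; case: eqVneq => [->|].
apply/seteqP; split => [w Sw|w [[wi]|[wi]]].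
- by case E : (bits w i); [left|right]; split=> //; rewrite /= -E U.
- by rewrite /= -wi U.
- by rewrite /= -wi U.
Qed.

Lemma before_window n m i : (m <= n)%N -> i \in noise_window m -> noise_before n (inl i).
Proof.
move=> mn; rewrite mem_cat => /orP[|/mapP[x _ ->]//].
elim: m mn => // m IH mn; rewrite /= !in_cons => /orP[/eqP->//|/orP[/eqP->//|]].
by apply: IH; exact: ltnW.
Qed.

Lemma local_state m z z' : {in noise_window m, z =1 z'} ->
  [/\ pos z m = pos z' m, env z m None = env z' m None &
      env z m (Some 0%R) = env z' m (Some 0%R)].
Proof.
move=> zz'.
have [|k km|hp he] := @walk_local m z z' _ _ m (leqnn m).
- by move=> x xm; apply: zz'; rewrite mem_cat map_f ?orbT.
- by split; apply: zz'; rewrite mem_cat ?coins_b ?coins_a.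
by split=> //; apply: he; [exact: window_None|rewrite mem_window].
Qed.

Lemma measurable_state_event n m (S : int -> bool -> bool -> Prop) : (m <= n)%N ->
  @measurable _ (past_space n) [set w | S (pos (bits w) m) (env (bits w) m None)
     (env (bits w) m (Some 0%R))].
Proof.
move=> mn; apply: (@measurable_local_event n (noise_window m) (fun z => S (pos z m) (env z m None)
     (env z m (Some 0%R)))).
  by move=> i; exact: before_window.
by move=> z z' /local_state[-> -> ->].
Qed.

Variable l0 : T -> int -> int.
Hypothesis hl0 : forall w x, (- grad (l0 w) x)%R = arrows_at (fun y => om y w) x.

Definition M2_walk n w : int :=
  (M2_chain (fun y => om y w) (fun m => b m w) (fun m => a m w) n).2.

Lemma M2_walkE n w : M2_walk n w = pos (bits w) n. Proof. by []. Qed.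

(** Each initial gradient is a function of at most three arrows, and each
    position a function of finitely many earlier bits. *)
Lemma history_before n (E : set T) : tsaw_history l0 M2_walk n E -> @measurable _ (past_space n) E.
Proof.
apply: smallest_sub; first exact: smallest_sigma_algebra.
move=> A [[x [k ->]]|[m [x [mn ->]]]]; last first.
  exact: (measurable_state_event (fun p _ _ => p = x) mn).
rewrite (_ : [set w | _] = [set w | arrows_at (arrows_of (bits w)) x = - k]%R); last first.
  apply/seteqP; split => w /=; rewrite -[arrows_at _ _]hl0; first by move=> ->.
  by move/oppr_inj.
apply: (@measurable_local_event n [:: inl (inl (Some x)); inl (inl (Some 0%R)); inl (inl None)]
  (fun z => arrows_at (arrows_of z) x = - k)%R).
  by move=> i; rewrite !inE => /or3P[] /eqP ->.
move=> z z' zz' <-; rewrite /arrows_at /arrows_of.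
by rewrite !zz' ?inE ?eqxx ?orbT.
Qed.

Lemma before_measurable n (E : set T) : @measurable _ (past_space n) E -> d.-measurable E.
Proof.
apply: smallest_sub; first exact: sigma_algebra_measurable.
by move=> A [[[[x|m]|m]|m] _ HA]; apply: (sigma_rv_measurable _ HA); exact: measurable_funPT.
Qed.

Lemma before_indep n (E : set T) e : @measurable _ (past_space n) E ->
  P (E `&` [set w | b n w = e]) = P E * (2^-1)%:E.
Proof.
move=> mE; have [_ _ _ _ ind] := noiseP.
pose bn : option int + nat + nat + nat := inl (inl (inr n)).
have := @independent_block _ _ _ P _ (M2_sigma om b a h) (noise_before n) [fset bn]%fset
   (fun=> [set w | b n w = e]) ind.
have -> : \bigcap_(j in [set` [fset bn]%fset]) [set w | b n w = e] = [set w | b n w = e].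
  apply/seteqP; split => w; first by move=> /(_ bn); apply; rewrite /= in_fset1.
  by move=> Aw j.
move=> H; have [] // := H _ _ _ _ _ mE.
- by move=> [[[x|m]|m]|m]; exact: sigma_rvI.
- by move=> [[[x|m]|m]|m]; exact: sigma_rvT.
- by move=> [[[x|m]|m]|m] C; apply: sigma_rv_measurable; exact: measurable_funPT.
- move=> j; rewrite in_fset1 => /eqP ->; split; last by rewrite /noise_before /= ltnn.
  exact: (@sigma_rv_preimage _ _ _ _ (b n) [set e]).
- by move=> _ ->; congr (_ * _); exact: (bit_fair noiseP (inl (inr n)) e).
Qed.

Lemma grad_profileE n w x :
  grad (profile (l0 w) (M2_walk ^~ w) n) x = (- arrows_at (env (bits w) n) (x - M2_walk n w))%R.
Proof.
rewrite -[LHS]opprK; congr (- _)%R; exact: (profile_env n x (hl0 w)).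
Qed.

Lemma M2_walk_step n w : M2_walk n.+1 w =
  (M2_walk n w + arrow (if b n w then env (bits w) n (Some 0) else env (bits w) n None))%R.
Proof.
by rewrite !M2_walkE {1}/pos walkS /= /swap_before /=; case: (b n w).
Qed.

(** At gradient 0 the event of a step [s] splits according to which of hand and
    site holds the arrow [s]; on each part the step is decided by the coin [b n],
    independent of the past.  At gradient -2 or 2 both arrows agree. *)
Theorem M2_is_TSAW : is_TSAW P l0 M2_walk.
Proof.
split.
- by move=> n E /history_before; exact: before_measurable.
- by [].
- move=> n w; rewrite grad_profileE subrr /arrows_at eqxx.
  by case: (env _ _ _); case: (env _ _ _); rewrite !inE.
move=> n E x s k hE hs hk H.
have mE := history_before hE.
pose Sx e1 e2 : set T := [set w | M2_walk n w = x /\ env (bits w) n None = e1 /\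
   env (bits w) n (Some 0%R) = e2].
have mS e1 e2 : @measurable _ (past_space n) (Sx e1 e2).
  exact: (@measurable_state_event n n (fun p u v => p = x /\ u = e1 /\ v = e2) (leqnn n)).
have HE : H = E `&` [set w | M2_walk n w = x /\
    (arrow (env (bits w) n (Some 0%R)) + arrow (env (bits w) n None) = - k)%R].
  apply/seteqP; split => [w [Ew [wx]]|w [Ew [wx wk]]].
    rewrite grad_profileE wx subrr /arrows_at eqxx => wk.
    by split=> //; split=> //; rewrite -wk opprK.
  by split=> //=; split=> //; rewrite grad_profileE wx subrr /arrows_at eqxx wk opprK.
have mH : @measurable _ (past_space n) H.
  rewrite HE; apply: measurableI => //.
  exact: (@measurable_state_event n n (fun p u v => p = x /\ (arrow v + arrow u = - k)%R) (leqnn n)).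
have sE : exists e, s = arrow e.
  by move: hs; rewrite !inE => /orP[]/eqP ->; [exists false|exists true].
have [e se] := sE.
have nextE w : H w -> (M2_walk n.+1 w = (x + s)%R) <->
   (if b n w then env (bits w) n (Some 0%R) else env (bits w) n None) = e.
  rewrite HE => -[_ [wx _]]; rewrite M2_walk_step wx se; split => [/addrI|->//].
  by case: (if _ then _ else _); case: (e).
have arr2 (e1 e2 : bool) : (arrow e1 + arrow e2 = - k)%R -> k = 0%R -> e2 = ~~ e1.
  by case: e1; case: e2 => //= + k0; rewrite k0.
rewrite /tsaw_prob; case: eqVneq => [k0|k0].
  rewrite (_ : _ `&` _ = ((H `&` [set w | env (bits w) n None = e]) `&` [set w | b n w = false]) `|`
     ((H `&` [set w | env (bits w) n None = ~~ e]) `&` [set w | b n w = true])); last first.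
    apply/seteqP; split => [w [Hw /(nextE w Hw)]|w [[[Hw we] wb]|[[Hw we] wb]]].
    - have := Hw; rewrite {1}HE => -[_ [_ /arr2 /(_ k0) hand]].
      case wb : (b n w) => /= we; last by left; split=> //; split.
      by right; split=> //; split=> //=; rewrite hand we.
    - by split=> //; apply/(nextE w Hw); rewrite wb.
    - split=> //; apply/(nextE w Hw); rewrite wb.
      have := Hw; rewrite {1}HE => -[_ [_ /arr2 /(_ k0)]].
      by rewrite we => /negb_inj.
  have m1 e' : @measurable _ (past_space n) (H `&` [set w | env (bits w) n None = e']).
    apply: measurableI => //.
    exact: (@measurable_state_event n n (fun p u v => u = e') (leqnn n)).
  have mb e' : measurable [set w | b n w = e'].
    exact: (@measurable_funPTI _ _ _ _ (b n) [set e'] _).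
  rewrite measureU; last 3 first.
  + by apply: measurableI; [exact: before_measurable (m1 _)|exact: mb].
  + by apply: measurableI; [exact: before_measurable (m1 _)|exact: mb].
  + by apply/seteqP; split => // w [[_ /= ->] [_]].
  rewrite [M2_walk in M2_walk + _](before_indep false (m1 e)) [M2_walk in _ + M2_walk](before_indep true (m1 (~~ e))).
  rewrite -ge0_muleDl//; congr (_ * _).
  rewrite -measureU; last 3 first.
  + exact: before_measurable (m1 _).
  + exact: before_measurable (m1 _).
  + by apply/seteqP; split => // w [[_ /= ->] [_]]; case: (e).
  congr (P _); apply/seteqP; split => [w [[]|[]]//|w Hw].
  by case: (eqVneq (env (bits w) n None) e) => we; [left|right]; split=> //=;
    move: we; case: (e); case: (env _ _ _).
have fixd w : H w -> env (bits w) n None = env (bits w) n (Some 0%R) /\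
    (- k = 2 * arrow (env (bits w) n None))%R.
  rewrite HE => -[_ [_]]; case: (env _ _ _); case: (env _ _ _) => /= wk; split => //;
   move: k0; rewrite -[k]opprK -wk //.
have [ks|ks] := eqVneq k (- 2%:Z * s)%R.
  rewrite mule1; congr (P _); apply/seteqP; split => [w []//|w Hw]; split=> //.
  apply/(nextE w Hw); have [hs' hk'] := fixd w Hw.
  rewrite -hs' if_same; move: hk'; rewrite ks se.
  by case: (env _ _ _); case: (e).
rewrite mule0 (_ : _ `&` _ = set0) ?measure0//.
apply/seteqP; split => // w [Hw /(nextE w Hw)]; have [hs' hk'] := fixd w Hw.
rewrite -hs' if_same => we; move: ks; rewrite se -we -[k]opprK hk'.
by rewrite mulNr eqxx.
Qed.

End TSAW.

(** * The M1 walk is ballistic *)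

Section Deterministic.

Lemma M1_chain_add om n m :
  M1_chain om (n + m) = ((M1_chain (M1_chain om n).1 m).1,
    (M1_chain om n).2 + (M1_chain (M1_chain om n).1 m).2).
Proof.
elim: m => [|m IH]; first by rewrite addn0 /= addr0; case: (M1_chain om n).
rewrite addnS /= IH; case: (M1_chain (M1_chain om n).1 m) => eta x /=.
by rewrite addrA.
Qed.

Lemma M1_chain1 om : M1_chain om 1 = (M1_step om, arrow (om None)).
Proof. by rewrite /= add0r. Qed.

Lemma M1_chain_pos_S om n :
  (M1_chain om n.+1).2 = arrow (om None) + (M1_chain (M1_step om) n).2.
Proof. by rewrite -add1n M1_chain_add M1_chain1. Qed.

(** The good states of M1: the walker goes on in direction [s], possibly after
    one step back. *)
Definition aligned (s : bool) (om : config) := om None = s /\ om (Some 0) = s.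

Lemma M1_step_hand om : M1_step om None = om (Some (arrow (om None))).
Proof. by rewrite /M1_step /= add0r. Qed.

Lemma M1_step_site om x : M1_step om (Some x) =
  if x == 0 then om None else om (Some (x + arrow (om None))).
Proof. by []. Qed.

(** If the next arrow is opposed to [s], it is picked up and the arrow [s] is
    left there: the walker goes back, exchanges the opposed arrow for the
    arrow [s] of the old site, returns, and finds the arrow [s] it had left. *)
Lemma aligned_step s om : aligned s om ->
  aligned s (M1_step om) \/
  [/\ M1_step om None = ~~ s, M1_step (M1_step om) None = s &
      aligned s (M1_step (M1_step (M1_step om)))].
Proof.
move=> [h0 t0]; case E : (om (Some (arrow s)) == s).
  by left; split; [rewrite M1_step_hand h0; apply/eqP|rewrite M1_step_site eqxx].
have {}E : om (Some (arrow s)) = ~~ s by move: E; case: (om _); case: (s).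
have e1 : M1_step om None = ~~ s by rewrite M1_step_hand h0.
have a1 : arrow (~~ s) + arrow s = 0 by case: (s).
have a0 : (arrow (~~ s) == 0) = false by case: (s).
have a0' : (arrow s == 0) = false by case: (s).
have e2 : M1_step (M1_step om) None = s.
  by rewrite M1_step_hand e1 M1_step_site a0 h0 a1.
have e3 : M1_step (M1_step om) (Some (arrow s)) = s.
  by rewrite M1_step_site a0' e1 [_ + arrow _]addrC a1 M1_step_site eqxx.
right; split=> //; split; first by rewrite M1_step_hand e2.
by rewrite M1_step_site eqxx.
Qed.

(** One site per step, or one site per three steps; the constant 3 covers
    a final incomplete group of three steps. *)
Lemma aligned_progress s om n : aligned s om ->
  (n%:Z <= 3 * (arrow s * (M1_chain om n).2) + 3)%R.
Proof.
have a1 : arrow s * arrow s = 1 :> int by case: (s).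
have a2 : arrow s * arrow (~~ s) = -1 :> int by case: (s).
elim/ltn_ind: n om => n IH om al; case: n IH => [|n] IH; first by rewrite /= mulr0.
have [al1|[e1 e2 al3]] := aligned_step al.
  rewrite M1_chain_pos_S mulrDr al.1 a1.
  by have := IH n (ltnSn n) _ al1; lia.
case: n IH => [|[|n]] IH.
- by rewrite M1_chain_pos_S al.1 addr0 a1; lia.
- by rewrite 2!M1_chain_pos_S addr0 mulrDr al.1 e1 a1 a2; lia.
rewrite 3!M1_chain_pos_S !mulrDr al.1 e1 e2 a1 a2.
by have := IH n (leq_trans (ltnSn n) (leq_addl 2 n.+1)) _ al3; lia.
Qed.

Lemma aligned_soon om : exists n s, (n <= 3)%N /\ aligned s (M1_chain om n).1.
Proof.
pose h := om None; pose s1 := om (Some (arrow h)).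
have [e|ne] := eqVneq s1 h.
  exists 1%N, h; split=> //; rewrite (_ : (M1_chain om 1).1 = M1_step om) //.
  split.
    by rewrite M1_step_hand.
  by rewrite M1_step_site eqxx.
have e1 : M1_step om None = ~~ h.
  by rewrite M1_step_hand -/h -/s1; move: ne; case: (s1); case: (h).
have a1 : arrow (~~ h) + arrow h = 0 by case: (h).
have a0 : (arrow (~~ h) == 0) = false by case: (h).
have e2 : M1_step (M1_step om) None = om (Some 0).
  by rewrite M1_step_hand e1 M1_step_site a0 -/h a1.
have [e|ne'] := eqVneq (om (Some 0)) (~~ h).
  exists 2%N, (~~ h); split=> //; rewrite (_ : (M1_chain om 2).1 = M1_step (M1_step om)) //.
  split; first by rewrite e2.
  by rewrite M1_step_site eqxx.
have e2' : M1_step (M1_step om) None = h.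
  by rewrite e2; move: ne'; case: (om _); case: (h).
have a0' : (arrow h == 0) = false by case: (h).
have e3 : M1_step (M1_step om) (Some (arrow h)) = h.
  by rewrite M1_step_site a0' e1 [_ + arrow _]addrC a1 M1_step_site eqxx.
exists 3%N, h; split=> //.
rewrite (_ : (M1_chain om 3).1 = M1_step (M1_step (M1_step om))) //.
split; first by rewrite M1_step_hand e2'.
by rewrite M1_step_site eqxx.
Qed.

Lemma M1_chain_dist om n : (absz (M1_chain om n).2 <= n)%N.
Proof.
elim: n => //= n; case: (M1_chain om n) => eta x /=.
by rewrite /arrow; case: ifP => _; lia.
Qed.

Lemma M1_ballistic om n : (n <= 3 * absz (M1_chain om n).2 + 15)%N.
Proof.
have [n0 [s [n03 al]]] := aligned_soon om.
have [nn|nn] := leqP n n0; first by lia.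
rewrite -(subnKC (ltnW nn)) M1_chain_add /=.
have := aligned_progress (n - n0) al; have := M1_chain_dist om n0.
by case: (s) => /=; lia.
Qed.

End Deterministic.

Section M1.
Context d (T : measurableType d) (R : realType) (P : probability T R).
Variable h : nat -> {RV P >-> R}.
Hypothesis hclock : rate1_clock h.

Definition overtime (eps : R) n : set T := [set w | (1 + eps) * n%:R <= jump_time h n w].

Lemma measurable_overtime eps n : measurable (overtime eps n).
Proof.
rewrite -[X in measurable X]setTI; apply: measurable_fun_ler => //.
exact: measurable_jump_time.
Qed.

Lemma prob_limsup_overtime eps : 0 < eps -> P (lim_sup_set (overtime eps)) = 0%E.
Proof.
move=> e0; apply: lim_sup_set_cvg0; first exact: measurable_overtime.
pose r := (1 + eps) * expR (- eps).
have r01 : 0 <= r < 1.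
  rewrite mulr_ge0 ?expR_ge0//=; last by lra.
  by rewrite /r expRN ltr_pdivrMr ?expR_gt0// mul1r expR_gt1Dx// gt_eqF.
have term n : (P (overtime eps n) <= (r ^+ n)%:E)%E.
  (* This choice optimises the Chernoff bound: it gives the ratio r < 1. *)
  pose th := eps / (1 + eps).
  have th0 : 0 < th by rewrite divr_gt0//; lra.
  have th1 : th < 1 by rewrite /th ltr_pdivrMr; lra.
  have := jump_time_chernoff hclock n (eps * n%:R) th1.
  have -> : [set w | (eps * n%:R <= th * jump_time h n w)%R] = overtime eps n.
    have E : eps * n%:R = th * ((1 + eps) * n%:R) by rewrite /th; field; rewrite gt_eqF//; lra.
    by apply/seteqP; split => w /=; rewrite E ler_pM2l.
  move=> H; apply: (le_trans H); rewrite lee_fin le_eqVlt; apply/orP; left; apply/eqP.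
  rewrite /r exprMn mulrC; congr (_ * _).
    by congr (_ ^+ _); rewrite /th; field; rewrite !gt_eqF//; lra.
  by rewrite -expRM_natl; congr expR; ring.
apply: (@le_lt_trans _ _ ((1 - r)^-1)%:E); last exact: ltry.
apply: lime_le; first exact: is_cvg_nneseries.
apply: nearW => m; apply: (@le_trans _ _ (\sum_(0 <= n < m) (r ^+ n)%:E)%E).
  by apply: lee_sum => n _; exact: term.
by rewrite sumEFin lee_fin big_mkord geom_sum_le.
Qed.

(** The clock violates the law of large numbers from above, or explodes. *)
Definition exceptional : set T :=
  (\bigcup_p lim_sup_set (overtime p.+1%:R^-1)) `|` (\bigcup_k stuck h k%:R).

Lemma exceptional_negligible : P.-negligible exceptional.
Proof.
apply: negligibleU; apply: negligible_bigcup => p.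
  exists (lim_sup_set (overtime p.+1%:R^-1)); split=> //.
    apply: bigcap_measurable; first by exists 0%N.
    by move=> k _; apply: bigcup_measurable => j _; exact: measurable_overtime.
  by apply: prob_limsup_overtime; rewrite invr_gt0.
exists (stuck h p%:R); split=> //; first exact: measurable_stuck.
exact: prob_stuck.
Qed.

(** The jump number [N + 1] comes after [t], so that [t < (1 + eps) (N + 1)]
    outside the exceptional set, while [N <= 3 |X| + 15]. *)
Lemma M1_speed om w : ~ exceptional w ->
  ((3^-1 : R)%:E <=
    limf_einf (fun t : R =>
      (`|(M1_position om (fun n => h n w) t)%:~R : R| / t)%:E) (pinfty_nbhs R))%E.
Proof.
move=> /not_orP[wF wS]; rewrite limf_einfE.
apply/lee_addgt0Pr => e e0.
pose p := Num.truncn e^-1; pose eps : R := p.+1%:R^-1.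
have eps0 : 0 < eps by rewrite invr_gt0.
have epse : eps <= e.
  by rewrite -[leRHS]invrK lef_pV2 ?posrE ?invr_gt0// ltW// truncnS_gt.
have [m0 Hm0] : exists m0, forall m, (m0 <= m)%N -> jump_time h m w < (1 + eps) * m%:R.
  apply: contrapT => /forallNP Hn; apply: wF; exists p => // k _.
  have /existsNP[m /not_implyP[km /negP]] := Hn k.
  by rewrite -leNgt => ?; exists m.
pose B : R := \sum_(k < m0) `|jump_time h k w|.
have HB k : (k < m0)%N -> jump_time h k w <= B.
  move=> km; rewrite /B (bigD1 (Ordinal km)) //= (le_trans (ler_norm _))//.
  by rewrite lerDl sumr_ge0.
have some t : exists n, t < \sum_(k < n.+1) h k w.
  apply: contrapT => /forallNP Hn; apply: wS.
  exists (Num.truncn `|t|).+1 => // n.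
  have tk : t <= (Num.truncn `|t|).+1%:R.
    by rewrite (le_trans (ler_norm t))// ltW// truncnS_gt.
  case: n => [|n]; first by rewrite /jump_time big_ord0.
  by apply: le_trans tk; rewrite leNgt; apply/negP; exact: Hn.
(* Past B the clock has gone through the index m0, and past 16 / eps the constant of the deterministic bound is negligible. *)
pose A := Num.max 1 (Num.max B (16 / eps)).
rewrite -leeBlDr//.
apply: (@le_trans _ _ (ereal_inf ((fun t : R =>
   (`|(M1_position om (fun n => h n w) t)%:~R : R| / t)%:E) @` [set t | A < t]))).
  apply: le_ereal_inf_tmp => _ [t /= At <-].
  move: At; rewrite !gt_max => /and3P[t1 Bt et].
  set N := jump_count (fun n => h n w) t.
  have tN : t < jump_time h N.+1 w := jump_count_some (some t).
  have m0N : (m0 <= N.+1)%N.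
    by rewrite leqNgt; apply/negP => /HB /(lt_le_trans tN) /(lt_trans Bt); rewrite ltxx.
  have {}tN : t < (1 + eps) * N.+1%:R := lt_trans tN (Hm0 _ m0N).
  have t0 : 0 < t by exact: lt_trans t1.
  have NX : N.+1%:R <= 3 * `|(M1_chain om N).2%:~R| + 16 :> R.
    rewrite -intr_norm -abszE -!(natrM, natrD) ler_nat.
    by have := M1_ballistic om N; clear; lia.
  have {}et : 16 < t * eps by rewrite -ltr_pdivrMr.
  have ee : eps * t <= e * t by rewrite ler_pM2r.
  rewrite lee_fin ler_pdivlMr// /M1_position -/N.
  move: NX tN; set y := `|_|; move: (N.+1%:R : R) => z NX tN.
  have [zt|tz] := lerP z t.
    have ez : eps * z <= eps * t by rewrite ler_pM2l.
    by clear -ez NX tN ee et e0 t0; nra.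
  by clear -tz NX ee et e0 t0; nra.
apply: ereal_sup_ubound; exists [set t | A < t] => //.
exists A; split => //; exact: num_real.
Qed.

End M1.

Theorem theorem1p6 (R : realType) :
  (forall (d : measure_display) (T : measurableType d) (P : probability T R)
     (om : config) (h : nat -> {RV P >-> R}),
     rate1_clock h ->
     {ae P, forall w,
       ((3^-1 : R)%:E <=
        limf_einf (fun t : R =>
          (`|(M1_position om (fun n => h n w) t)%:~R : R| / t)%:E) (pinfty_nbhs R))%E})
  /\
  (exists C D : R, [/\ 0 < C, 0 < D &
     forall (d : measure_display) (T : measurableType d) (P : probability T R)
       (om : option int -> {RV P >-> bool}) (b a : nat -> {RV P >-> bool})
       (h : nat -> {RV P >-> R}),
       M2_noise om b a h ->
       (forall l0 : T -> int -> int,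
          (forall w x, - grad (l0 w) x = arrows_at (fun y => om y w) x) ->
          is_TSAW P l0
            (fun n w =>
               (M2_chain (fun y => om y w) (fun m => b m w) (fun m => a m w) n).2))
       /\
       (forall t : R, 1 <= t ->
          let E := 'E_P[fun w =>
            (`|(M2_position (fun y => om y w) (fun m => b m w) (fun m => a m w)
                 (fun n => h n w) t)%:~R : R| ^+ 2)%R]%E in
          ((C * t `^ (4 / 3))%:E <= E)%E /\ (E <= (D * t `^ (4 / 3))%:E)%E)]).
Proof.
split=> [d T P om h hclock|].
  apply: negligibleS (exceptional_negligible hclock) => w /= slow.
  by apply: contrapT => /(M1_speed om).
have [C C0 lower] := M2_lower R; have [D D0 upper] := M2_upper R.
exists C, D; split=> // d T P om b a h noiseP; split=> [l0 hl0|t t1].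
  have tsaw := M2_is_TSAW noiseP hl0; exact: tsaw.
by split; [exact: lower noiseP t1|exact: upper noiseP t1].
Qed.
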